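(* Let $1<p<5$ and let $f:\mathbb{R}\to\mathbb{R}$ satisfy $|f(s)|\lesssim s^{\frac{p-1}{2}}$ for $s\ge 0$, with $s\mapsto f(s^2)$ locally Lipschitz continuous. Then there exists $\varepsilon>0$ (small) such that the following holds. If $u$ is a global odd solution in $H^1(\mathbb{R})$ of $$iu_t+u_{xx}=f(|u|^2)u,\qquad (t,x)\in\mathbb{R}\times\mathbb{R},$$ with $\|u(0)\|_{H^1(\mathbb{R})}\le\varepsilon$, then for every bounded interval $I\subset\mathbb{R}$, $$\lim_{t\to\infty}\Big(\|u(t)\|_{L^2(I)}+\|u(t)\|_{L^\infty(I)}\Big)=0.$$ Moreover, if the equation is defocusing, i.e. $f(s)=s^{\frac{p-1}{2}}$ for $s\ge 0$, the same conclusion holds for every global odd solution in $H^1(\mathbb{R})$, without the smallness condition on $u(0)$.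
   Context: $u$ is complex-valued. A global odd solution in $H^1(\mathbb{R})$ is a function $u\in C(\mathbb{R};H^1(\mathbb{R}))$ satisfying the equation (in $H^{-1}(\mathbb{R})$) for all $t\in\mathbb{R}$, such that $u(t,-x)=-u(t,x)$ for all $t,x$. *)

(* Defs.v *)
From HB Require Import structures.
From mathcomp Require Import all_boot all_order all_algebra.
From mathcomp Require Import complex.
From mathcomp Require Import all_classical all_reals all_analysis.

Set Implicit Arguments.
Unset Strict Implicit.
Unset Printing Implicit Defensive.

Import Order.TTheory GRing.Theory Num.Theory.
Import numFieldNormedType.Exports.

Local Open Scope classical_set_scope.
Local Open Scope ring_scope.
Local Open Scope complex_scope.

(* Elements of L^2(R), H^1(R) are arbitrary Borel representatives R -> R[i];
   every notion below depends only on the class modulo a.e. equality. *)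
Section function_spaces.
Variable R : realType.
Local Notation mu := (@lebesgue_measure R).
Implicit Types (g w v phi : R -> R[i]).

Local Notation cmod := (@Normc.normc R).

Definition Lpnorm (q : \bar R) g : \bar R := 'N[mu]_q[EFin \o cmod \o g].

Definition Lpnorm_on (I : set R) (q : \bar R) g : \bar R :=
  'N[mu]_q[(EFin \o cmod \o g) \_ I].

Definition cmeasurable g :=
  measurable_fun setT (fun x => complex.Re (g x)) /\
  measurable_fun setT (fun x => complex.Im (g x)).

Definition cintegral g : R[i] :=
  (\int[mu]_x complex.Re (g x))%R +i* (\int[mu]_x complex.Im (g x))%R.

Definition L2 : set (R -> R[i]) :=
  [set g | cmeasurable g /\ (Lpnorm 2%:E g < +oo)%E].

Definition C1c (eta : R -> R) :=
  [/\ forall x : R, derivable eta x 1,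
      continuous (derive1 eta) &
      compact (closure [set x | eta x != 0])].

(* Test functions are C^1 with compact support, as in Brezis's definition of
   W^{1,p} of an interval; density gives the same notion as with C^oo ones. *)
Definition weak_derivative g w :=
  forall eta : R -> R, C1c eta ->
    cintegral (fun x => g x * (derive1 eta x)%:C) =
    - cintegral (fun x => w x * (eta x)%:C).

Definition H1 : set (R -> R[i]) :=
  [set g | L2 g /\ exists2 w, L2 w & weak_derivative g w].

(* For g in H1, a representative of its weak derivative (unique a.e.). *)
Definition dx g : R -> R[i] :=
  xget (fun=> 0) [set w | L2 w /\ weak_derivative g w].

Definition H1norm g : \bar R :=
  ((Lpnorm 2%:E g ^+ 2 + Lpnorm 2%:E (dx g) ^+ 2) `^ 2^-1)%E.

(* H^{-1}(R) is the topological dual of H^1(R), with C-bilinear pairing;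
   only the values of a functional on H1 are relevant. *)
Definition Hm1norm (T : (R -> R[i]) -> R[i]) : \bar R :=
  ereal_sup [set (cmod (T phi))%:E |
             phi in [set phi | H1 phi /\ (H1norm phi <= 1)%E]].

Definition Hm1 : set ((R -> R[i]) -> R[i]) :=
  [set T | (forall (a : R[i]) phi psi, H1 phi -> H1 psi ->
              T (fun x => a * phi x + psi x) = a * T phi + T psi) /\
           (Hm1norm T < +oo)%E].

Definition Hm1_eq (S T : (R -> R[i]) -> R[i]) := forall phi, H1 phi -> S phi = T phi.

Definition Hm1_of_fun g : (R -> R[i]) -> R[i] :=
  fun phi => cintegral (fun x => g x * phi x).

Definition Hm1_dxx v : (R -> R[i]) -> R[i] :=
  fun phi => - cintegral (fun x => dx v x * dx phi x).

Definition Hm1_is_time_derivative (u : R -> R -> R[i]) (t : R)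
    (T : (R -> R[i]) -> R[i]) :=
  Hm1 T /\
  Hm1norm (fun phi =>
      Hm1_of_fun (fun x => (u (t + h) x - u t x) / h%:C) phi - T phi)
    @[h --> 0^'] --> 0%E.

Definition continuous_in_H1 (u : R -> R -> R[i]) :=
  (forall t, H1 (u t)) /\
  forall t0, H1norm (fun x => u t x - u t0 x) @[t --> t0] --> 0%E.

(* i u_t + u_xx = f(|u|^2) u in H^{-1}(R), at every time t in R *)
Definition solves_NLS (f : R -> R) (u : R -> R -> R[i]) :=
  forall t, exists2 ut, Hm1_is_time_derivative u t ut &
    Hm1_eq (fun phi => 'i%C * ut phi + Hm1_dxx (u t) phi)
           (Hm1_of_fun (fun x => (f (cmod (u t x) ^+ 2))%:C * u t x)).

Definition global_odd_H1_solution (f : R -> R) (u : R -> R -> R[i]) :=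
  [/\ continuous_in_H1 u,
      solves_NLS f u &
      forall t, {ae mu, forall x, u t (- x) = - u t x}].

Definition locally_decays (u : R -> R -> R[i]) :=
  forall I : set R, is_interval I -> bounded_set I ->
    (Lpnorm_on I 2%:E (u t) + Lpnorm_on I +oo%E (u t))%E @[t --> +oo] --> 0%E.

Definition locally_lipschitz (g : R -> R) :=
  forall a : R, exists2 r : R, 0 < r & [lipschitz g s | s in ball a r].

End function_spaces.

(* Main.v *)
(* The proof is a virial argument on the half line. Write [u = a + i b]; oddness gives
   [a 0 = b 0 = 0]. With [psi x = 1 - exp(-x)] for [x > 0] and [psi x = 0] for [x <= 0], the
   quantity [J = int psi (a b_x - b a_x)] is bounded along the flow, and, with
   [kappa = psi' = exp(-x)] on the right half line,
     [J' = 2 int kappa ((a_x - a/2)^2 + (b_x - b/2)^2) + int kappa V(|u|)],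
   where [V s = s^2 f(s^2) - int_0^{s^2} f]. In the defocusing case [V >= 0]; for small data [V]
   is cubic in [|u|], since [s |-> f(s^2)] is locally Lipschitz, and its contribution is absorbed
   by the quadratic form, because [int kappa |a|^3 <= 36 (sup |a|) int kappa (a_x - a/2)^2] when
   [a 0 = 0]. The H^1 norm stays bounded (and small) by conservation of mass and energy. As the
   quadratic form controls a Gaussian-weighted mass, this mass is integrable in time; its time
   derivative is bounded, so it tends to 0, and interpolation with the gradient gives local uniform
   decay. *)
Require Import Defs.
From HB Require Import structures.
From mathcomp Require Import all_boot all_order all_algebra.
From mathcomp Require Import complex.
From mathcomp Require Import all_classical all_reals all_analysis.
From mathcomp Require Import measurable_realfun ess_sup_inf ring lra.

Set Implicit Arguments.
Unset Strict Implicit.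
Unset Printing Implicit Defensive.

Import Order.TTheory GRing.Theory Num.Theory.
Import numFieldNormedType.Exports.

Local Open Scope classical_set_scope.
Local Open Scope ring_scope.

(** * Square integrable functions *)

Section integrable_functions.
Variable R : realType.
Local Notation mu := (@lebesgue_measure R).
Implicit Types (f g h : R -> R) (D E : set (measurableTypeR R)).

(** The solution lies only in H^1 and the equation holds in H^{-1}, so neither the energy nor [J]
    can be differentiated by inserting the equation into it. All the identities come from one
    bilinear formula, [bilinear_derivative], for the weighted symplectic pairing of two solutions,
    in which the products of two derivatives cancel. The second solution is the image of the first
    under a symmetry of the equation: multiplication by [i] gives the mass, a time translation the
    energy, a space translation the virial identity. In the last two cases the pairing is divided by
    the length of the translation and its derivative is passed to the limit; the nonlinear remainder
    is controlled by a trapezoidal rule, with an error quadratic in the increment of the solution.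
    The shape of the quadratic form comes from [exp(-x/2) (a_x - a/2)] being the derivative of
    [exp(-x/2) a]: starting from the zero of [a] at the origin, the form bounds [a] pointwise on the
    right half line up to an exponential factor, which the Gaussian weight absorbs. On the left half
    line the evenness of [|u|] takes over. *)

Definition itg D f := mu.-integrable D (EFin \o f).

Definition sqi D f := measurable_fun D f /\ itg D (fun x => f x ^+ 2).

Lemma itg_meas D f : itg D f -> measurable_fun D f.
Proof. by move=> fi; apply/measurable_EFinP; exact: (measurable_int mu). Qed.

Lemma itgS D E f : measurable D -> measurable E -> E `<=` D -> itg D f -> itg E f.
Proof. by move=> mD mE ED; exact: integrableS. Qed.

Lemma sqiS D E f : measurable D -> measurable E -> E `<=` D -> sqi D f -> sqi E f.
Proof.
move=> mD mE ED [mf f2]; split; first exact: measurable_funS mf.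
exact: itgS f2.
Qed.

Lemma eq_itg D f g : measurable D -> (forall x, D x -> f x = g x) -> itg D f -> itg D g.
Proof.
by move=> mD fg fi; apply: eq_integrable fi => // x; rewrite inE => Dx /=; rewrite fg.
Qed.

Lemma eq_int D f g : (forall x, D x -> f x = g x) ->
  \int[mu]_(x in D) f x = \int[mu]_(x in D) g x.
Proof. by move=> fg; apply: eq_Rintegral => x; rewrite inE; exact: fg. Qed.

Lemma itgD D f g : measurable D -> itg D f -> itg D g -> itg D (fun x => f x + g x).
Proof. by rewrite /itg => mD fi gi; apply: eq_integrable (integrableD mD fi gi). Qed.

Lemma itgB D f g : measurable D -> itg D f -> itg D g -> itg D (fun x => f x - g x).
Proof. by rewrite /itg => mD fi gi; apply: eq_integrable (integrableB mD fi gi). Qed.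

Lemma itgZ D f (c : R) : measurable D -> itg D f -> itg D (fun x => c * f x).
Proof. by rewrite /itg => mD fi; apply: eq_integrable (integrableZl mD c fi). Qed.

Lemma itg_norm D f : itg D f -> itg D (fun x => `|f x|).
Proof. by move=> fi; exact: integrable_norm. Qed.

Lemma itg_dom D f g : measurable D -> measurable_fun D f -> itg D g ->
  (forall x, D x -> `|f x| <= g x) -> itg D f.
Proof.
move=> mD mf gi fg; apply: le_integrable gi => //; first exact/measurable_EFinP.
by move=> x Dx /=; rewrite lee_fin (le_trans (fg _ Dx))// ler_norm.
Qed.

Lemma intN D f : measurable D -> itg D f ->
  \int[mu]_(x in D) (- f x) = - \int[mu]_(x in D) f x.
Proof.
move=> mD fi; rewrite -[RHS]mulN1r -RintegralZl//.
by apply: eq_int => x _; rewrite mulN1r.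
Qed.

Lemma int_norm D f (M : R) : measurable D -> itg D f ->
  (\int[mu]_(x in D) `|f x| <= M) -> `|\int[mu]_(x in D) f x| <= M.
Proof. by move=> mD fi; apply: le_trans; exact: le_normr_Rintegral. Qed.

Lemma le_int D f g : measurable D -> itg D f -> itg D g ->
  (forall x, D x -> f x <= g x) ->
  \int[mu]_(x in D) f x <= \int[mu]_(x in D) g x.
Proof. by move=> mD fi gi fg; apply: le_Rintegral. Qed.

Lemma ge0_int_subset D E f : measurable D -> measurable E -> E `<=` D -> itg D f ->
  (forall x, 0 <= f x) ->
  \int[mu]_(x in E) f x <= \int[mu]_(x in D) f x.
Proof.
move=> mD mE ED fi f0; rewrite (Rintegral_mkcond _ E) (Rintegral_mkcond _ D).
have r0 (A : set R) : measurable A -> itg A f -> itg setT (f \_ A).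
  move=> mA fA; rewrite /itg -restrict_EFin.
  by apply/integrable_restrict => //; rewrite setTI.
apply: le_int => //; first by apply: r0 => //; exact: itgS fi.
  exact: r0.
move=> x _; rewrite !patchE; case: ifPn => [/set_mem/ED/mem_set ->//|_].
by case: ifPn.
Qed.

Lemma sqi_itgM D f g : measurable D -> sqi D f -> sqi D g -> itg D (fun x => f x * g x).
Proof.
move=> mD [mf f2] [mg g2]; apply: (itg_dom _ _ (itgD _ f2 g2)) => //.
  exact: measurable_funM.
move=> x Dx; rewrite normrM -(real_normK (num_real (f x))).
rewrite -(real_normK (num_real (g x))).
have := sqr_ge0 (`|f x| - `|g x|); have := normr_ge0 (f x); have := normr_ge0 (g x).
by nra.
Qed.

Lemma sqiD D f g : measurable D -> sqi D f -> sqi D g -> sqi D (fun x => f x + g x).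
Proof.
move=> mD sf sg; have [mf f2] := sf; have [mg g2] := sg.
split; first exact: measurable_funD.
apply: (eq_itg mD _ (itgD mD (itgD mD f2 (itgZ 2 mD (sqi_itgM mD sf sg))) g2)) => x _.
by ring.
Qed.

Lemma sqiM D f g (M : R) : measurable D -> measurable_fun D f ->
  (forall x, D x -> `|f x| <= M) -> sqi D g -> sqi D (fun x => f x * g x).
Proof.
move=> mD mf fM [mg g2]; split; first exact: measurable_funM.
apply: (itg_dom _ _ (itgZ (M ^+ 2) mD g2)) => //.
  by apply: measurable_funX; exact: measurable_funM.
move=> x Dx; rewrite ger0_norm ?sqr_ge0// exprMn ler_wpM2r ?sqr_ge0//.
by rewrite -(real_normK (num_real (f x))) lerXn2r// ?nnegrE ?(le_trans _ (fM x Dx)).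
Qed.

Lemma sqiZ D f (c : R) : measurable D -> sqi D f -> sqi D (fun x => c * f x).
Proof.
move=> mD sf; apply: (@sqiM _ (fun=> c) _ `|c|) => //.
Qed.

Lemma sqiN D f : measurable D -> sqi D f -> sqi D (fun x => - f x).
Proof.
move=> mD sf; have := sqiZ (-1) mD sf.
by congr sqi; apply/funext => x; rewrite mulN1r.
Qed.

Lemma sqiB D f g : measurable D -> sqi D f -> sqi D g -> sqi D (fun x => f x - g x).
Proof. by move=> mD sf sg; apply: sqiD => //; exact: sqiN. Qed.

Lemma sqi_norm D f : measurable D -> sqi D f -> sqi D (fun x => `|f x|).
Proof.
move=> mD [mf f2]; split; first exact: measurableT_comp.
by apply: (eq_itg mD _ f2) => x _; rewrite real_normK// num_real.
Qed.

(** The integral of [(t f + g)^2] is a quadratic polynomial in [t] without negative values; it is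
    evaluated at its minimum [- B / A]. *)
Lemma CauchySchwarz D f g : measurable D -> sqi D f -> sqi D g ->
  (\int[mu]_(x in D) (f x * g x)) ^+ 2 <=
  (\int[mu]_(x in D) (f x ^+ 2)) * (\int[mu]_(x in D) (g x ^+ 2)).
Proof.
move=> mD sf sg; set A := \int[mu]_(x in D) (f x ^+ 2).
set B := \int[mu]_(x in D) _; set C := \int[mu]_(x in D) _.
have A0 : 0 <= A by apply: Rintegral_ge0 => x _; exact: sqr_ge0.
have P t : 0 <= t ^+ 2 * A + 2 * t * B + C.
  have -> : t ^+ 2 * A + 2 * t * B + C = \int[mu]_(x in D) (t * f x + g x) ^+ 2.
    rewrite /A /B /C -!RintegralZl//; last 2 first.
    - exact: sqi_itgM.
    - exact: sf.2.
    rewrite -RintegralD//; last 2 first.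
    - exact: itgZ sf.2.
    - exact: itgZ (sqi_itgM mD sf sg).
    rewrite -RintegralD//; last 2 first.
    - by apply: itgD => //; [exact: itgZ sf.2|exact: itgZ (sqi_itgM mD sf sg)].
    - exact: sg.2.
    by apply: eq_int => x _; ring.
  by apply: Rintegral_ge0 => x _; exact: sqr_ge0.
have [A_eq0|A_neq0] := eqVneq A 0.
  rewrite A_eq0 mul0r; have [->|B0] := eqVneq B 0; first by rewrite expr0n.
  (* For [A = 0] the polynomial is affine in [t]; if [B] were nonzero, this value of [t] would make
     it equal to -1. *)
  have := P (- (C + 1) / (2 * B)); rewrite A_eq0 mulr0 add0r.
  have -> : 2 * (- (C + 1) / (2 * B)) * B + C = -1 by field.
  by rewrite ler0N1.
have Agt : 0 < A by rewrite lt_def A_neq0.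
have := P (- B / A); have -> : (- B / A) ^+ 2 * A + 2 * (- B / A) * B + C =
  C - B ^+ 2 / A by field.
by rewrite subr_ge0 ler_pdivrMr// mulrC.
Qed.

Lemma int_sqD D f g : measurable D -> sqi D f -> sqi D g ->
  \int[mu]_(x in D) ((f x + g x) ^+ 2) <=
  2 * \int[mu]_(x in D) (f x ^+ 2) + 2 * \int[mu]_(x in D) (g x ^+ 2).
Proof.
move=> mD sf sg; rewrite -!RintegralZl//; [|exact: sg.2|exact: sf.2].
rewrite -RintegralD//; [|exact: itgZ sf.2|exact: itgZ sg.2].
apply: le_int => //; first exact: (sqiD mD sf sg).2.
  by apply: itgD => //; [exact: itgZ sf.2|exact: itgZ sg.2].
by move=> x _; have := sqr_ge0 (f x - g x); nra.
Qed.

(** By uniqueness of Lebesgue measure: its image under a translation gives half-open intervals the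
    same length. *)
Lemma lebesgue_measure_shift (c : R) D : measurable D ->
  pushforward mu ((fun x => x + c) : measurableTypeR R -> measurableTypeR R) D = mu D.
Proof.
move=> mD; apply/esym.
have mf : measurable_fun setT ((fun x => x + c) : measurableTypeR R -> measurableTypeR R).
  exact: measurable_funD.
pose f : {mfun measurableTypeR R >-> measurableTypeR R} :=
  HB.pack ((fun x => x + c) : measurableTypeR R -> measurableTypeR R) (isMeasurableFun.Build _ _ _ _ _ mf).
have := @lebesgue_measure_unique R (pushforward mu f : {measure set _ -> \bar R}).
apply => //= _ [[a b]] _ <-.
rewrite /pushforward/=.
have -> : (fun x : R => x + c) @^-1` `]a, b] = `]a - c, b - c]%classic.
  apply/seteqP; split => x /=; rewrite !in_itv/= => /andP[h1 h2]; apply/andP; split; lra.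
rewrite !lebesgue_measure_itv/= !lte_fin ltrD2r; case: ifPn => // _.
by rewrite -!EFinB; congr EFin; lra.
Qed.

Lemma measurable_shift (c : R) :
  measurable_fun setT ((fun x => x + c) : measurableTypeR R -> measurableTypeR R).
Proof. exact: measurable_funD. Qed.

Lemma itg_shift f (c : R) : itg setT f -> itg setT (fun x => f (x + c)).
Proof.
move=> fi; have mf := itg_meas fi.
apply/integrableP; split.
  apply/measurable_EFinP; apply: (measurableT_comp mf); exact: measurable_shift.
move/integrableP : fi => [_]; apply: le_lt_trans; rewrite le_eqVlt; apply/orP; left; apply/eqP.
have h := @ge0_integral_pushforward _ _ _ _ R _ (measurable_shift c) mu setT
  (fun x => `|(f x)%:E|%E).
rewrite preimage_setT in h; rewrite -[LHS]h//; last by do 2 apply: measurableT_comp => //.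
apply: (eq_measure_integral mu); first exact: measurable_shift.
by move=> mT A mA _; exact: lebesgue_measure_shift.
Qed.

Lemma int_shift f (c : R) : itg setT f ->
  \int[mu]_x f (x + c) = \int[mu]_x f x.
Proof.
move=> fi; have mf := itg_meas fi; rewrite /Rintegral; congr fine.
have h := @integral_pushforward _ _ _ _ R _ (measurable_shift c) mu setT (EFin \o f).
rewrite preimage_setT in h; rewrite -[LHS]h//; [|exact/measurable_EFinP|exact: itg_shift].
apply: (eq_measure_integral mu); first exact: measurable_shift.
by move=> mT A mA _; exact: lebesgue_measure_shift.
Qed.

Lemma sqi_shift f (c : R) : sqi setT f -> sqi setT (fun x => f (x + c)).
Proof.
move=> [mf f2]; split; last exact: (itg_shift c f2).
apply: (measurableT_comp mf); exact: measurable_shift.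
Qed.

End integrable_functions.

(** * Absolutely continuous functions *)

Section real_calculus.
Variable R : realType.
Local Notation mu := (@lebesgue_measure R).
Implicit Types (f g h w k : R -> R) (D E : set (measurableTypeR R)).

(** This form has no division and includes [y = x]; estimates on increments, such as bounds by
    integrals or limits of mean value inequalities, apply to it directly. *)
Lemma is_derive_epsP g (x d : R) :
  (forall e : R, 0 < e -> exists2 r : R, 0 < r &
     forall y, `|y - x| < r -> `|g y - g x - d * (y - x)| <= e * `|y - x|) <->
  is_derive x (1 : R) g d.
Proof.
split=> [H|dg].
  have cv : h^-1 *: (g (h *: (1 : R) + x) - g x) @[h --> 0^'] --> d.
    apply/cvgrPdist_le => e e0; have [r r0 Hr] := H e e0.
    near=> h.
    have h0 : h != 0 by near: h; exact: nbhs_dnbhs_neq.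
    have hr : `|h| < r.
      near: h; apply: dnbhs0_lt => //.
    have := Hr (h + x); rewrite addrK => /(_ hr).
    rewrite /= [h *: _]mulr1 [_ *: _]mulrC => E.
    have nh : 0 < `|h| by rewrite normr_gt0.
    by rewrite -(ler_pM2r nh) -normrM mulrBl mulfVK// distrC.
  apply: DeriveDef; first by apply/cvg_ex; exists d.
  exact/cvg_lim.
have /cvgrPdist_le H : h^-1 *: ((g \o shift x) (h *: (1 : R)) - g x) @[h --> 0^'] --> 'D_1 g x.
  exact: ex_derive.
move=> e e0; have [r /= r0 Hr] := H e e0; exists r => // y yx.
have [->|yx0] := eqVneq y x; first by rewrite !subrr mulr0 normr0 mulr0 subr0 normr0.
have yx1 : y - x != 0 by rewrite subr_eq0.
have := Hr (y - x); rewrite /= ?sub0r ?subr0 ?normrN => /(_ yx yx1).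
rewrite /= [_ *: 1]mulr1 subrK [_^-1 *: _]mulrC derive_val => E.
have nh : 0 < `|y - x| by rewrite normr_gt0.
by move: E; rewrite -(ler_pM2r nh) -normrM mulrBl mulfVK// distrC.
Unshelve. all: by end_near. Qed.

Lemma continuous_epsP g : (forall x e : R, 0 < e -> exists2 r : R, 0 < r &
     forall y, `|y - x| < r -> `|g y - g x| <= e) <-> continuous g.
Proof.
split=> [H x|cg x e e0].
  apply/cvgrPdist_le => e e0; have [r r0 Hr] := H x e e0; exists r => //= y yx.
  by rewrite distrC; apply: Hr; rewrite distrC.
have /cvgrPdist_le/(_ e e0)[r /= r0 Hr] := cg x; exists r => // y yx.
by rewrite distrC; apply: Hr; rewrite /= distrC.
Qed.

Lemma mitv (x y : R) : measurable (`[x, y] : set (measurableTypeR R)).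
Proof. exact: measurable_itv. Qed.

Lemma mray (x : R) : measurable (`[x, +oo[ : set (measurableTypeR R)).
Proof. exact: measurable_itv. Qed.

Hint Resolve mitv mray : core.

Lemma sub_itv (a b x y : R) : a <= x -> y <= b -> `[x, y]%classic `<=` `[a, b]%classic.
Proof. by move=> ax yb; apply: subset_itv; rewrite bnd_simp. Qed.

Lemma itg_cont g x y : continuous g -> itg `[x, y] g.
Proof.
move=> cg; apply: continuous_compact_integrable; first exact: segment_compact.
exact: continuous_subspaceT.
Qed.

Lemma cont_meas g D : measurable D -> continuous g -> measurable_fun D g.
Proof.
move=> mD cg; apply: (@measurable_funS _ _ _ _ setT) => //.
exact: continuous_measurable_fun.
Qed.

Lemma sqi_cont g x y : continuous g -> sqi `[x, y] g.
Proof.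
move=> cg; split; first exact: cont_meas.
have -> : (fun x => g x ^+ 2) = (fun x => g x * g x) by apply/funext => z; rewrite expr2.
by apply: itg_cont => z; apply: continuousM; exact: cg.
Qed.

Lemma sqi_itg g x y : sqi `[x, y] g -> itg `[x, y] g.
Proof.
move=> sg; have c1 : continuous (cst 1 : R -> R) by exact: cst_continuous.
apply: (eq_itg (mitv x y) _ (sqi_itgM (mitv x y) sg (sqi_cont x y c1))) => z _.
by rewrite mulr1.
Qed.

Lemma int_cst_itv x y (c : R) : x <= y -> \int[mu]_(z in `[x, y]) c = c * (y - x).
Proof.
move=> xy; rewrite Rintegral_cst//= lebesgue_measure_itv/= lte_fin.
case: ltP => [_|yx]; first by rewrite -EFinB.
have -> : y = x by apply/le_anti; rewrite xy yx.
by rewrite subrr !mulr0.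
Qed.

Lemma int_split f x y z : x <= y -> y <= z -> itg `[x, z] f ->
  \int[mu]_(t in `[x, z]) f t = \int[mu]_(t in `[x, y]) f t + \int[mu]_(t in `[y, z]) f t.
Proof.
move=> xy yz fi.
have := @Rintegral_itvB R f (BLeft x) (BRight z) y fi.
rewrite !bnd_simp => /(_ xy yz) /(canRL (subrK _)) ->; rewrite addrC; congr (_ + _).
rewrite Rintegral_itv_obnd_cbnd//; apply: itgS fi => //.
by move=> t /=; rewrite !in_itv/= => /andP[h1 h2]; apply/andP; split => //; lra.
Qed.

Lemma primitive_exists k : (forall x y, itg `[x, y] k) ->
  exists K : R -> R, forall x y, x <= y -> K y - K x = \int[mu]_(t in `[x, y]) k t.
Proof.
move=> ki; exists (fun y => if 0 <= y then \int[mu]_(t in `[0, y]) k t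
                           else - \int[mu]_(t in `[y, 0]) k t) => x y xy.
case: ifPn => y0; case: ifPn => x0.
- by rewrite (int_split x0 xy)// addrC addKr.
- by rewrite opprK [RHS](@int_split _ _ 0)// 1?addrC// ltW// ltNge.
- by have := le_trans x0 xy; rewrite (negbTE y0).
- by rewrite opprK (@int_split k x y 0)//; [ring|rewrite ltW// ltNge].
Qed.

(** Absolute continuity of the integral near a point, read off from the continuity of the indefinite
    integral of [|k|]. *)
Lemma int_local_small k (x e : R) : (forall x y, itg `[x, y] k) -> 0 < e ->
  exists2 r : R, 0 < r & \int[mu]_(t in `[x - r, x + r]) `|k t| <= e.
Proof.
move=> ki e0; have x1 : x - 1 < x + 1 by lra.
have nki : itg `[x - 1, x + 1] (fun t => `|k t|) by apply: itg_norm.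
have /within_continuous_continuous : {within `[x - 1, x + 1],
    continuous (fun z => parameterized_integral mu (x - 1) z (fun t => `|k t|))}.
  by apply: parameterized_integral_continuous => //; exact: ltW.
move=> /(_ x x1); rewrite in_itv/=.
have -> : (x - 1 < x < x + 1) by apply/andP; split; lra.
move=> /(_ isT)/cvgrPdist_le/(_ (e / 2) ltac:(by rewrite divr_gt0))[r /= r0 Hr].
set r' := Num.min (r / 2) 1; have r'0 : 0 < r' by rewrite lt_min ltr01 divr_gt0.
have r'1 : r' <= 1 by rewrite ge_min lexx orbT.
have r'r : r' < r by rewrite gt_min; apply/orP; left; lra.
exists r' => //.
have i0 a b : x - 1 <= a -> b <= x + 1 -> itg `[a, b] (fun t => `|k t|).
  by move=> ha hb; apply: itgS nki => //; exact: sub_itv.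
have := Hr (x + r'); have := Hr (x - r'); rewrite /parameterized_integral /=.
rewrite (@int_split _ (x - 1) (x - r') x) ?i0//; [|lra..].
rewrite (@int_split _ (x - 1) x (x + r')) ?i0//; [|lra..].
rewrite (@int_split _ (x - r') x (x + r')) ?i0//; [|lra..].
rewrite (@int_split _ (x - 1) (x - r') x) ?i0//; [|lra..].
rewrite (_ : x - (x - r') = r'); last ring.
rewrite (_ : x - (x + r') = - r'); last ring.
rewrite normrN gtr0_norm// => /(_ r'r) + /(_ r'r).
by rewrite !ler_norml => /andP[_ h1] /andP[h2 _]; lra.
Qed.

(** The difference of [G] and a primitive of [k] has increments of size [o(y - x)] near every point,
    so its derivative vanishes everywhere and it is constant. *)
Lemma int_critical G k : (forall x y, itg `[x, y] k) ->
  (forall x0 e : R, 0 < e -> exists2 r : R, 0 < r & forall x y, x0 - r < x -> x <= y ->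
     y < x0 + r -> `|G y - G x - \int[mu]_(t in `[x, y]) k t| <= e * (y - x)) ->
  forall x y, x <= y -> G y - G x = \int[mu]_(t in `[x, y]) k t.
Proof.
move=> ki H x y xy; have [K HK] := primitive_exists ki.
rewrite -HK//; have := @is_derive_0_is_cst R (fun z => G z - K z) y x.
move=> h; apply/eqP; rewrite -subr_eq0 -subr_eq0; apply/eqP.
have -> : G y - G x - (K y - K x) - 0 = (G y - K y) - (G x - K x) by ring.
suff -> : G y - K y = G x - K x by rewrite subrr.
apply: h => z; apply/is_derive_epsP => e e0.
have [r r0 Hr] := H z e e0; exists r => // t; rewrite mul0r subr0 ltr_norml => /andP[h1 h2].
have [zt|tz] := leP z t.
  have := Hr z t; rewrite -HK// [`|t - z|]ger0_norm ?subr_ge0//.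
  have -> : G t - K t - (G z - K z) = G t - G z - (K t - K z) by ring.
  by apply => //; lra.
have := Hr t z; rewrite -HK ?(ltW tz)// [`|t - z|]distrC [`|z - t|]ger0_norm ?subr_ge0 ?(ltW tz)//.
rewrite -[X in _ -> X <= _]normrN.
have -> : - (G t - K t - (G z - K z)) = (G z - G t - (K z - K t)) by ring.
by apply => //; lra.
Qed.

(** A locally H^1 function together with its derivative. With [w] locally square integrable,
    Cauchy-Schwarz bounds a product of two increments over [[x, y]] by [y - x] times an integral
    that is small on short intervals; the product rule rests on this. *)
Definition ac g w := (forall x y, sqi `[x, y] w) /\
  (forall x y, x <= y -> g y - g x = \int[mu]_(t in `[x, y]) w t).

Lemma ac_itg g w x y : ac g w -> itg `[x, y] w.
Proof. by move=> [sw _]; exact: sqi_itg. Qed.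

Lemma int_abs_sq w x y : x <= y -> sqi `[x, y] w ->
  (\int[mu]_(t in `[x, y]) `|w t|) ^+ 2 <= (y - x) * \int[mu]_(t in `[x, y]) w t ^+ 2.
Proof.
move=> xy sw.
have c1 : continuous (cst 1 : R -> R) by exact: cst_continuous.
have := CauchySchwarz (mitv x y) (sqi_cont x y c1) (sqi_norm (mitv x y) sw).
rewrite (eq_int (g := fun t => `|w t|)); last by move=> z _; rewrite mul1r.
rewrite [in X in X * _](eq_int (g := fun=> 1)); last by move=> z _; rewrite expr1n.
rewrite int_cst_itv// mul1r => /le_trans; apply; rewrite ler_wpM2l ?subr_ge0//.
rewrite le_eqVlt; apply/orP; left; apply/eqP.
by apply: eq_int => z _; rewrite real_normK// num_real.
Qed.

Lemma ac_absdiff g w x y : ac g w -> x <= y ->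
  `|g y - g x| <= \int[mu]_(t in `[x, y]) `|w t|.
Proof.
move=> [sw gw] xy; rewrite gw//; apply: le_normr_Rintegral => //.
exact: sqi_itg.
Qed.

Lemma ac_holder g w x y : ac g w -> x <= y ->
  (g y - g x) ^+ 2 <= (y - x) * \int[mu]_(t in `[x, y]) w t ^+ 2.
Proof.
move=> gw xy; apply: le_trans (int_abs_sq xy (gw.1 x y)).
rewrite -(real_normK (num_real (_ - _))) lerXn2r ?nnegrE//.
  by apply: Rintegral_ge0 => z _.
exact: ac_absdiff gw xy.
Qed.

Lemma ac_cont g w : ac g w -> continuous g.
Proof.
move=> gw; apply/continuous_epsP => x e e0.
have [r r0 Hr] := int_local_small x (fun x y => ac_itg x y gw) e0.
have P a b : x - r <= a -> a <= b -> b <= x + r -> `|g b - g a| <= e.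
  move=> ha ab hb; apply: le_trans (ac_absdiff gw ab) _.
  apply: le_trans Hr; apply: ge0_int_subset => //; first exact: sub_itv.
  exact/itg_norm/ac_itg/gw.
exists r => // y; rewrite ltr_norml => /andP[h1 h2].
have [xy|yx] := leP x y; first by apply: P => //; lra.
by rewrite distrC; apply: P => //; [lra|exact: ltW|lra].
Qed.

End real_calculus.
#[global] Hint Extern 0 (measurable _) => solve [exact: mitv | exact: mray] : core.

(** * Product rule, translations and limits of integrals *)

Section absolutely_continuous.
Variable R : realType.
Local Notation mu := (@lebesgue_measure R).
Implicit Types (f g h w k : R -> R) (D E : set (measurableTypeR R)).

Lemma sqi_contM h w x y : continuous h -> sqi `[x, y] w -> sqi `[x, y] (fun t => h t * w t).
Proof.
move=> ch sw; have cs : {within `[x, y], continuous h} by exact: continuous_subspaceT.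
have /compact_bounded[M [_ HM]] := continuous_compact cs (@segment_compact R x y).
apply: (@sqiM _ _ _ _ (M + 1)) => //; first exact: cont_meas.
by move=> t xyt; apply: (HM (M + 1)); [rewrite ltrDl|exists t].
Qed.

(** The integral of [|s|] over short intervals is small, so the error is [o(y - x)] and
    [int_critical] applies. Such errors arise from products of two increments. *)
Lemma ac_of_quadratic_error G k s : (forall x y, sqi `[x, y] k) ->
  (forall x y, itg `[x, y] s) ->
  (forall x y, x <= y -> `|G y - G x - \int[mu]_(t in `[x, y]) k t| <=
    (y - x) * \int[mu]_(t in `[x, y]) `|s t|) ->
  ac G k.
Proof.
move=> sk si H; split=> // x y xy; apply: int_critical => //.
  by move=> ? ?; exact: sqi_itg.
move=> x0 e e0; have [r r0 Hr] := int_local_small x0 si e0; exists r => // a b ha ab hb.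
apply: le_trans (H _ _ ab) _; rewrite mulrC ler_wpM2r ?subr_ge0//.
apply: le_trans Hr; apply: ge0_int_subset => //; last exact: itg_norm.
by apply: sub_itv; lra.
Qed.

Lemma ac_near g w a b t : ac g w -> a <= t -> t <= b ->
  `|g t - g a| <= \int[mu]_(z in `[a, b]) `|w z|.
Proof.
move=> gw at_ tb; apply: le_trans (ac_absdiff gw at_) _.
by apply: ge0_int_subset => //; [exact: sub_itv|exact/itg_norm/(ac_itg _ _ gw)].
Qed.

Lemma int_osc g w k x y : ac g w -> sqi `[x, y] k -> x <= y ->
  `|\int[mu]_(t in `[x, y]) ((g t - g x) * k t)| <=
  (\int[mu]_(t in `[x, y]) `|w t|) * \int[mu]_(t in `[x, y]) `|k t|.
Proof.
move=> gw sk xy; have cg := ac_cont gw.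
have ic : itg `[x, y] (fun t => (g t - g x) * k t).
  apply: sqi_itg; apply: sqi_contM => // z.
  by apply: continuousB; [exact: cg|exact: cst_continuous].
have ik : itg `[x, y] (fun t => `|k t|) by exact/itg_norm/sqi_itg.
apply: int_norm => //; rewrite -RintegralZl//; apply: le_int => //.
- exact: itg_norm.
- exact: itgZ.
move=> t /=; rewrite in_itv/= => /andP[xt ty].
by rewrite normrM ler_wpM2r//; exact: ac_near gw xt ty.
Qed.

Lemma int_oscE g w k x y : ac g w -> sqi `[x, y] k -> x <= y ->
  \int[mu]_(t in `[x, y]) (k t * g t) =
  \int[mu]_(t in `[x, y]) ((g t - g x) * k t) + g x * \int[mu]_(t in `[x, y]) k t.
Proof.
move=> gw sk xy; have cg := ac_cont gw.
rewrite -RintegralZl//; last exact: sqi_itg.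
rewrite -RintegralD//; last 2 first.
- apply: sqi_itg; apply: sqi_contM => // z.
  by apply: continuousB; [exact: cg|exact: cst_continuous].
- by apply: itgZ => //; exact: sqi_itg.
by apply: eq_int => t _; ring.
Qed.

(** Freezing one factor at the left endpoint leaves three error terms, each at most the product of
    the integrals of [|w|] and [|k|] over [[x, y]]. By Cauchy-Schwarz this product is quadratic in
    the sense of [ac_of_quadratic_error]. *)
Lemma ac_mul g w h k : ac g w -> ac h k ->
  ac (fun x => g x * h x) (fun x => w x * h x + g x * k x).
Proof.
move=> gw hk; have cg := ac_cont gw; have ch := ac_cont hk.
have s1 x y : sqi `[x, y] (fun t => w t * h t).
  have := sqi_contM ch (gw.1 x y); congr sqi.
  by apply/funext => t; rewrite mulrC.
have s2 x y : sqi `[x, y] (fun t => g t * k t) by exact: sqi_contM cg (hk.1 x y).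
apply: (@ac_of_quadratic_error _ _ (fun t => 2 * (w t ^+ 2 + k t ^+ 2))).
- by move=> x y; exact: sqiD.
- by move=> x y; apply: itgZ => //; apply: itgD => //; [exact: (gw.1 x y).2|exact: (hk.1 x y).2].
move=> x y xy.
set A := \int[mu]_(t in `[x, y]) `|w t|; set B := \int[mu]_(t in `[x, y]) `|k t|.
have A0 : 0 <= A by apply: Rintegral_ge0.
have B0 : 0 <= B by apply: Rintegral_ge0.
have HA : A ^+ 2 <= _ := int_abs_sq xy (gw.1 x y).
have HB : B ^+ 2 <= _ := int_abs_sq xy (hk.1 x y).
have -> : \int[mu]_(t in `[x, y]) `|2 * (w t ^+ 2 + k t ^+ 2)| =
    2 * (\int[mu]_(t in `[x, y]) w t ^+ 2 + \int[mu]_(t in `[x, y]) k t ^+ 2).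
  rewrite -RintegralD//; [|exact: (gw.1 x y).2|exact: (hk.1 x y).2].
  rewrite -RintegralZl//; last first.
    by apply: itgD => //; [exact: (gw.1 x y).2|exact: (hk.1 x y).2].
  by apply: eq_int => t _; rewrite ger0_norm// mulr_ge0// addr_ge0// sqr_ge0.
have I1 := int_osc hk (gw.1 x y) xy; have I2 := int_osc gw (hk.1 x y) xy.
rewrite -/A -/B in I1 I2.
have D1 : `|g y - g x| <= A := ac_absdiff gw xy.
have D2 : `|h y - h x| <= B := ac_absdiff hk xy.
rewrite RintegralD//; [|exact: sqi_itg|exact: sqi_itg].
have -> : \int[mu]_(t in `[x, y]) (w t * h t) =
    \int[mu]_(t in `[x, y]) ((h t - h x) * w t) + h x * (g y - g x).
  by rewrite gw.2// -(int_oscE hk (gw.1 x y)).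
have -> : \int[mu]_(t in `[x, y]) (g t * k t) =
    \int[mu]_(t in `[x, y]) ((g t - g x) * k t) + g x * (h y - h x).
  rewrite hk.2// -(int_oscE gw (hk.1 x y))//.
  by apply: eq_int => t _; rewrite mulrC.
set J1 := \int[mu]_(t in `[x, y]) ((h t - h x) * w t) in I1 *.
set J2 := \int[mu]_(t in `[x, y]) ((g t - g x) * k t) in I2 *.
have -> : g y * h y - g x * h x - (J1 + h x * (g y - g x) + (J2 + g x * (h y - h x))) =
  (g y - g x) * (h y - h x) - J1 - J2 by ring.
apply: (@le_trans _ _ (A * B + A * B + A * B)).
  apply: le_trans (ler_normB _ _) _; apply: lerD => //.
  apply: le_trans (ler_normB _ _) _; apply: lerD.
    by rewrite normrM ler_pM.
  by rewrite mulrC.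
have := sqr_ge0 (A - B); nra.
Qed.

Lemma ac_add g w h k : ac g w -> ac h k -> ac (fun x => g x + h x) (fun x => w x + k x).
Proof.
move=> gw hk; split=> [x y|x y xy].
  by apply: sqiD => //; [exact: gw.1|exact: hk.1].
by rewrite RintegralD -?gw.2 -?hk.2//; [ring|exact: ac_itg gw|exact: ac_itg hk].
Qed.

Lemma ac_scale g w (c : R) : ac g w -> ac (fun x => c * g x) (fun x => c * w x).
Proof.
move=> gw; split=> [x y|x y xy].
  by apply: sqiZ => //; exact: gw.1.
by rewrite RintegralZl -?gw.2//; [ring|exact: ac_itg gw].
Qed.

Lemma ac_opp g w : ac g w -> ac (fun x => - g x) (fun x => - w x).
Proof.
move=> /(ac_scale (-1)); congr ac; apply/funext => x; exact: mulN1r.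
Qed.

Lemma ac_C1 g k : (forall x, is_derive x (1 : R) g (k x)) -> continuous k -> ac g k.
Proof.
move=> gk ck; have ik x y : itg `[x, y] k by exact: itg_cont.
split=> [x y|x y xy]; first exact: sqi_cont.
apply: int_critical => // x0 e e0.
have e20 : 0 < e / 2 by rewrite divr_gt0.
have [r r0 Hr] := (continuous_epsP k).2 ck x0 _ e20.
exists r => // a b ha ab hb.
have [c cab ->] := MVT_segment ab (fun x _ => gk x) (continuous_subspaceT
  (fun x => differentiable_continuous ((derivable1_diffP _ _).1 (@ex_derive _ _ _ _ _ _ _ (gk x))))).
have -> : k c * (b - a) - \int[mu]_(t in `[a, b]) k t =
  \int[mu]_(t in `[a, b]) (k c - k t).
  by rewrite RintegralB ?int_cst_itv//; [apply: itg_cont; exact: cst_continuous|exact: ik].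
apply: int_norm => //.
  by apply: itgB => //; apply: itg_cont; exact: cst_continuous.
rewrite -(int_cst_itv e ab); apply: le_int => //.
- by apply: itg_norm; apply: itgB => //; apply: itg_cont; exact: cst_continuous.
- by apply: itg_cont; exact: cst_continuous.
move: cab; rewrite in_itv/= => /andP[ac_ cb] t /=; rewrite in_itv/= => /andP[at_ tb].
have h1 := Hr c; have h2 := Hr t.
have -> : k c - k t = (k c - k x0) - (k t - k x0) by ring.
apply: le_trans (ler_normB _ _) _; rewrite (splitr e); apply: lerD.
  by apply: h1; rewrite ltr_norml; apply/andP; split; lra.
by apply: h2; rewrite ltr_norml; apply/andP; split; lra.
Qed.

Lemma antiderivative_exists k : continuous k ->
  exists K : R -> R, forall x, is_derive x (1 : R) K (k x).
Proof.
move=> ck; have ik x y : itg `[x, y] k by exact: itg_cont.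
have [K HK] := primitive_exists ik; exists K => x.
apply/is_derive_epsP => e e0; have [r r0 Hr] := (continuous_epsP k).2 ck x e e0.
have P a b : x - r < a -> a <= b -> b < x + r ->
    `|K b - K a - k x * (b - a)| <= e * (b - a).
  move=> ha ab hb; rewrite HK//.
  have -> : \int[mu]_(t in `[a, b]) k t - k x * (b - a) = \int[mu]_(t in `[a, b]) (k t - k x).
    by rewrite RintegralB ?int_cst_itv//; [exact: ik|apply: itg_cont; exact: cst_continuous].
  have ic : itg `[a, b] (fun t => k t - k x).
    by apply: itgB => //; apply: itg_cont; exact: cst_continuous.
  apply: int_norm => //; rewrite -(int_cst_itv e ab); apply: le_int => //.
  - exact: itg_norm.
  - by apply: itg_cont; exact: cst_continuous.
  move=> t /=; rewrite in_itv/= => /andP[at_ tb]; apply: Hr.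
  by rewrite ltr_norml; apply/andP; split; lra.
exists r => // y; rewrite ltr_norml => /andP[h1 h2].
have [xy|yx] := leP x y.
  by rewrite [`|y - x|]ger0_norm ?subr_ge0//; apply: P => //; lra.
rewrite [`|y - x|]distrC [`|x - y|]gtr0_norm ?subr_gt0//.
rewrite -normrN; have -> : - (K y - K x - k x * (y - x)) = K x - K y - k x * (x - y) by ring.
by apply: P; [lra|exact: ltW|lra].
Qed.

Lemma int_itv_shift f (c x y : R) : itg `[x + c, y + c] f ->
  itg `[x, y] (fun t => f (t + c)) /\
  \int[mu]_(t in `[x, y]) f (t + c) = \int[mu]_(t in `[x + c, y + c]) f t.
Proof.
move=> fi.
have E : (fun t => (f \_ `[x + c, y + c]) (t + c)) = (fun t => f (t + c)) \_ `[x, y].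
  apply/funext => t; rewrite !patchE.
  have -> : (t + c \in `[x + c, y + c]%classic) = (t \in `[x, y]%classic).
    by apply/idP/idP => /set_mem/= h; apply/mem_set => /=; move: h; rewrite !in_itv/= !lerD2r.
  by [].
have fi' : itg setT (f \_ `[x + c, y + c]).
  by rewrite /itg -restrict_EFin; apply/integrable_restrict => //; rewrite setTI.
split.
  have := itg_shift c fi'; rewrite E => i2.
  have : itg `[x, y] ((fun t => f (t + c)) \_ `[x, y]) by apply: itgS i2.
  by apply: eq_itg => // t xyt; rewrite patchE mem_set.
by rewrite Rintegral_mkcond -E (int_shift c fi') -Rintegral_mkcond.
Qed.

Lemma ac_shift g w (c : R) : ac g w -> ac (fun x => g (x + c)) (fun x => w (x + c)).
Proof.
move=> gw; split=> [x y|x y xy]; last first.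
  by rewrite (int_itv_shift (ac_itg _ _ gw)).2 -gw.2// lerD2r.
split; last exact: (int_itv_shift (gw.1 (x + c) (y + c)).2).1.
exact: itg_meas (int_itv_shift (ac_itg (x + c) (y + c) gw)).1.
Qed.

Lemma dct D (f_ : nat -> R -> R) f g : measurable D ->
  (forall n, measurable_fun D (f_ n)) -> measurable_fun D f ->
  {ae mu, forall x, D x -> f_ n x @[n --> \oo] --> f x} -> itg D g ->
  (forall n x, D x -> `|f_ n x| <= g x) ->
  itg D f /\ \int[mu]_(x in D) f_ n x @[n --> \oo] --> \int[mu]_(x in D) f x.
Proof.
move=> mD mf_ mf cv ig fg.
have [] := @dominated_convergence _ (measurableTypeR R) R mu D mD
  (fun n => EFin \o f_ n) (EFin \o f) (EFin \o g).
- by move=> n; exact/measurable_EFinP.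
- exact/measurable_EFinP.
- move: cv; apply: filterS => x + Dx => /(_ Dx) cx.
  by apply: cvg_EFin => //; apply: nearW.
- exact: ig.
- by apply: aeW => x n Dx /=; rewrite lee_fin; exact: fg.
move=> fi _ cv'; split=> //; apply: fine_cvg.
rewrite /Rintegral fineK//; exact: integrable_fin_num.
Qed.

Lemma int_exhaust D (E : nat -> set (measurableTypeR R)) f : measurable D ->
  (forall n, measurable (E n)) -> (forall n, E n `<=` D) ->
  (forall x, D x -> \forall n \near \oo, E n x) -> itg D f ->
  \int[mu]_(x in E n) f x @[n --> \oo] --> \int[mu]_(x in D) f x.
Proof.
move=> mD mE ED cE fi.
have -> : (fun n => \int[mu]_(x in E n) f x) = (fun n => \int[mu]_(x in D) (f \_ (E n)) x).
  apply/funext => n; rewrite -Rintegral_mkcondr; congr (Rintegral _ _ _).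
  by rewrite setIC; apply/esym/setIidl.
have mf := itg_meas fi.
apply: (dct (g := fun x => `|f x|) mD _ mf _ (itg_norm fi) _).2.
- by move=> n; apply/measurable_restrict => //; apply: measurable_funS mf => //; exact: subIsetl.
- apply: aeW => x Dx; apply: cvg_near_cst; near=> n.
  rewrite patchE mem_set//; near: n; exact: cE.
- by move=> n x Dx; rewrite patchE; case: ifPn => // _; rewrite normr0.
Unshelve. all: by end_near. Qed.

End absolutely_continuous.

(** * Sobolev functions on the line *)

Section sobolev_line.
Variable R : realType.
Local Notation mu := (@lebesgue_measure R).
Implicit Types (f g h w k s p q : R -> R) (D E : set (measurableTypeR R)).

Lemma int_escape D (E : nat -> set (measurableTypeR R)) s : measurable D ->
  (forall n, measurable (E n)) -> (forall n, E n `<=` D) ->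
  (forall x, \forall n \near \oo, ~ E n x) -> itg D s ->
  \int[mu]_(x in E n) s x @[n --> \oo] --> (0 : R).
Proof.
move=> mD mE ED cE fi.
have -> : (fun n => \int[mu]_(x in E n) s x) = (fun n => \int[mu]_(x in D) (s \_ (E n)) x).
  apply/funext => n; rewrite -Rintegral_mkcondr; congr (Rintegral _ _ _).
  by rewrite setIC; apply/esym/setIidl.
have mf := itg_meas fi.
have -> : 0 = \int[mu]_(x in D) (fun=> 0) x :> R.
  by rewrite Rintegral_cst//= mul0r.
apply: (dct (f := fun=> 0) (g := fun x => `|s x|) mD _ _ _ (itg_norm fi) _).2 => //.
- by move=> n; apply/measurable_restrict => //; apply: measurable_funS mf => //; exact: subIsetl.
- apply: aeW => x Dx; apply: cvg_near_cst; near=> n.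
  rewrite patchE memNset//; near: n; exact: cE.
- by move=> n x Dx; rewrite patchE; case: ifPn => // _; rewrite normr0.
Unshelve. all: by end_near. Qed.

(** For each [t] in the unit interval after [b n], the value at [b n] is bounded by [|F t|] plus the
    integral of [|k|] over this interval. Averaging over [t] gives an integral over an escaping
    interval, which tends to 0. *)
Lemma primitive_escape D F k (b : nat -> R) : measurable D ->
  (forall n, `[b n, b n + 1]%classic `<=` D) ->
  (forall x, \forall n \near \oo, ~ (b n <= x <= b n + 1)) ->
  itg D F -> itg D k ->
  (forall n y, b n <= y -> F y - F (b n) = \int[mu]_(t in `[b n, y]) k t) ->
  F (b n) @[n --> \oo] --> (0 : R).
Proof.
move=> mD bD bx Fi ki H.
pose s x := `|F x| + `|k x|.
have si : itg D s by apply: itgD => //; exact: itg_norm.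
have /cvgrPdist_le cv : \int[mu]_(x in `[b n, b n + 1]) s x @[n --> \oo] --> (0 : R).
  apply: (int_escape mD _ bD _ si) => [n|x]; first exact: mitv.
  by apply: filterS (bx x) => n; rewrite /= in_itv/=.
apply/cvgrPdist_le => e e0; have := cv e e0; apply: filterS => n.
rewrite !sub0r !normrN => /(le_trans (ler_norm _)); apply: le_trans.
have Si (E : set (measurableTypeR R)) f : measurable E -> E `<=` `[b n, b n + 1] -> itg D f -> itg E f.
  by move=> mE Eb; apply: itgS => //; apply: subset_trans (bD n).
pose B : set (measurableTypeR R) := `[b n, b n + 1]%classic.
have mB : measurable B by exact: mitv.
rewrite -/B.
set K := \int[mu]_(t in B) `|k t|.
have n1 : b n <= b n + 1 by lra.
rewrite RintegralD//; [|exact/itg_norm/Si|exact/itg_norm/Si].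
have -> : \int[mu]_(t in B) `|k t| = \int[mu]_(t in B) (fun=> K) t.
  by rewrite int_cst_itv// addrAC subrr add0r mulr1.
have ic (c : R) : itg B (fun=> c) by apply: itg_cont; exact: cst_continuous.
rewrite -RintegralD//; [|exact/itg_norm/Si|exact: ic].
rewrite -[leLHS]mulr1 -[X in _ * X](_ : b n + 1 - b n = 1); last ring.
rewrite -int_cst_itv//; apply: le_int => //.
  by apply: itgD => //; exact/itg_norm/Si.
move=> t /=; rewrite in_itv/= => /andP[bt tb].
have -> : F (b n) = F t - (F t - F (b n)) by ring.
apply: le_trans (ler_normB _ _) _; rewrite lerD2l H//.
have sb : `[b n, t]%classic `<=` B by exact: sub_itv.
apply: (le_trans (le_normr_Rintegral _ _)) => //; first exact: Si.
by apply: ge0_int_subset => //; apply: itg_norm; exact: Si.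
Qed.

Lemma near_natr_gt (x : R) : \forall n \near \oo, x < n%:R.
Proof. exact: nbhs_infty_gtr. Qed.

Lemma int_ray F k (a : R) : itg `[a, +oo[ F -> itg `[a, +oo[ k ->
  (forall x y, a <= x -> x <= y -> F y - F x = \int[mu]_(t in `[x, y]) k t) ->
  \int[mu]_(t in `[a, +oo[) k t = - F a.
Proof.
move=> Fi ki H.
have c1 : F (a + n%:R) @[n --> \oo] --> (0 : R).
  apply: (primitive_escape (mray a) _ _ Fi ki).
  - move=> n t /=; rewrite !in_itv/= andbT => /andP[+ _]; apply: le_trans.
    by rewrite lerDl.
  - move=> x; near=> n => /andP[+ _]; apply/negP; rewrite -ltNge.
    by rewrite -ltrBlDl; near: n; exact: near_natr_gt.
  - by move=> n y; apply: H; rewrite lerDl.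
have c2 : \int[mu]_(t in `[a, a + n%:R]) k t @[n --> \oo] -->
    \int[mu]_(t in `[a, +oo[) k t.
  apply: (@int_exhaust _ _ (fun n => `[a, a + n%:R]%classic)) => //.
  - by move=> n t /=; rewrite !in_itv/= andbT => /andP[].
  - move=> x /=; rewrite in_itv/= andbT => ax; near=> n.
    rewrite /= in_itv/= ax/= -lerBlDl ltW//; near: n; exact: near_natr_gt.
have : \int[mu]_(t in `[a, a + n%:R]) k t @[n --> \oo] --> 0 - F a.
  have -> : (fun n => \int[mu]_(t in `[a, a + n%:R]) k t) = (fun n => F (a + n%:R) - F a).
    by apply/funext => n; rewrite H// lerDl.
  by apply: cvgB => //; exact: cvg_cst.
by rewrite sub0r; apply: cvg_unique c2.
Unshelve. all: by end_near. Qed.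

Lemma int_line F k : itg setT F -> itg setT k ->
  (forall x y, x <= y -> F y - F x = \int[mu]_(t in `[x, y]) k t) ->
  \int[mu]_t k t = 0.
Proof.
move=> Fi ki H.
have c1 : F (n%:R) @[n --> \oo] --> (0 : R).
  apply: (primitive_escape measurableT _ _ Fi ki) => //; last by move=> n y; exact: H.
  move=> x; near=> n => /andP[+ _]; apply/negP; rewrite -ltNge.
  by near: n; exact: near_natr_gt.
have c0 : F (- n%:R) @[n --> \oo] --> (0 : R).
  apply: (primitive_escape measurableT _ _ Fi ki) => //; last by move=> n y; exact: H.
  move=> x; near=> n => /andP[_]; apply/negP; rewrite -ltNge.
  have : 1 - x < n%:R by near: n; exact: near_natr_gt.
  lra.
have c2 : \int[mu]_(t in `[- n%:R, n%:R]) k t @[n --> \oo] --> \int[mu]_t k t.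
  apply: (@int_exhaust _ _ (fun n => `[- n%:R, n%:R]%classic)) => //.
  move=> x _; near=> n; rewrite /= in_itv/= -ler_norml ltW//.
  by near: n; exact: near_natr_gt.
have : \int[mu]_(t in `[- n%:R, n%:R]) k t @[n --> \oo] --> (0 : R) - 0.
  have -> : (fun n => \int[mu]_(t in `[- n%:R, n%:R]) k t) = (fun n => F (n%:R) - F (- n%:R)).
    by apply/funext => n; rewrite H// ge0_cp.
  exact: cvgB.
by rewrite subr0; apply: cvg_unique c2.
Unshelve. all: by end_near. Qed.

(** The continuous representative of a real H^1 function, paired with a derivative. The derivative
    is an explicit argument, determined only almost everywhere, so that the rules of calculus can
    produce it by formulas. *)
Definition HS g w := [/\ ac g w, sqi setT g & sqi setT w].

(** The squared H^1 norm. *)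
Definition N2 g w : R := \int[mu]_x g x ^+ 2 + \int[mu]_x w x ^+ 2.

Lemma int_sq_ge0 D f : 0 <= \int[mu]_(x in D) f x ^+ 2.
Proof. by apply: Rintegral_ge0 => x _; exact: sqr_ge0. Qed.

Lemma N2_ge0 g w : 0 <= N2 g w.
Proof. by apply: addr_ge0; exact: int_sq_ge0. Qed.

Lemma HS_add g w h k : HS g w -> HS h k -> HS (fun x => g x + h x) (fun x => w x + k x).
Proof.
by move=> [a1 a2 a3] [b1 b2 b3]; split; [exact: ac_add|exact: sqiD|exact: sqiD].
Qed.

Lemma HS_scale g w (c : R) : HS g w -> HS (fun x => c * g x) (fun x => c * w x).
Proof.
by move=> [a1 a2 a3]; split; [exact: ac_scale|exact: sqiZ|exact: sqiZ].
Qed.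

Lemma HS_opp g w : HS g w -> HS (fun x => - g x) (fun x => - w x).
Proof.
by move=> [a1 a2 a3]; split; [exact: ac_opp|exact: sqiN|exact: sqiN].
Qed.

Lemma HS_sub g w h k : HS g w -> HS h k -> HS (fun x => g x - h x) (fun x => w x - k x).
Proof. by move=> gw hk; apply: HS_add => //; exact: HS_opp. Qed.

Lemma HS_shift g w (c : R) : HS g w -> HS (fun x => g (x + c)) (fun x => w (x + c)).
Proof.
by move=> [a1 a2 a3]; split; [exact: ac_shift|exact: sqi_shift|exact: sqi_shift].
Qed.

Lemma N2_shift g w (c : R) : HS g w ->
  N2 (fun x => g (x + c)) (fun x => w (x + c)) = N2 g w.
Proof.
move=> [_ [_ g2] [_ w2]]; rewrite /N2.
by rewrite (int_shift c g2) (int_shift c w2).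
Qed.

Lemma N2_add g w h k : HS g w -> HS h k ->
  N2 (fun x => g x + h x) (fun x => w x + k x) <= 2 * N2 g w + 2 * N2 h k.
Proof.
move=> [_ a2 a3] [_ b2 b3]; have := int_sqD measurableT a2 b2.
by have := int_sqD measurableT a3 b3; rewrite /N2; lra.
Qed.

Lemma N2_scale g w (c : R) : HS g w ->
  N2 (fun x => c * g x) (fun x => c * w x) = c ^+ 2 * N2 g w.
Proof.
move=> [_ [_ g2] [_ w2]]; rewrite /N2 mulrDr -!RintegralZl//.
by congr (_ + _); apply: eq_int => x _; rewrite exprMn.
Qed.

Definition multiplier g w (M : R) := [/\ ac g w, measurable_fun setT w &
  forall x, `|g x| <= M /\ `|w x| <= M].

Lemma HS_mul p q (M : R) g w : multiplier p q M -> HS g w ->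
  HS (fun x => p x * g x) (fun x => q x * g x + p x * w x).
Proof.
move=> [ap mq pM] [a1 a2 a3].
have mp : measurable_fun setT p by apply: cont_meas => //; exact: ac_cont ap.
split; first exact: ac_mul.
  by apply: (sqiM (M := M)) => // x _; exact: (pM x).1.
apply: sqiD => //; apply: (sqiM (M := M)) => // x _; [exact: (pM x).2|exact: (pM x).1].
Qed.

Lemma int_sq_mul p (M : R) g : measurable_fun setT p -> (forall x, `|p x| <= M) -> sqi setT g ->
  \int[mu]_x (p x * g x) ^+ 2 <= M ^+ 2 * \int[mu]_x g x ^+ 2.
Proof.
move=> mp pM sg; rewrite -RintegralZl//; last exact: sg.2.
apply: le_int => //; first by apply: (sqiM (M := M) _ _ _ sg).2.
  by apply: itgZ => //; exact: sg.2.
move=> x _; rewrite exprMn ler_wpM2r ?sqr_ge0//.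
by rewrite -(real_normK (num_real (p x))) lerXn2r// ?nnegrE ?(le_trans _ (pM x)).
Qed.

Lemma N2_mul p q (M : R) g w : multiplier p q M -> HS g w ->
  N2 (fun x => p x * g x) (fun x => q x * g x + p x * w x) <= 3 * M ^+ 2 * N2 g w.
Proof.
move=> [ap mq pM] [a1 a2 a3].
have mp : measurable_fun setT p by apply: cont_meas => //; exact: ac_cont ap.
have s1 : sqi setT (fun x => q x * g x) by apply: (sqiM (M := M)) => // x _; exact: (pM x).2.
have s2 : sqi setT (fun x => p x * w x) by apply: (sqiM (M := M)) => // x _; exact: (pM x).1.
have := int_sqD measurableT s1 s2; rewrite /N2.
have i1 := int_sq_mul mp (fun x => (pM x).1) a2.
have i2 := int_sq_mul mq (fun x => (pM x).2) a2.
have i3 := int_sq_mul mp (fun x => (pM x).1) a3.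
have := int_sq_ge0 setT w; have := sqr_ge0 M; nra.
Qed.

Lemma HS_ibp g w h k : HS g w -> HS h k ->
  \int[mu]_x (w x * h x) = - \int[mu]_x (g x * k x).
Proof.
move=> [a1 a2 a3] [b1 b2 b3]; apply/eqP; rewrite -addr_eq0; apply/eqP.
rewrite -RintegralD//; [|exact: sqi_itgM|exact: sqi_itgM].
apply: (int_line (F := fun x => g x * h x)).
- exact: sqi_itgM.
- by apply: itgD => //; exact: sqi_itgM.
- exact: (ac_mul a1 b1).2.
Qed.

Lemma HS_sq_ray g w (a : R) : HS g w ->
  \int[mu]_(t in `[a, +oo[) (2 * (g t * w t)) = - g a ^+ 2.
Proof.
move=> [a1 a2 a3]; have gw : itg setT (fun t => g t * w t) by exact: sqi_itgM.
rewrite expr2; apply: (int_ray (F := fun x => g x * g x)).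
- by apply: (@itgS _ setT) => //; exact: sqi_itgM.
- by apply: (@itgS _ setT) => //; exact: itgZ.
move=> x y _ xy; rewrite (ac_mul a1 a1).2//; apply: eq_int => t _; ring.
Qed.

Lemma HS_sup g w x : HS g w -> g x ^+ 2 <= N2 g w.
Proof.
move=> hs; have [a1 a2 a3] := hs.
have gw : itg setT (fun t => 2 * (g t * w t)) by apply: itgZ => //; exact: sqi_itgM.
rewrite -[leLHS]opprK -(HS_sq_ray x hs); apply: le_trans (ler_norm _) _; rewrite normrN.
rewrite /N2 -RintegralD//; [|exact: a2.2|exact: a3.2].
apply: (le_trans (le_normr_Rintegral _ _)) => //.
  by apply: (@itgS _ setT).
apply: (@le_trans _ _ (\int[mu]_t `|2 * (g t * w t)|)).
  by apply: ge0_int_subset => //; exact: itg_norm.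
apply: le_int => //; first exact: itg_norm.
  by apply: itgD => //; [exact: a2.2|exact: a3.2].
move=> t _; have := sqr_ge0 (`|g t| - `|w t|); rewrite !normrM normr_nat.
rewrite -(real_normK (num_real (g t))) -(real_normK (num_real (w t))); nra.
Qed.

(** The Gagliardo-Nirenberg inequality for the supremum norm: Cauchy-Schwarz applied to [g x ^+ 2],
    written as an integral of [- 2 g w] over the ray. The product form lets a small mass absorb the
    gradient later on. *)
Lemma HS_sup4 g w x : HS g w ->
  g x ^+ 4 <= 4 * ((\int[mu]_x g x ^+ 2) * \int[mu]_x w x ^+ 2).
Proof.
move=> hs; have [a1 a2 a3] := hs.
have r2 : sqi `[x, +oo[ g by apply: (@sqiS _ setT).
have r3 : sqi `[x, +oo[ w by apply: (@sqiS _ setT).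
have -> : g x ^+ 4 = (- g x ^+ 2) ^+ 2 by ring.
rewrite -(HS_sq_ray x hs) RintegralZl//; last exact: sqi_itgM.
rewrite exprMn -natrX ler_wpM2l//; apply: le_trans (CauchySchwarz (mray x) r2 r3) _.
apply: ler_pM; try exact: int_sq_ge0.
  by apply: ge0_int_subset => //; [exact: a2.2|move=> t; exact: sqr_ge0].
by apply: ge0_int_subset => //; [exact: a3.2|move=> t; exact: sqr_ge0].
Qed.

End sobolev_line.

(** * Difference quotients and almost everywhere derivatives *)

Section difference_quotients.
Variable R : realType.
Local Notation mu := (@lebesgue_measure R).
Implicit Types (f g h w k s p q : R -> R) (D E : set (measurableTypeR R)).

Lemma ae_imp (P Q : R -> Prop) : {ae mu, forall x, P x} -> (forall x, P x -> Q x) ->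
  {ae mu, forall x, Q x}.
Proof.
move=> aP PQ; move: aP; apply: filterS; first exact: (ae_filter_ringOfSetsType mu).
exact: PQ.
Qed.

Lemma ae_imp2 (P Q S : R -> Prop) : {ae mu, forall x, P x} -> {ae mu, forall x, Q x} ->
  (forall x, P x -> Q x -> S x) -> {ae mu, forall x, S x}.
Proof.
move=> aP aQ PQS; move: aP aQ; apply: filterS2; first exact: (ae_filter_ringOfSetsType mu).
exact: PQS.
Qed.

Lemma primitive_continuous P s : (forall x y, itg `[x, y] s) ->
  (forall x y, x <= y -> P y - P x = \int[mu]_(t in `[x, y]) s t) -> continuous P.
Proof.
move=> si HP; apply/continuous_epsP => x e e0.
have [r r0 Hr] := int_local_small x si e0.
have H a b : x - r <= a -> a <= b -> b <= x + r -> `|P b - P a| <= e.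
  move=> ha ab hb; rewrite HP//; apply: le_trans Hr; apply: int_norm => //.
  by apply: ge0_int_subset => //; [exact: sub_itv|exact: itg_norm].
exists r => // y; rewrite ltr_norml => /andP[h1 h2].
have [xy|yx] := leP x y; first by apply: H => //; lra.
by rewrite distrC; apply: H => //; [lra|exact: ltW|lra].
Qed.

(** With [P] a primitive of [w^2], the squared increment at [x] is at most [h (P (x + h) - P x)].
    Integrated over [[- N, N]], the difference of [P] telescopes to two end intervals of length [h],
    on which the monotone [P] is compared with its extreme values. *)
Lemma HS_diff_le g w (h : R) : 0 < h -> HS g w ->
  \int[mu]_x (g (x + h) - g x) ^+ 2 <= h ^+ 2 * \int[mu]_x w x ^+ 2.
Proof.
move=> h0 hs; have [a1 a2 a3] := hs; have [d1 d2 d3] := HS_sub (HS_shift h hs) hs.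
have w2 x y : itg `[x, y] (fun t => w t ^+ 2) by exact: (a1.1 x y).2.
have [P HP] := primitive_exists w2.
set W := \int[mu]_x w x ^+ 2.
have PW x y : x <= y -> P y - P x <= W.
  move=> xy; rewrite HP//; apply: ge0_int_subset => //; first exact: a3.2.
  by move=> t; exact: sqr_ge0.
have Pm x y : x <= y -> P x <= P y.
  by move=> xy; rewrite -subr_ge0 HP//; exact: int_sq_ge0.
have cP := primitive_continuous w2 HP.
have cPh : continuous (fun x => P (x + h)).
  by move=> x; apply: continuous_comp; [apply: continuousD => //; exact: cst_continuous|exact: cP].
have cv : \int[mu]_(x in `[- n%:R, n%:R]) ((g (x + h) - g x) ^+ 2) @[n --> \oo] -->
    \int[mu]_x (g (x + h) - g x) ^+ 2.
  apply: (@int_exhaust _ _ (fun n => `[- n%:R, n%:R]%classic)) => //; last exact: d2.2.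
  move=> x _; near=> n; rewrite /= in_itv/= -ler_norml ltW//.
  by near: n; exact: near_natr_gt.
rewrite -(cvg_lim _ cv)//; apply: limr_le; first by apply/cvg_ex; eexists; exact: cv.
near=> n.
have hn : h <= 2 * n%:R.
  have : h < n%:R by near: n; exact: near_natr_gt.
  have : 0 <= n%:R :> R by []. 
  lra.
set N : R := n%:R in hn *; have N0 : 0 <= N by [].
apply: (@le_trans _ _ (\int[mu]_(x in `[- N, N]) (h * (P (x + h) - P x)))).
  apply: le_int => //.
  - by apply: (@itgS _ setT) => //; exact: d2.2.
  - by apply: itgZ => //; apply: itgB => //; exact: itg_cont.
  move=> x _; have xh : x <= x + h by lra.
  by have := ac_holder a1 xh; rewrite HP// [x + h - x]addrAC subrr add0r.
rewrite RintegralZl//; last by apply: itgB => //; exact: itg_cont.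
have iP x y : itg `[x, y] P by exact: itg_cont.
have iPh x y : itg `[x, y] (fun t => P (t + h)) by exact: itg_cont.
rewrite expr2 -mulrA ler_wpM2l ?(ltW h0)// RintegralB//; [|exact: iPh|exact: iP].
rewrite (int_itv_shift (itg_cont _ _ cP)).2.
have l1 : - N <= - N + h by lra.
have l2 : - N + h <= N by lra.
have l3 : N <= N + h by lra.
rewrite (int_split l2 l3)// (int_split l1 l2)//.
have -> : forall a b c : R, b + c - (a + b) = c - a by move=> *; ring.
apply: (@le_trans _ _ (\int[mu]_(x in `[N, N + h]) P (N + h) -
                      \int[mu]_(x in `[- N, - N + h]) P (- N))).
  apply: lerB; apply: le_int; rewrite //; try by apply: itg_cont; exact: cst_continuous.
    by move=> t /=; rewrite in_itv/= => /andP[_]; exact: Pm.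
  by move=> t /=; rewrite in_itv/= => /andP[]; auto.
rewrite !int_cst_itv//.
have := PW (- N) (N + h) ltac:(lra); nra.
Unshelve. all: by end_near. Qed.

Lemma sqi_locally_integrable w : sqi setT w -> locally_integrable setT w.
Proof.
move=> sw; split; [exact: sw.1|exact: openT|move=> K _ cK].
have [M [_ HM]] := compact_bounded cK.
have KM : K `<=` `[- (M + 1), M + 1]%classic.
  by move=> x Kx; rewrite /= in_itv/= -ler_norml; apply: (HM (M + 1)) => //; rewrite ltrDl.
have wi : itg `[- (M + 1), M + 1] w by apply/sqi_itg/(@sqiS _ setT).
have := itg_norm wi; move=> /integrableP[_]; apply: le_lt_trans.
have mK : measurable (K : set (measurableTypeR R)) by exact: compact_measurable.
under [leRHS]eq_integral do rewrite /= normr_id.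
apply: ge0_subset_integral => //; apply/measurable_EFinP.
by apply: measurableT_comp => //; exact: itg_meas wi.
Qed.

Lemma ac_lebesgue_pt g w x : ac g w -> lebesgue_pt w x -> is_derive x (1 : R) g (w x).
Proof.
move=> gw lx; have ax : (BLeft (x - 1)%R < BRight x)%E.
  by rewrite (@lte_fin R); lra.
have [] := @FTC1_lebesgue_pt R w (BLeft (x - 1)) x (x + 1) ltac:(lra)
  (ac_itg (x - 1) (x + 1) gw) ax lx.
set F := fun y => _; rewrite derive1E => dF Fx.
have /is_derive_epsP H : is_derive x (1 : R) F (w x) by exact: DeriveDef.
apply/is_derive_epsP => e e0; have [r r0 Hr] := H e e0.
exists (Num.min r 1); first by rewrite lt_min r0 ltr01.
move=> y; rewrite lt_min => /andP[yr y1].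
have E z : x - 1 <= z -> F z = g z - g (x - 1) by move=> xz; rewrite gw.2.
have := Hr y yr; rewrite !E; [|lra|by move: y1; rewrite ltr_norml => /andP[]; lra].
by have -> : g y - g (x - 1) - (g x - g (x - 1)) = g y - g x by ring.
Qed.

Lemma HS_ae_derive g w : HS g w -> {ae mu, forall x, is_derive x (1 : R) g (w x)}.
Proof.
move=> [a1 a2 a3].
have := lebesgue_differentiation (sqi_locally_integrable a3).
by move/ae_imp; apply => x; exact: ac_lebesgue_pt.
Qed.

Lemma HS_derivative_unique g w v : HS g w -> HS g v -> {ae mu, forall x, w x = v x}.
Proof.
by move=> /HS_ae_derive dw /HS_ae_derive dv; apply: (ae_imp2 dw dv) => x [_ <-] [_ <-].
Qed.

(** The product [|k v|] is cut at [l k^2]: below this level dominated convergence applies, and above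
    it [l |k| < |v|], so that [|k v|] is at most [v^2 / l], of integral at most [M / l]. *)
Lemma weak_cvg0 k (v : nat -> R -> R) (M : R) : sqi setT k ->
  (forall n, sqi setT (v n)) -> (forall n, \int[mu]_x v n x ^+ 2 <= M) ->
  {ae mu, forall x, v n x @[n --> \oo] --> (0 : R)} ->
  \int[mu]_x (k x * v n x) @[n --> \oo] --> (0 : R).
Proof.
move=> sk sv vM cv.
have M0 : 0 <= M by apply: le_trans (vM 0%N); exact: int_sq_ge0.
apply/cvgrPdist_le => e e0.
(* Chosen so that [M / l <= e / 2]. *)
pose l : R := 2 * (M + 1) / e.
have l0 : 0 < l by rewrite divr_gt0// mulr_gt0// ltr_wpDl.
pose m n x := Num.min `|k x * v n x| (l * k x ^+ 2).
have im n : itg setT (fun x => k x * v n x) by exact: sqi_itgM.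
have ik : itg setT (fun x => l * k x ^+ 2) by apply: itgZ => //; exact: sk.2.
have lk0 x : 0 <= l * k x ^+ 2 by rewrite mulr_ge0 ?(ltW l0)// sqr_ge0.
have m0 n x : 0 <= m n x by rewrite /m le_min normr_ge0 lk0.
have mm n : measurable_fun setT (m n).
  apply: measurable_minr; last exact: itg_meas ik.
  by apply: measurableT_comp => //; exact: itg_meas (im n).
have ml n x : `|m n x| <= l * k x ^+ 2 by rewrite ger0_norm// /m ge_min lexx orbT.
have imm n : itg setT (m n) by exact: (itg_dom measurableT (mm n) ik (fun x _ => ml n x)).
have : \int[mu]_x m n x @[n --> \oo] --> \int[mu]_x (fun=> 0) x.
  apply: (dct (f := fun=> 0) (g := fun x => l * k x ^+ 2) measurableT mm _ _ ik _).2 => //.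
  apply: (ae_imp cv) => x vx _.
  apply: (@squeeze_cvgr _ _ _ _ (fun=> 0) (fun n => `|k x * v n x|)).
  - by apply: nearW => n; rewrite m0 /m ge_min lexx.
  - exact: cvg_cst.
  - have : `|k x * v n x| @[n --> \oo] --> `|k x * 0|.
      by apply: cvg_norm; apply: cvgM => //; exact: cvg_cst.
    by rewrite mulr0 normr0.
rewrite Rintegral_cst//= mul0r => /cvgrPdist_le/(_ (e / 2) ltac:(by rewrite divr_gt0)).
apply: filterS => n; rewrite !sub0r !normrN => hn.
apply: int_norm => //.
have iv : itg setT (fun x => l^-1 * v n x ^+ 2) by apply: itgZ => //; exact: (sv n).2.
apply: (@le_trans _ _ (\int[mu]_x (m n x + l^-1 * v n x ^+ 2))).
  apply: le_int => //; [exact: itg_norm|exact: itgD|move=> x _].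
  rewrite /m; have [h|h] := leP `|k x * v n x| (l * k x ^+ 2).
    by rewrite lerDl mulr_ge0 ?invr_ge0 ?(ltW l0)// sqr_ge0.
  apply: (@le_trans _ _ (l^-1 * v n x ^+ 2)); last by rewrite lerDr.
  move: h; rewrite normrM -(real_normK (num_real (k x))) -(real_normK (num_real (v n x))).
  have := normr_ge0 (k x); have := normr_ge0 (v n x).
  move: (`|k x|) (`|v n x|) => a b b0 a0.
  rewrite ler_pdivlMl// expr2 mulrA => h.
  have a_gt0 : 0 < a.
    by rewrite lt_def a0 andbT; apply: contraTneq h => ->; rewrite !mulr0 !mul0r ltxx.
  have : l * a < b by rewrite -(ltr_pM2r a_gt0) [b * a]mulrC.
  by move=> /ltW /(ler_wpM2r b0); rewrite expr2; lra.
have imn := imm n; rewrite RintegralD// RintegralZl//; last exact: (sv n).2.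
rewrite (splitr e); apply: lerD; first by apply: le_trans hn; exact: ler_norm.
rewrite ler_pdivrMl// /l; apply: le_trans (vM n) _.
have -> : 2 * (M + 1) / e * (e / 2) = M + 1 by field; rewrite gt_eqF.
by rewrite lerDl.
Qed.

(** The quotients are bounded in L^2 by [HS_diff_le] and tend to [w] almost everywhere by Lebesgue
    differentiation, so they converge weakly by [weak_cvg0]. *)
Lemma HS_diff_quot_weak g w k (h : nat -> R) : HS g w -> sqi setT k ->
  (forall n, 0 < h n) -> h n @[n --> \oo] --> (0 : R) ->
  \int[mu]_x (k x * ((h n)^-1 * (g (x + h n) - g x))) @[n --> \oo] -->
  \int[mu]_x (k x * w x).
Proof.
move=> hs sk h0 ch; have [a1 a2 a3] := hs.
pose q n x := (h n)^-1 * (g (x + h n) - g x).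
have sq n : sqi setT (q n).
  by apply: sqiZ => //; have [_] := HS_sub (HS_shift (h n) hs) hs.
pose v n x := q n x - w x.
have sv n : sqi setT (v n) by exact: sqiB.
set W := \int[mu]_x w x ^+ 2.
have vM n : \int[mu]_x v n x ^+ 2 <= 4 * W.
  have := int_sqD measurableT (sq n) (sqiN measurableT a3).
  rewrite [X in _ + _ * X](_ : _ = W); last by apply: eq_int => x _; rewrite sqrrN.
  have : \int[mu]_x q n x ^+ 2 <= W.
    have := HS_diff_le (h0 n) hs; rewrite -/W -ler_pdivrMl ?exprn_gt0//.
    apply: le_trans; rewrite -RintegralZl//.
      rewrite le_eqVlt; apply/orP; left; apply/eqP; apply: eq_int => x _.
      by rewrite /q exprMn exprVn.
    by have [_ [_ ]] := HS_sub (HS_shift (h n) hs) hs.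
  rewrite /v; lra.
have cv : {ae mu, forall x, v n x @[n --> \oo] --> (0 : R)}.
  apply: (ae_imp (HS_ae_derive hs)) => x /is_derive_epsP H.
  apply/cvgrPdist_le => e e0; have [r r0 Hr] := H e e0.
  near=> n; rewrite sub0r normrN /v /q.
  have := Hr (x + h n); rewrite [x + h n - x]addrAC subrr add0r gtr0_norm// => Hn.
  have : h n < r.
    have : `|0 - h n| < r by near: n; move/cvgrPdist_lt : ch => ch; exact: ch.
    by rewrite sub0r normrN gtr0_norm.
  move=> /Hn; rewrite -[X in _ -> `|X| <= _](_ : (h n)^-1 * (g (x + h n) - g x - w x * h n) = _).
    by rewrite [e * _]mulrC normrM gtr0_norm ?invr_gt0// ler_pdivrMl.
  by field; rewrite gt_eqF.
have := weak_cvg0 sk sv vM cv.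
have -> : (fun n => \int[mu]_x (k x * v n x)) =
    (fun n => \int[mu]_x (k x * q n x) - \int[mu]_x (k x * w x)).
  apply/funext => n; rewrite -RintegralB//; [|exact: sqi_itgM|exact: sqi_itgM].
  by apply: eq_int => x _; rewrite /v; ring.
move=> c.
have -> : (fun n => \int[mu]_x (k x * ((h n)^-1 * (g (x + h n) - g x)))) =
    (fun n => \int[mu]_x (k x * q n x) - \int[mu]_x (k x * w x) + \int[mu]_x (k x * w x)).
  by apply/funext => n; rewrite subrK.
by rewrite -[X in _ --> X]add0r; apply: cvgD => //; exact: cvg_cst.
Unshelve. all: by end_near. Qed.

End difference_quotients.

(** * Weak derivatives *)

Section du_bois_reymond.
Variable R : realType.
Local Notation mu := (@lebesgue_measure R).
Implicit Types (f g h w k s p q v : R -> R) (D E : set (measurableTypeR R)).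

Lemma eq_ae_itg D f g : measurable D -> measurable_fun D f ->
  {ae mu, forall x, f x = g x} -> itg D g -> itg D f.
Proof.
move=> mD mf fg gi; have mg := itg_meas gi.
apply/integrableP; split; first exact/measurable_EFinP.
move/integrableP : gi => [_]; apply: le_lt_trans; rewrite le_eqVlt; apply/orP; left; apply/eqP.
apply: ae_eq_integral => //.
- by apply/measurableT_comp => //; exact/measurable_EFinP.
- by apply/measurableT_comp => //; exact/measurable_EFinP.
- by apply: (ae_imp fg) => x /= ->.
Qed.

Lemma eq_ae_int D f g : measurable D -> measurable_fun D f -> measurable_fun D g ->
  {ae mu, forall x, f x = g x} ->
  \int[mu]_(x in D) f x = \int[mu]_(x in D) g x.
Proof.
move=> mD mf mg fg; rewrite /Rintegral; congr fine; apply: ae_eq_integral => //.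
- exact/measurable_EFinP.
- exact/measurable_EFinP.
- by apply: (ae_imp fg) => x /= ->.
Qed.

Lemma eq_ae_sqi D f g : measurable D -> measurable_fun D f ->
  {ae mu, forall x, f x = g x} -> sqi D g -> sqi D f.
Proof.
move=> mD mf fg [mg g2]; split => //; apply: (eq_ae_itg mD _ _ g2).
  exact: measurable_funX.
by apply: (ae_imp fg) => x ->.
Qed.

Lemma mball (x r : R) : measurable (ball x r : set (measurableTypeR R)).
Proof. exact: measurable_ball. Qed.

Lemma lebesgue_pt_small v x : (forall a b, itg `[a, b] v) -> lebesgue_pt v x ->
  forall e : R, 0 < e -> exists2 r0 : R, 0 < r0 & forall r, 0 < r -> r < r0 ->
    \int[mu]_(z in ball x r) `|v z - v x| <= e * (2 * r).
Proof.
move=> vi /fine_cvgP[_ /cvgrPdist_le H] e e0.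
have [r0 /= r00 Hr] := H e e0; exists r0 => // r rgt rlt.
have := Hr r; rewrite /= !sub0r !normrN gtr0_norm// => /(_ rlt rgt).
rewrite /davg /iavg (lebesgue_measure_ball _ (ltW rgt)) inver.
have -> : (r *+ 2 == 0) = false by rewrite mulrn_eq0/= gt_eqF.
have bi : itg (ball x r) (fun z => v z - v x).
  apply: (@itgS _ `[x - r, x + r]) => //; first exact: mball.
    by move=> z; rewrite ball_itv/= !in_itv/= => /andP[/ltW -> /ltW ->].
  by apply: itgB => //; apply: itg_cont; exact: cst_continuous.
have ni := integrable_fin_num (mball x r) (itg_norm bi).
rewrite -(fineK ni) -EFinM /= => h; rewrite mulrC -ler_pdivrMl//; last by rewrite mulr_gt0.
rewrite mulr_natl; apply: le_trans h; exact: ler_norm.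
Qed.

(** A tent of height and half-width [d]. The difference of two such tents has zero integral, so its
    antiderivative can be a compactly supported C^1 test function. *)
Definition hat (d x z : R) : R := Num.max 0 (d - `|z - x|).

Lemma hat_cont d x : continuous (hat d x).
Proof.
apply/continuous_epsP => z e e0; exists e => // y yz; rewrite /hat.
have := ler_dist_dist (y - x) (z - x).
have -> : y - x - (z - x) = y - z by ring.
move=> /le_trans/(_ (ltW yz)); rewrite ler_norml => /andP[h1 h2].
rewrite ler_norml; apply/andP.
by case: (leP 0 (d - `|y - x|)) => h3; case: (leP 0 (d - `|z - x|)) => h4; split; lra.
Qed.

Lemma hat_ge0 d x z : 0 <= hat d x z.
Proof. by rewrite /hat le_max lexx. Qed.

Lemma hat_le d x z : 0 <= d -> hat d x z <= d.
Proof. by move=> d0; rewrite /hat ge_max d0 lerBlDr lerDl normr_ge0. Qed.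

Lemma hat_out d x z : d <= `|z - x| -> hat d x z = 0.
Proof. by move=> dz; rewrite /hat; apply/max_idPl; rewrite subr_le0. Qed.

Lemma int_hat_shift (d x M : R) : `|x| + d <= M -> 0 <= d ->
  \int[mu]_(z in `[- M, M]) hat d x z = \int[mu]_z hat d 0 z.
Proof.
move=> xM d0.
have E : hat d x \_ `[- M, M] = hat d x.
  apply/funext => z; rewrite patchE; case: ifPn => // zM.
  rewrite hat_out//; move: zM; rewrite notin_setE/= in_itv/= -ler_norml => /negP; rewrite -ltNge => h.
  have : `|z| <= `|z - x| + `|x| by rewrite -{1}(subrK x z) ler_normD.
  lra.
have hi : itg setT (hat d x).
  rewrite -E /itg -restrict_EFin; apply/integrable_restrict => //; rewrite setTI.
  exact/itg_cont/hat_cont.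
rewrite Rintegral_mkcond E -(int_shift x hi); apply: eq_int => z _.
by rewrite /hat addrK subr0.
Qed.

Lemma int_hat_ge (d : R) : 0 < d -> d ^+ 2 / 2 <= \int[mu]_z hat d 0 z.
Proof.
move=> d0; rewrite -(@int_hat_shift d 0 d) ?normr0 ?add0r ?(ltW d0)//.
apply: (@le_trans _ _ (\int[mu]_(z in `[- (d / 2), d / 2]) (d / 2))).
  rewrite int_cst_itv; last lra.
  by rewrite le_eqVlt; apply/orP; left; apply/eqP; field.
apply: (@le_trans _ _ (\int[mu]_(z in `[- (d / 2), d / 2]) hat d 0 z)).
  apply: le_int => //; [by apply: itg_cont; exact: cst_continuous|exact/itg_cont/hat_cont|].
  move=> z; rewrite /= in_itv/= -ler_norml => h; rewrite /hat le_max subr0; apply/orP; right.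
  lra.
apply: ge0_int_subset => //; [by apply: sub_itv; lra|exact/itg_cont/hat_cont|].
exact: hat_ge0.
Qed.

(** The tent is at most [d] and lives on the ball of radius [d], where [v] is close to [v x] in the
    mean. *)
Lemma hat_average v (d x M e : R) : (forall a b, sqi `[a, b] v) -> 0 < d ->
  `|x| + d <= M ->
  \int[mu]_(z in ball x d) `|v z - v x| <= e * (2 * d) ->
  `|\int[mu]_(z in `[- M, M]) (hat d x z * v z) - v x * \int[mu]_z hat d 0 z| <= 2 * e * d ^+ 2.
Proof.
move=> sv d0 xM Hb; have vi a b : itg `[a, b] v by exact: sqi_itg.
rewrite -(int_hat_shift xM (ltW d0)).
have hi : itg `[- M, M] (hat d x) by exact/itg_cont/hat_cont.
have hvi : itg `[- M, M] (fun z => hat d x z * v z).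
  by apply: sqi_itg; apply: sqi_contM => //; exact: hat_cont.
rewrite -RintegralZl// -RintegralB//; last exact: itgZ.
apply: int_norm => //; first by apply: itgB => //; exact: itgZ.
have bM : ball x d `<=` `[- M, M]%classic.
  move=> z; rewrite ball_itv/= !in_itv/= -ler_norml => /andP[h1 h2].
  have : `|z - x| <= d by rewrite ler_norml; apply/andP; split; lra.
  have : `|z| <= `|z - x| + `|x| by rewrite -{1}(subrK x z) ler_normD.
  lra.
have vxi : itg (ball x d) (fun z => `|v z - v x|).
  apply: itg_norm; apply: (@itgS _ `[- M, M]) => //; first exact: mball.
  by apply: itgB => //; apply: itg_cont; exact: cst_continuous.
have E : (`[- M, M]%classic `&` ball x d) = ball x d by exact/setIidr.
apply: (@le_trans _ _ (\int[mu]_(z in `[- M, M]) ((fun z => d * `|v z - v x|) \_ (ball x d)) z)).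
  apply: le_int => //.
  - by apply: itg_norm; apply: itgB => //; exact: itgZ.
  - rewrite /itg -restrict_EFin; apply/integrable_restrict => //; rewrite ?E; first exact: mball.
    by apply: itgZ => //; exact: mball.
  move=> z _; rewrite patchE.
  have -> : hat d x z * v z - v x * hat d x z = hat d x z * (v z - v x) by ring.
  rewrite normrM ger0_norm ?hat_ge0//; case: ifPn => [_|zb].
    by rewrite ler_wpM2r//; exact/hat_le/ltW.
  rewrite hat_out ?mul0r//; move: zb; rewrite notin_setE /ball/= => /negP.
  by rewrite -leNgt distrC.
rewrite -Rintegral_mkcondr E RintegralZl//; last exact: mball.
have -> : 2 * e * d ^+ 2 = d * (e * (2 * d)) by ring.
by rewrite ler_wpM2l// ltW.
Qed.

Lemma C1c_ac (eta : R -> R) : C1c eta -> ac eta (derive1 eta).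
Proof.
move=> [deta ceta _]; apply: ac_C1 => // x; rewrite derive1E; exact/derivableP.
Qed.

Lemma C1c_support (eta : R -> R) : C1c eta -> exists2 M : R, 0 < M &
  forall x, M <= `|x| -> eta x = 0 /\ derive1 eta x = 0.
Proof.
move=> [deta ceta cpt].
have [M [_ HM]] := compact_bounded cpt.
have H x : `|M| + 1 < `|x| -> eta x = 0.
  move=> xM; apply: contrapT => ex.
  have cx : closure [set x | eta x != 0] x by apply: subset_closure; exact/eqP.
  have M1 : M < `|M| + 1 by rewrite (le_lt_trans (ler_norm _))// ltrDl.
  by have := HM _ M1 _ cx => /= /(lt_le_trans xM); rewrite ltxx.
(* One unit further than where [eta] is known to vanish, so that [eta] vanishes on a whole
   neighbourhood of [x] and its derivative there is 0 too. *)
exists (`|M| + 2); first by rewrite ltr_wpDl.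
move=> x xM; have xM1 : `|M| + 1 < `|x| by lra.
split; first exact: H.
rewrite derive1E; apply: (@derive_val _ _ _ _ _ _ _).
apply/is_derive_epsP => e e0; exists 1 => // y; rewrite ltr_norml => /andP[h1 h2].
have yx : `|M| + 1 < `|y|.
  have : `|x| <= `|x - y| + `|y| by rewrite -{1}(subrK y x) ler_normD.
  have : `|x - y| < 1 by rewrite ltr_norml; apply/andP; split; lra.
  lra.
by rewrite !H// mul0r !subr0 normr0 mulr_ge0// ltW.
Qed.

Lemma int_supported f (M : R) : (forall x, M <= `|x| -> f x = 0) ->
  \int[mu]_x f x = \int[mu]_(x in `[- M, M]) f x.
Proof.
move=> fM; rewrite [RHS]Rintegral_mkcond; apply: eq_int => x _; rewrite patchE.
case: ifPn => //; rewrite notin_setE/= in_itv/= -ler_norml => /negP; rewrite -ltNge => /ltW.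
exact: fM.
Qed.

(** The du Bois-Reymond lemma. Subtracting a primitive [G0] of [w] leaves a function [v] orthogonal
    to all derivatives of test functions. Hence its averages against tents do not depend on the
    centre of the tent, and shrinking the tents shows that [v] takes the same value at all its
    Lebesgue points. *)
Theorem weak_derivative_HS g w : sqi setT g -> sqi setT w ->
  (forall eta, C1c eta ->
     \int[mu]_x (g x * derive1 eta x) = - \int[mu]_x (w x * eta x)) ->
  exists2 G, HS G w & {ae mu, forall x, g x = G x}.
Proof.
move=> sg sw H.
have sl f x y : sqi setT f -> sqi `[x, y] f by move=> sf; exact: (@sqiS _ setT).
have [G0 HG0] := primitive_exists (fun x y => sqi_itg (sl w x y sw)).
have aG0 : ac G0 w by split=> // x y; exact: sl.
have cG0 := ac_cont aG0.
pose v x := g x - G0 x.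
have mG0 : measurable_fun setT G0 by exact: cont_meas.
have sv x y : sqi `[x, y] v by apply: sqiB => //; [exact: sl|exact: sqi_cont].
have vtest eta M : C1c eta -> 0 < M -> (forall x, M <= `|x| -> eta x = 0 /\ derive1 eta x = 0) ->
    \int[mu]_(x in `[- M, M]) (derive1 eta x * v x) = 0.
  move=> ceta M0 HM; have aeta := C1c_ac ceta; have [_ cd _] := ceta.
  have MM : - M <= M by lra.
  have := (ac_mul aG0 aeta).2 _ _ MM.
  have zM : eta M = 0 by apply: (HM _ _).1; rewrite ler_norm.
  have zNM : eta (- M) = 0 by apply: (HM _ _).1; rewrite normrN ler_norm.
  rewrite zM zNM !mulr0 subrr.
  have i1 : itg `[- M, M] (fun x => eta x * w x).
    by apply: sqi_itg; apply: sqi_contM; [exact: ac_cont aeta|exact: sl].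
  have i2 : itg `[- M, M] (fun x => derive1 eta x * G0 x).
    by apply: sqi_itg; apply: sqi_contM => //; exact: sqi_cont.
  have i3 : itg `[- M, M] (fun x => derive1 eta x * g x).
    by apply: sqi_itg; apply: sqi_contM => //; exact: sl.
  have -> : \int[mu]_(x in `[- M, M]) (w x * eta x + G0 x * derive1 eta x) =
      \int[mu]_(x in `[- M, M]) (eta x * w x) + \int[mu]_(x in `[- M, M]) (derive1 eta x * G0 x).
    by rewrite -RintegralD//; apply: eq_int => x _; ring.
  have := H _ ceta; rewrite (int_supported (M := M)) => [|x /HM[_ ->]]; last by rewrite mulr0.
  rewrite (int_supported (f := fun x => w x * eta x) (M := M)) => [|x /HM[-> _]]; last by rewrite mulr0.
  have -> : \int[mu]_(x in `[- M, M]) (derive1 eta x * v x) =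
    \int[mu]_(x in `[- M, M]) (derive1 eta x * g x) - \int[mu]_(x in `[- M, M]) (derive1 eta x * G0 x).
    by rewrite -RintegralB//; apply: eq_int => x _; rewrite /v; ring.
  have -> : \int[mu]_(x in `[- M, M]) (g x * derive1 eta x) =
    \int[mu]_(x in `[- M, M]) (derive1 eta x * g x) by apply: eq_int => x _; rewrite mulrC.
  have -> : \int[mu]_(x in `[- M, M]) (w x * eta x) =
    \int[mu]_(x in `[- M, M]) (eta x * w x) by apply: eq_int => x _; rewrite mulrC.
  lra.
(* The test function is the antiderivative of the difference of the two tents; it vanishes at both
   ends because the tents have equal integrals. *)
have hats d x y M : 0 < d -> `|x| + d <= M -> `|y| + d <= M ->
    \int[mu]_(z in `[- M, M]) (hat d x z * v z) = \int[mu]_(z in `[- M, M]) (hat d y z * v z).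
  move=> d0 xM yM; have M0 : 0 < M by have := normr_ge0 x; lra.
  pose th z := hat d x z - hat d y z.
  have cth : continuous th by move=> z; apply: continuousB; exact: hat_cont.
  have [K HK] := antiderivative_exists cth.
  pose eta z := K z - K (- M).
  have dK z : is_derive z (1 : R) eta (th z).
    have := HK z; move=> /is_derive_epsP HKz; apply/is_derive_epsP => e e0.
    have [r r0 Hr] := HKz e e0; exists r => // t /Hr.
    by rewrite /eta opprB addrA subrK.
  have dE : derive1 eta = th by apply/funext => z; rewrite derive1E derive_val.
  have aeta : ac eta th by exact: ac_C1.
  have thM z : M <= `|z| -> th z = 0.
    move=> Mz; rewrite /th !hat_out ?subrr//.
      have : `|z| <= `|z - y| + `|y| by rewrite -{1}(subrK y z) ler_normD.
      lra.
    have : `|z| <= `|z - x| + `|x| by rewrite -{1}(subrK x z) ler_normD.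
    lra.
  have eNM : eta (- M) = 0 by rewrite /eta subrr.
  have hi z a b : itg `[a, b] (hat d z) by exact/itg_cont/hat_cont.
  have eM : eta M = 0.
    rewrite -[eta M]subr0 -{1}eNM aeta.2; last lra.
    rewrite RintegralB//; [|exact: hi|exact: hi].
    by rewrite !int_hat_shift ?subrr// ltW.
  have etaM z : M <= `|z| -> eta z = 0 /\ derive1 eta z = 0.
    move=> Mz; split; last by rewrite dE thM.
    have z0 (a b : R) : (forall t, a <= t -> t <= b -> M <= `|t|) ->
        \int[mu]_(t in `[a, b]) th t = 0.
      move=> ab; rewrite (eq_int (g := fun=> 0)); first by rewrite Rintegral_cst//= mul0r.
      by move=> t /=; rewrite in_itv/= => /andP[h1 h2]; exact/thM/ab.
    have [zp|zn] := leP 0 z.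
      rewrite -[eta z]subr0 -{1}eM aeta.2; last by move: Mz; rewrite ger0_norm.
      apply: z0 => t Mt _; apply: le_trans Mt _; exact: ler_norm.
    rewrite -[eta z]opprK -[- eta z]add0r -{1}eNM aeta.2; last first.
      by move: Mz; rewrite ltr0_norm//; lra.
    rewrite z0 ?oppr0// => t _ tM; have : - t <= `|t| by rewrite -normrN ler_norm.
    lra.
  have ceta : C1c eta.
    split; first by move=> z; exact: ex_derive.
      by rewrite dE.
    apply: (subclosed_compact _ (@segment_compact R (- M) M)); first exact: closed_closure.
    have -> : `[- M, M]%classic = closure `[- M, M]%classic :> set R.
      by apply/closure_id; exact: itv_closed.
    apply: closure_subset => z /= ez; rewrite in_itv/= -ler_norml leNgt; apply/negP => /ltW.
    by move=> /etaM[e0 _]; rewrite e0 eqxx in ez.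
  have := vtest eta M ceta M0 etaM; rewrite dE.
  have hvi z : itg `[- M, M] (fun t => hat d z t * v t).
    by apply: sqi_itg; apply: sqi_contM => //; exact: hat_cont.
  rewrite (eq_int (g := fun z => hat d x z * v z - hat d y z * v z)); last first.
    by move=> z _; rewrite /th; ring.
  rewrite RintegralB//; [|exact: hvi|exact: hvi].
  by move=> /eqP; rewrite subr_eq0 => /eqP.
have svl : locally_integrable setT v.
  have [m1 o1 i1] := sqi_locally_integrable sg.
  split => //; first exact: measurable_funB.
  move=> K _ cK; have [M [_ HM]] := compact_bounded cK.
  have KM : K `<=` `[- (M + 1), M + 1]%classic.
    by move=> x Kx; rewrite /= in_itv/= -ler_norml; apply: (HM (M + 1)) => //; rewrite ltrDl.
  have vi := sqi_itg (sv (- (M + 1)) (M + 1)).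
  have := itg_norm vi; move=> /integrableP[_]; apply: le_lt_trans.
  have mK : measurable (K : set (measurableTypeR R)) by exact: compact_measurable.
  under [leRHS]eq_integral do rewrite /= normr_id.
  apply: ge0_subset_integral => //; apply/measurable_EFinP.
  by apply: measurableT_comp => //; exact: itg_meas vi.
have vv x y : lebesgue_pt v x -> lebesgue_pt v y -> v x = v y.
  have vi a b : itg `[a, b] v by exact: sqi_itg.
  move=> lx ly; apply/eqP; rewrite -subr_eq0 -normr_le0; apply/ler_addgt0Pl => e e0.
  rewrite addr0.
  (* Each average is off by at most [2 (e / 8) d^2], together [e d^2 / 2], while the integral of the
     tent is at least [d^2 / 2]. *)
  have e8 : 0 < e / 8 by rewrite divr_gt0.
  have [r1 r10 H1] := lebesgue_pt_small vi lx e8.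
  have [r2 r20 H2] := lebesgue_pt_small vi ly e8.
  pose d := Num.min r1 r2 / 2.
  have d0 : 0 < d by rewrite divr_gt0// lt_min r10 r20.
  have d1 : d < r1.
    have : Num.min r1 r2 <= r1 by rewrite ge_min lexx.
    by rewrite /d in d0 *; lra.
  have d2 : d < r2.
    have : Num.min r1 r2 <= r2 by rewrite ge_min lexx orbT.
    by rewrite /d in d0 *; lra.
  pose M := `|x| + `|y| + d.
  have xM : `|x| + d <= M by rewrite /M; have := normr_ge0 y; lra.
  have yM : `|y| + d <= M by rewrite /M; have := normr_ge0 x; lra.
  have := hat_average sv d0 xM (H1 d d0 d1); have := hat_average sv d0 yM (H2 d d0 d2).
  rewrite (hats d x y M d0 xM yM).
  set I := \int[mu]_(z in `[- M, M]) _; have := int_hat_ge d0.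
  set c := \int[mu]_z _ => hc h1 h2.
  have d20 : 0 < d ^+ 2 by rewrite exprn_gt0.
  have c0 : 0 < c by lra.
  have : `|(v x - v y) * c| <= (e / 2) * d ^+ 2.
    have -> : (v x - v y) * c = (I - v y * c) - (I - v x * c) by ring.
    apply: le_trans (ler_normB _ _) _; lra.
  rewrite normrM (gtr0_norm c0) => h.
  have : `|v x - v y| * c <= e * c by nra.
  by rewrite ler_pM2r.
have lv := lebesgue_differentiation svl.
have [x0 lx0] : exists x0, lebesgue_pt v x0.
  have : (0 < mu setT)%E.
    by rewrite -set_itvNyy lebesgue_measure_itv//= ltry.
  move=> mu0; have PF := ae_properfilter_algebraOfSetsType mu0.
  exact: (@filter_ex _ _ PF _ lv).
have aG : ac (fun x => G0 x + v x0) w.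
  split; first exact: aG0.1.
  by move=> x y xy; rewrite -aG0.2//; ring.
have gG : {ae mu, forall x, g x = G0 x + v x0}.
  by apply: (ae_imp lv) => x lx; rewrite -(vv _ _ lx lx0) /v; ring.
exists (fun x => G0 x + v x0) => //; split => //.
apply: (eq_ae_sqi measurableT _ _ sg); first by apply: cont_meas => //; exact: ac_cont aG.
by apply: (ae_imp gG) => x ->.
Qed.

End du_bois_reymond.

(** * Real and imaginary parts of a solution *)

Section real_solutions.
Variable R : realType.
Local Notation mu := (@lebesgue_measure R).
Implicit Types (f g p q phi psi kap : R -> R) (D E : set (measurableTypeR R)).

Lemma int_CS_le D f g (A B e : R) : measurable D -> sqi D f -> sqi D g ->
  \int[mu]_(x in D) f x ^+ 2 <= A -> \int[mu]_(x in D) g x ^+ 2 <= B ->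
  A * B <= e ^+ 2 -> 0 <= e -> `|\int[mu]_(x in D) (f x * g x)| <= e.
Proof.
move=> mD sf sg fA gB AB e0; rewrite -(@ler_pXn2r _ 2)// ?nnegrE//.
rewrite real_normK ?num_real//; apply: le_trans (CauchySchwarz mD sf sg) _.
by apply: le_trans AB; apply: ler_pM => //; exact: int_sq_ge0.
Qed.

Lemma int_comb4 D (j1 j2 j3 j4 : R -> R) : measurable D ->
  itg D j1 -> itg D j2 -> itg D j3 -> itg D j4 ->
  \int[mu]_(x in D) j1 x + \int[mu]_(x in D) j2 x - \int[mu]_(x in D) j3 x
    - \int[mu]_(x in D) j4 x =
  \int[mu]_(x in D) (j1 x + j2 x - j3 x - j4 x).
Proof.
move=> mD i1 i2 i3 i4; have i12 := itgD mD i1 i2; have i123 := itgB mD i12 i3.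
by rewrite RintegralB// RintegralB// RintegralD.
Qed.

(* Weak form of [c' = - p_x + q], uniform over H^1 test functions. *)
Definition weak_dt (c : R -> R -> R) (t : R) p q := forall e : R, 0 < e ->
  exists2 r : R, 0 < r & forall h : R, h != 0 -> `|h| < r ->
    forall phi phix, HS phi phix ->
    `|h^-1 * \int[mu]_x ((c (t + h) x - c t x) * phi x) -
      (\int[mu]_x (p x * phix x) + \int[mu]_x (q x * phi x))| <= e * (1 + N2 phi phix).

Definition H1_curve (c cx : R -> R -> R) := (forall t, HS (c t) (cx t)) /\
  forall t e : R, 0 < e -> exists2 r : R, 0 < r & forall s, `|s - t| < r ->
    N2 (fun x => c s x - c t x) (fun x => cx s x - cx t x) <= e.

Lemma N2_subrr g (g' : R -> R) : N2 (fun x => g x - g x) (fun x => g' x - g' x) = 0.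
Proof.
have E (p : R -> R) : \int[mu]_x (p x - p x) ^+ 2 = 0.
  by rewrite (@eq_int _ _ _ (fun=> 0)) ?Rintegral_cst//= ?mul0r// => x _; rewrite subrr expr0n.
by rewrite /N2 !E addr0.
Qed.

Lemma H1_curve_shift c cx (y : R) : H1_curve c cx ->
  H1_curve (fun t x => c t (x + y)) (fun t x => cx t (x + y)).
Proof.
move=> [H1 H2]; split=> [t|t e e0]; first exact: HS_shift.
have [r r0 Hr] := H2 t e e0; exists r => // s st.
by rewrite (N2_shift y (HS_sub (H1 s) (H1 t))); exact: Hr.
Qed.

Lemma H1_curve_time c cx (tau : R) : H1_curve c cx ->
  H1_curve (fun t => c (t + tau)) (fun t => cx (t + tau)).
Proof.
move=> [H1 H2]; split=> [t|t e e0]; first exact: H1.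
have [r r0 Hr] := H2 (t + tau) e e0; exists r => // s st; apply: Hr.
by have -> : s + tau - (t + tau) = s - t by ring.
Qed.

Lemma H1_curve_opp c cx : H1_curve c cx ->
  H1_curve (fun t x => - c t x) (fun t x => - cx t x).
Proof.
move=> [H1 H2]; split=> [t|t e e0]; first exact: HS_opp.
have [r r0 Hr] := H2 t e e0; exists r => // s st.
have := N2_scale (-1) (HS_sub (H1 s) (H1 t)); rewrite sqrrN expr1n mul1r => N.
apply: le_trans (Hr s st); rewrite -N le_eqVlt; apply/orP; left; apply/eqP.
by congr N2; apply/funext => x; ring.
Qed.

Lemma H1_curve_mul p q (M : R) c cx : multiplier p q M -> H1_curve c cx ->
  H1_curve (fun t x => p x * c t x) (fun t x => q x * c t x + p x * cx t x).
Proof.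
move=> mp [H1 H2]; split=> [t|t e e0]; first exact: HS_mul mp (H1 t).
have M3 : 0 < 3 * M ^+ 2 + 1 by have := sqr_ge0 M; lra.
have [r r0 Hr] := H2 t (e / (3 * M ^+ 2 + 1)) (divr_gt0 e0 M3).
exists r => // s st.
have := N2_mul mp (HS_sub (H1 s) (H1 t)).
have := Hr s st; rewrite ler_pdivlMr// => h1 h2.
apply: (@le_trans _ _ (3 * M ^+ 2 * N2 (fun x => c s x - c t x) (fun x => cx s x - cx t x))).
  apply: le_trans h2; rewrite le_eqVlt; apply/orP; left; apply/eqP.
  by congr N2; apply/funext => x; ring.
have := N2_ge0 (fun x => c s x - c t x) (fun x => cx s x - cx t x); lra.
Qed.

Lemma H1_curve_bounded c cx (t : R) : H1_curve c cx ->
  exists2 r : R, 0 < r & forall s, `|s - t| < r -> N2 (c s) (cx s) <= 2 * N2 (c t) (cx t) + 2.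
Proof.
move=> [H1 H2]; have [r r0 Hr] := H2 t 1 ltr01; exists r => // s /Hr h.
have := N2_add (H1 t) (HS_sub (H1 s) (H1 t)).
have -> : (fun x => c t x + (c s x - c t x)) = c s by apply/funext => x; ring.
have -> : (fun x => cx t x + (cx s x - cx t x)) = cx s by apply/funext => x; ring.
lra.
Qed.

(** For a product rule the increment of one solution must be tested against another solution at the
    later time [t + h]. The uniformity of [weak_dt] over test functions permits this moving test
    function. *)
Lemma weak_dt_pair c t p q (phi phix : R -> R -> R) :
  weak_dt c t p q -> sqi setT p -> sqi setT q -> H1_curve phi phix ->
  forall e : R, 0 < e -> exists2 r : R, 0 < r & forall h : R, h != 0 -> `|h| < r ->
    `|\int[mu]_x ((c (t + h) x - c t x) * phi (t + h) x) -
      h * (\int[mu]_x (p x * phix t x) + \int[mu]_x (q x * phi t x))| <= e * `|h|.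
Proof.
move=> dc sp sq cphi e e0; have [H1 H2] := cphi.
have [r1 r10 Hr1] := H1_curve_bounded t cphi.
move: (N2_ge0 (phi t) (phix t)) Hr1; move: (N2 (phi t) (phix t)) => N N0 Hr1.
have N3 : 0 < 3 + 2 * N by lra.
have e4 : 0 < e / 4 by rewrite divr_gt0.
(* By [H1_curve_bounded], [1 + N2] of the test function at time [t + h] is at most [3 + 2 N], so
   this error is at most [e / 4]. *)
have [r2 r20 Hr2] := dc (e / 4 / (3 + 2 * N)) (divr_gt0 e4 N3).
have [P [P0 Pp Pq]] : exists P : R, [/\ 0 < P, \int[mu]_x p x ^+ 2 <= P & \int[mu]_x q x ^+ 2 <= P].
  exists (\int[mu]_x p x ^+ 2 + \int[mu]_x q x ^+ 2 + 1).
  by have := int_sq_ge0 setT p; have := int_sq_ge0 setT q; split; lra.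
have [r3 r30 Hr3] := H2 t ((e / 4) ^+ 2 / P) (divr_gt0 (exprn_gt0 2 e4) P0).
exists (Num.min r1 (Num.min r2 r3)); first by rewrite !lt_min r10 r20 r30.
move=> h h0; rewrite !lt_min => /andP[h1 /andP[h2 h3]].
have th : t + h - t = h by ring.
have := Hr2 h h0 h2 _ _ (H1 (t + h)).
have B1 : N2 (phi (t + h)) (phix (t + h)) <= 2 * N + 2 by apply: Hr1; rewrite th.
have B3 := Hr3 (t + h); rewrite th in B3; have {}B3 := B3 h3.
have [a1 a2 a3] := HS_sub (H1 (t + h)) (H1 t).
have hphi := H1 t; have [b1 b2 b3] := hphi; have [d1 d2 d3] := H1 (t + h).
set I := \int[mu]_x ((c (t + h) x - c t x) * phi (t + h) x) => Q.
have Q' : `|h^-1 * I - (\int[mu]_x (p x * phix (t + h) x) + \int[mu]_x (q x * phi (t + h) x))|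
    <= e / 4.
  apply: le_trans Q _; rewrite -mulrA ger_pMr// ler_pdivrMl// mulr1; lra.
have E1 : \int[mu]_x (p x * phix (t + h) x) = \int[mu]_x (p x * phix t x) +
    \int[mu]_x (p x * (phix (t + h) x - phix t x)).
  rewrite -RintegralD//; [|exact: sqi_itgM|exact: sqi_itgM].
  by apply: eq_int => x _; ring.
have E2 : \int[mu]_x (q x * phi (t + h) x) = \int[mu]_x (q x * phi t x) +
    \int[mu]_x (q x * (phi (t + h) x - phi t x)).
  rewrite -RintegralD//; [|exact: sqi_itgM|exact: sqi_itgM].
  by apply: eq_int => x _; ring.
have F1 : `|\int[mu]_x (p x * (phix (t + h) x - phix t x))| <= e / 4.
  apply: (int_CS_le measurableT sp a3 (A := P) (B := (e / 4) ^+ 2 / P)).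
  - exact: Pp.
  - apply: le_trans B3; rewrite /N2 lerDr; exact: int_sq_ge0.
  - by rewrite mulrC divfK// gt_eqF.
  - exact: ltW.
have F2 : `|\int[mu]_x (q x * (phi (t + h) x - phi t x))| <= e / 4.
  apply: (int_CS_le measurableT sq a2 (A := P) (B := (e / 4) ^+ 2 / P)).
  - exact: Pq.
  - apply: le_trans B3; rewrite /N2 lerDl; exact: int_sq_ge0.
  - by rewrite mulrC divfK// gt_eqF.
  - exact: ltW.
rewrite E1 E2 in Q'.
set J := \int[mu]_x (p x * phix t x) + \int[mu]_x (q x * phi t x).
have : `|h^-1 * I - J| <= e.
  move: Q' F1 F2; rewrite /J.
  set j1 := \int[mu]_x _; set j2 := \int[mu]_x _; set j3 := \int[mu]_x _; set j4 := \int[mu]_x _.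
  by rewrite !ler_norml => /andP[? ?] /andP[? ?] /andP[? ?]; apply/andP; split; lra.
have nh : 0 < `|h| by rewrite normr_gt0.
rewrite -(ler_pM2r nh) -normrM mulrBl mulrAC mulVf// mul1r.
by rewrite [J * h]mulrC.
Qed.

Variable f : R -> R.
Let k0 s := f (s ^+ 2).
Hypothesis k_cont : continuous k0.

Definition dens (u v : R -> R) x : R := u x ^+ 2 + v x ^+ 2.
Definition pot (u v : R -> R) x : R := f (dens u v x).

(** The regularity assumption concerns [s |-> f (s^2)], so the nonlinearity is always read through
    the modulus of the solution. *)
Lemma potE (u v : R -> R) x : pot u v x = k0 (Num.sqrt (dens u v x)).
Proof. by rewrite /k0 sqr_sqrtr// addr_ge0// sqr_ge0. Qed.

Lemma pot_meas (u v : R -> R) : continuous u -> continuous v -> continuous (pot u v).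
Proof.
move=> cu cv; have -> : pot u v = k0 \o (fun x => Num.sqrt (dens u v x)).
  by apply/funext => x; rewrite potE.
move=> x; apply: continuous_comp; last exact: k_cont.
apply: (@continuous_comp _ _ _ (dens u v) Num.sqrt); last exact: sqrt_continuous.
have -> : dens u v = fun x => u x * u x + v x * v x.
  by apply/funext => z; rewrite /dens !expr2.
by apply: continuousD; apply: continuousM; (exact: cu || exact: cv).
Qed.

Lemma k0_bounded (K : R) : exists B : R, forall s, 0 <= s -> s ^+ 2 <= K -> `|k0 s| <= B.
Proof.
have cs : {within `[0, K + 1], continuous k0} by exact: continuous_subspaceT.
have /compact_bounded[M [_ HM]] := continuous_compact cs (@segment_compact R 0 (K + 1)).
exists (M + 1) => s s0 sK; apply: (HM (M + 1)); first by rewrite ltrDl.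
exists s => //=; rewrite in_itv/= s0/=; nra.
Qed.

Lemma pot_sqi (u ux v vx g : R -> R) : HS u ux -> HS v vx -> sqi setT g ->
  sqi setT (fun x => pot u v x * g x).
Proof.
move=> hu hv sg; have [B HB] := k0_bounded (N2 u ux + N2 v vx).
apply: (sqiM (M := B)) => //.
  apply: cont_meas => //; apply: pot_meas.
    by have [/ac_cont] := hu.
  by have [/ac_cont] := hv.
move=> x _; rewrite potE; apply: HB; rewrite ?sqrtr_ge0// sqr_sqrtr.
  by apply: lerD; apply: HS_sup.
by rewrite addr_ge0// sqr_ge0.
Qed.

(* Real and imaginary parts of a solution: [a_t = - b_xx + f(a^2+b^2) b], [b_t = a_xx - f(a^2+b^2) a]. *)
Definition real_solution (a ax b bx : R -> R -> R) :=
  [/\ H1_curve a ax, H1_curve b bx,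
      forall t, weak_dt a t (bx t) (fun x => pot (a t) (b t) x * b t x) &
      forall t, weak_dt b t (fun x => - ax t x) (fun x => - (pot (a t) (b t) x * a t x))].

Lemma weak_dt_shift c t p q (y : R) (c1 : forall t, exists cx, HS (c t) cx) :
  sqi setT p -> sqi setT q -> weak_dt c t p q ->
  weak_dt (fun t x => c t (x + y)) t (fun x => p (x + y)) (fun x => q (x + y)).
Proof.
move=> sp sq dc e e0; have [r r0 Hr] := dc e e0; exists r => // h h0 hr phi phix hphi.
have := Hr h h0 hr _ _ (HS_shift (- y) hphi); rewrite N2_shift//.
have [cx1 [_ h1 _]] := c1 (t + h); have [cx2 [_ h2 _]] := c1 t.
have [_ p1 p2] := hphi.
have E (g v : R -> R) : sqi setT g -> sqi setT v ->
    \int[mu]_x (g x * v (x - y)) = \int[mu]_x (g (x + y) * v x).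
  move=> sg sv; rewrite -(@int_shift R (fun x => g x * v (x - y)) y).
    by apply: eq_int => x _; rewrite addrK.
  by apply: sqi_itgM => //; exact: sqi_shift.
rewrite (E (fun x => c (t + h) x - c t x))//; last exact: sqiB.
by rewrite (E p)// (E q).
Qed.

Lemma real_solution_shift a ax b bx (y : R) : real_solution a ax b bx ->
  real_solution (fun t x => a t (x + y)) (fun t x => ax t (x + y))
                (fun t x => b t (x + y)) (fun t x => bx t (x + y)).
Proof.
move=> [ca cb da db].
have qa t := let: And3 _ _ h := (ca.1 t) in h.
have qb t := let: And3 _ _ h := (cb.1 t) in h.
have ra t := let: And3 _ h _ := (ca.1 t) in h.
have rb t := let: And3 _ h _ := (cb.1 t) in h.
split; [exact: H1_curve_shift|exact: H1_curve_shift|move=> t|move=> t].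
- apply: (weak_dt_shift y _ (qb t) _ (da t)); last exact: pot_sqi (ca.1 t) (cb.1 t) (rb t).
  by move=> s; exists (ax s); exact: ca.1.
- apply: (weak_dt_shift y _ (sqiN measurableT (qa t)) _ (db t)).
    by move=> s; exists (bx s); exact: cb.1.
  exact/sqiN/(pot_sqi (ca.1 t) (cb.1 t) (ra t)).
Qed.

Lemma real_solution_time a ax b bx (tau : R) : real_solution a ax b bx ->
  real_solution (fun t => a (t + tau)) (fun t => ax (t + tau))
                (fun t => b (t + tau)) (fun t => bx (t + tau)).
Proof.
move=> [ca cb da db]; split; [exact: H1_curve_time|exact: H1_curve_time|move=> t|move=> t].
- move=> e e0; have [r r0 Hr] := da (t + tau) e e0; exists r => // h h0 hr phi phix hphi.
  by have := Hr h h0 hr phi phix hphi; rewrite [t + tau + h]addrAC.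
- move=> e e0; have [r r0 Hr] := db (t + tau) e e0; exists r => // h h0 hr phi phix hphi.
  by have := Hr h h0 hr phi phix hphi; rewrite [t + tau + h]addrAC.
Qed.

Lemma weak_dt_opp c t p q (c1 : forall t, exists cx, HS (c t) cx) :
  sqi setT p -> sqi setT q -> weak_dt c t p q ->
  weak_dt (fun t x => - c t x) t (fun x => - p x) (fun x => - q x).
Proof.
move=> sp sq dc e e0; have [r r0 Hr] := dc e e0; exists r => // h h0 hr phi phix hphi.
have := Hr h h0 hr _ _ hphi; rewrite -normrN.
have [cx1 [_ h1 _]] := c1 (t + h); have [cx2 [_ h2 _]] := c1 t.
have [_ p1 p2] := hphi.
have E (g v : R -> R) : sqi setT g -> sqi setT v ->
    \int[mu]_x (- g x * v x) = - \int[mu]_x (g x * v x).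
  move=> sg sv; rewrite -intN//; last exact: sqi_itgM.
  by apply: eq_int => x _; rewrite mulNr.
rewrite (E p)// (E q)//.
have -> : \int[mu]_x ((- c (t + h) x - - c t x) * phi x) =
   - \int[mu]_x ((c (t + h) x - c t x) * phi x).
  rewrite -(E (fun x => c (t + h) x - c t x))//; last exact: sqiB.
  by apply: eq_int => x _; ring.
set j1 := \int[mu]_x _; set j2 := \int[mu]_x _; set j3 := \int[mu]_x _.
by have -> : - (h^-1 * j1 - (j2 + j3)) = h^-1 * - j1 - (- j2 - j3) by ring.
Qed.

(** Multiplication of the solution by [i]. Paired with the original solution in [symp], it gives the
    mass density. *)
Lemma real_solution_rot a ax b bx : real_solution a ax b bx ->
  real_solution (fun t x => - b t x) (fun t x => - bx t x) a ax.
Proof.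
move=> [ca cb da db].
have qa t := let: And3 _ _ h := (ca.1 t) in h.
have qb t := let: And3 _ _ h := (cb.1 t) in h.
have ra t := let: And3 _ h _ := (ca.1 t) in h.
have rb t := let: And3 _ h _ := (cb.1 t) in h.
have potN t : pot (fun x => - b t x) (a t) = pot (a t) (b t).
  by apply/funext => x; rewrite /pot /dens sqrrN addrC.
split => // [|t|t]; first exact: H1_curve_opp.
- have := weak_dt_opp _ (sqiN measurableT (qa t))
    (sqiN measurableT (pot_sqi (ca.1 t) (cb.1 t) (ra t))) (db t).
  rewrite potN; have -> : (fun x => - - ax t x) = ax t by apply/funext => x; rewrite opprK.
  have -> : (fun x => - - (pot (a t) (b t) x * a t x)) = (fun x => pot (a t) (b t) x * a t x).
    by apply/funext => x; rewrite opprK.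
  by apply => s; exists (bx s); exact: cb.1.
- rewrite potN; have -> : (fun x => - - bx t x) = bx t by apply/funext => x; rewrite opprK.
  have -> // : (fun x => - (pot (a t) (b t) x * - b t x)) = (fun x => pot (a t) (b t) x * b t x).
  by apply/funext => x; rewrite mulrN opprK.
Qed.

(** With [u = a + i b] and [v = al + i be], this is the imaginary part of the integral of [psi]
    times the conjugate of [u] times [v]. *)
Definition symp psi (a b al be : R -> R) : R := \int[mu]_x (psi x * (a x * be x - b x * al x)).

(** The terms [psi ax alx] and [psi bx bex] occur twice with opposite signs and cancel. What is left
    has at most one derivative on each product, and the nonlinearity enters through the difference
    of the two potentials. *)
Lemma bilinear_derivative a ax b bx al alx be bex psi kap (M t : R) :
  real_solution a ax b bx -> real_solution al alx be bex -> multiplier psi kap M ->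
  is_derive t (1 : R) (fun t => symp psi (a t) (b t) (al t) (be t))
   (\int[mu]_x (kap x * ((bx t x * be t x - alx t x * a t x) + (ax t x * al t x - bex t x * b t x)))
    + \int[mu]_x (psi x * ((a t x * al t x + b t x * be t x) *
                         (pot (a t) (b t) x - pot (al t) (be t) x)))).
Proof.
move=> [ca cb da db] [cal cbe dal dbe] mpsi.
have [apsi mkap bpsi] := mpsi.
have mpsi' : measurable_fun setT psi by apply: cont_meas => //; exact: ac_cont apsi.
have S1 (c cx : R -> R -> R) s : H1_curve c cx -> sqi setT (c s) by move=> [H _]; have [] := H s.
have S2 (c cx : R -> R -> R) s : H1_curve c cx -> sqi setT (cx s) by move=> [H _]; have [] := H s.
have a_ s := S1 _ _ s ca; have b_ s := S1 _ _ s cb; have al_ s := S1 _ _ s cal; have be_ s := S1 _ _ s cbe.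
have ax_ := S2 _ _ t ca; have bx_ := S2 _ _ t cb; have alx_ := S2 _ _ t cal; have bex_ := S2 _ _ t cbe.
have Pm g : sqi setT g -> sqi setT (fun x => psi x * g x).
  by move=> sg; apply: (sqiM (M := M)) => // x _; exact: (bpsi x).1.
have Km g : sqi setT g -> sqi setT (fun x => kap x * g x).
  by move=> sg; apply: (sqiM (M := M)) => // x _; exact: (bpsi x).2.
have pu g : sqi setT g -> sqi setT (fun x => pot (a t) (b t) x * g x) by exact: pot_sqi (ca.1 t) (cb.1 t).
have pv g : sqi setT g -> sqi setT (fun x => pot (al t) (be t) x * g x) by exact: pot_sqi (cal.1 t) (cbe.1 t).
(* Discrete product rule: the increment of one factor is tested against the other factor at the new
   time, and the increment of that other factor against the first one frozen at time [t]. *)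
have cst c cx : H1_curve c cx -> H1_curve (fun=> c t) (fun=> cx t).
  move=> [H _]; split => // s e e0; exists 1 => // s' _.
  by rewrite N2_subrr ltW.
have P1 := weak_dt_pair (da t) bx_ (pu _ (b_ t)) (H1_curve_mul mpsi cbe).
have P2 := weak_dt_pair (dbe t) (sqiN measurableT alx_) (sqiN measurableT (pv _ (al_ t))) (H1_curve_mul mpsi (cst _ _ ca)).
have P3 := weak_dt_pair (db t) (sqiN measurableT ax_) (sqiN measurableT (pu _ (a_ t))) (H1_curve_mul mpsi cal).
have P4 := weak_dt_pair (dal t) bex_ (pv _ (be_ t)) (H1_curve_mul mpsi (cst _ _ cb)).
apply/is_derive_epsP => e e0; have e4 : 0 < e / 4 by rewrite divr_gt0.
have [r1 r10 H1] := P1 _ e4; have [r2 r20 H2] := P2 _ e4.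
have [r3 r30 H3] := P3 _ e4; have [r4 r40 H4] := P4 _ e4.
exists (Num.min (Num.min r1 r2) (Num.min r3 r4)); first by rewrite !lt_min r10 r20 r30 r40.
move=> y; rewrite !lt_min => /andP[/andP[y1 y2] /andP[y3 y4]].
have [->|yt] := eqVneq y t; first by rewrite !subrr mulr0 normr0 mulr0 subrr normr0.
have h0 : y - t != 0 by rewrite subr_eq0.
have := H1 _ h0 y1; have := H2 _ h0 y2; have := H3 _ h0 y3; have := H4 _ h0 y4.
rewrite [t + (y - t)]addrC subrK.
have i2 g1 g2 : sqi setT g1 -> sqi setT g2 -> itg setT (fun x => g1 x * g2 x) by move=> *; exact: sqi_itgM.
have -> : symp psi (a y) (b y) (al y) (be y) - symp psi (a t) (b t) (al t) (be t) =
  \int[mu]_x ((a y x - a t x) * (psi x * be y x)) +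
  \int[mu]_x ((be y x - be t x) * (psi x * a t x)) -
  \int[mu]_x ((b y x - b t x) * (psi x * al y x)) -
  \int[mu]_x ((al y x - al t x) * (psi x * b t x)).
  have j1 : itg setT (fun x => (a y x - a t x) * (psi x * be y x)) by apply: i2; [exact: sqiB|exact: Pm].
  have j2 : itg setT (fun x => (be y x - be t x) * (psi x * a t x)) by apply: i2; [exact: sqiB|exact: Pm].
  have j3 : itg setT (fun x => (b y x - b t x) * (psi x * al y x)) by apply: i2; [exact: sqiB|exact: Pm].
  have j4 : itg setT (fun x => (al y x - al t x) * (psi x * b t x)) by apply: i2; [exact: sqiB|exact: Pm].
  have Q s : itg setT (fun x => psi x * (a s x * be s x - b s x * al s x)).
    apply: (eq_itg measurableT _ (itgB measurableT (i2 _ _ (a_ s) (Pm _ (be_ s))) (i2 _ _ (b_ s) (Pm _ (al_ s))))).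
    by move=> x _; ring.
  rewrite int_comb4// /symp -RintegralB//; [|exact: Q|exact: Q].
  by apply: eq_int => x _; ring.
have kp g1 g2 : sqi setT g1 -> sqi setT g2 -> sqi setT (fun x => kap x * g1 x + psi x * g2 x).
  by move=> *; apply: sqiD => //; [exact: Km|exact: Pm].
set K1 := \int[mu]_x ((a y x - a t x) * _); set K2 := \int[mu]_x ((be y x - be t x) * _).
set K3 := \int[mu]_x ((b y x - b t x) * _); set K4 := \int[mu]_x ((al y x - al t x) * _).
have -> : \int[mu]_x (kap x * ((bx t x * be t x - alx t x * a t x) +
      (ax t x * al t x - bex t x * b t x))) =
    \int[mu]_x (bx t x * (kap x * be t x + psi x * bex t x)) +
    \int[mu]_x (- alx t x * (kap x * a t x + psi x * ax t x)) -
    \int[mu]_x (- ax t x * (kap x * al t x + psi x * alx t x)) -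
    \int[mu]_x (bex t x * (kap x * b t x + psi x * bx t x)).
  have j1 : itg setT (fun x => bx t x * (kap x * be t x + psi x * bex t x)) by apply: i2 => //; exact: kp.
  have j2 : itg setT (fun x => - alx t x * (kap x * a t x + psi x * ax t x)) by apply: i2; [exact: sqiN|exact: kp].
  have j3 : itg setT (fun x => - ax t x * (kap x * al t x + psi x * alx t x)) by apply: i2; [exact: sqiN|exact: kp].
  have j4 : itg setT (fun x => bex t x * (kap x * b t x + psi x * bx t x)) by apply: i2 => //; exact: kp.
  by rewrite int_comb4//; apply: eq_int => x _; ring.
have -> : \int[mu]_x (psi x * ((a t x * al t x + b t x * be t x) *
      (pot (a t) (b t) x - pot (al t) (be t) x))) =
    \int[mu]_x (pot (a t) (b t) x * b t x * (psi x * be t x)) +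
    \int[mu]_x (- (pot (al t) (be t) x * al t x) * (psi x * a t x)) -
    \int[mu]_x (- (pot (a t) (b t) x * a t x) * (psi x * al t x)) -
    \int[mu]_x (pot (al t) (be t) x * be t x * (psi x * b t x)).
  have j1 : itg setT (fun x => pot (a t) (b t) x * b t x * (psi x * be t x)) by apply: i2; [exact: pu|exact: Pm].
  have j2 : itg setT (fun x => - (pot (al t) (be t) x * al t x) * (psi x * a t x)).
    by apply: i2; [apply: sqiN => //; exact: pv|exact: Pm].
  have j3 : itg setT (fun x => - (pot (a t) (b t) x * a t x) * (psi x * al t x)).
    by apply: i2; [apply: sqiN => //; exact: pu|exact: Pm].
  have j4 : itg setT (fun x => pot (al t) (be t) x * be t x * (psi x * b t x)) by apply: i2; [exact: pv|exact: Pm].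
  by rewrite int_comb4//; apply: eq_int => x _; ring.
set A1 := \int[mu]_x (bx t x * _); set A2 := \int[mu]_x (- alx t x * _).
set A3 := \int[mu]_x (- ax t x * _); set A4 := \int[mu]_x (bex t x * _).
set B1 := \int[mu]_x (_ * b t x * _); set B2 := \int[mu]_x (- (_ * al t x) * _).
set B3 := \int[mu]_x (- (_ * a t x) * _); set B4 := \int[mu]_x (_ * be t x * _).
move=> h4 h3 h2 h1.
have -> : K1 + K2 - K3 - K4 - (A1 + A2 - A3 - A4 + (B1 + B2 - B3 - B4)) * (y - t) =
  (K1 - (y - t) * (A1 + B1)) + (K2 - (y - t) * (A2 + B2)) - (K3 - (y - t) * (A3 + B3))
   - (K4 - (y - t) * (A4 + B4)) by ring.
have -> : e * `|y - t| = e / 4 * `|y - t| + e / 4 * `|y - t| + e / 4 * `|y - t| + e / 4 * `|y - t|.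
  by field.
apply: le_trans (ler_normB _ _) (lerD _ h4).
apply: le_trans (ler_normB _ _) (lerD _ h3).
exact: le_trans (ler_normD _ _) (lerD h1 h2).
Qed.

End real_solutions.

(** * The nonlinearity *)

Section nonlinearity.
Variable R : realType.
Implicit Types (g p q phi psi kap : R -> R) (D E : set (measurableTypeR R)).

Lemma MVT_bound g (g' : R -> R) (t0 y D e : R) :
  (forall t, `|t - t0| <= `|y - t0| -> is_derive t (1 : R) g (g' t)) ->
  (forall t, `|t - t0| <= `|y - t0| -> `|g' t - D| <= e) ->
  `|g y - g t0 - D * (y - t0)| <= e * `|y - t0|.
Proof.
move=> dg bg.
have P a b : a <= b -> (forall t, a <= t -> t <= b -> `|t - t0| <= `|y - t0|) ->
    `|g b - g a - D * (b - a)| <= e * (b - a).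
  move=> ab H.
  have cg : {within `[a, b], continuous g}.
    apply: derivable_within_continuous => t; rewrite in_itv/= => /andP[at_ tb].
    have [dt _] := dg t (H t at_ tb); exact: dt.
  have [|c] := MVT_segment (df := g') ab _ cg.
    by move=> t; rewrite in_itv/= => /andP[/ltW at_ /ltW tb]; exact/dg/H.
  rewrite in_itv/= => /andP[ac_ cb] ->.
  rewrite -mulrBl normrM [`|b - a|]ger0_norm ?subr_ge0// ler_wpM2r ?subr_ge0//.
  exact/bg/H.
have [ty|yt] := leP t0 y.
  rewrite [`|y - t0|]ger0_norm ?subr_ge0//; apply: P => // t h1 h2.
  by rewrite !ger0_norm ?subr_ge0// lerD2r.
rewrite [`|y - t0|]distrC [`|t0 - y|]gtr0_norm ?subr_gt0// -normrN.
have -> : - (g y - g t0 - D * (y - t0)) = g t0 - g y - D * (t0 - y) by ring.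
apply: P; first exact: ltW.
move=> t h1 h2; rewrite distrC [`|y - t0|]distrC !ger0_norm ?subr_ge0//; last exact: ltW.
by rewrite lerD2l lerN2.
Qed.

(** The radius [r] is fixed before [n], so the mean value estimate for [X n] on one neighbourhood of
    [t0] passes to the pointwise limit. *)
Lemma limit_derivative (X X' : nat -> R -> R) (J : R -> R) (t0 D : R) :
  (forall n t, is_derive t (1 : R) (X n) (X' n t)) ->
  (forall t, X n t @[n --> \oo] --> J t) ->
  (forall e : R, 0 < e -> exists2 r : R, 0 < r &
     \forall n \near \oo, forall t, `|t - t0| < r -> `|X' n t - D| <= e) ->
  is_derive t0 (1 : R) J D.
Proof.
move=> dX cX H; apply/is_derive_epsP => e e0.
have [r r0 Hr] := H e e0; exists r => // y yr.
have cv : `|X n y - X n t0 - D * (y - t0)| @[n --> \oo] --> `|J y - J t0 - D * (y - t0)|.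
  apply: cvg_norm; apply: cvgB; last exact: cvg_cst.
  by apply: cvgB; exact: cX.
rewrite -(cvg_lim _ cv)//; apply: limr_le; first by apply/cvg_ex; eexists; exact: cv.
apply: filterS Hr => n Hn; apply: (MVT_bound (g' := X' n)) => t tl.
by apply: Hn; apply: le_lt_trans yr.
Qed.

Variable f : R -> R.
Let k s := f (s ^+ 2).

(** The bound is put on the squares because it comes from a bound on the density [|u|^2]. *)
Definition lipschitz_on_bounded := forall K : R, 0 <= K -> exists2 L : R, 0 <= L &
  forall s t : R, 0 <= s -> 0 <= t -> s ^+ 2 <= K -> t ^+ 2 <= K ->
  `|f (s ^+ 2) - f (t ^+ 2)| <= L * `|s - t|.

(* [Gam s] is the integral of [f] over [0, s^2], so that [Gam (|u|)] is the potential energy density. *)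
Definition primitive_nl (Gam : R -> R) := Gam 0 = 0 /\
  forall s, is_derive s (1 : R) Gam (2 * s * f (s ^+ 2)).

Variable Gam : R -> R.
Hypothesis k_cont : continuous k.
Hypothesis k_lip : lipschitz_on_bounded.
Hypothesis Gam_prim : primitive_nl Gam.

Definition virial_nl (s : R) := s ^+ 2 * f (s ^+ 2) - Gam s.

Lemma Gam_cont : continuous Gam.
Proof. by move=> s; apply/differentiable_continuous/derivable1_diffP; have [] := Gam_prim.2 s. Qed.

Lemma sqr_cont : continuous (fun s : R => s ^+ 2).
Proof. by move=> s; exact: exprn_continuous. Qed.

Lemma virial_nl_cont : continuous virial_nl.
Proof.
change (continuous (fun s : R => s ^+ 2 * f (s ^+ 2) - Gam s)) => s.
apply: cvgB; last exact: Gam_cont.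
by apply: cvgM; [exact: sqr_cont|exact: k_cont].
Qed.

Lemma virial_nl0 : virial_nl 0 = 0.
Proof. by rewrite /virial_nl Gam_prim.1 expr0n mul0r subrr. Qed.

Lemma sqr_le_bound (s K : R) : 0 <= K -> s ^+ 2 <= K -> s <= K + 1.
Proof. by move=> K0 sK; rewrite leNgt; apply/negP => h; nra. Qed.

(* [Gam t - Gam s] is the integral of [f] over [s^2, t^2]: this is the trapezoidal rule. *)
Lemma trapezoid (K : R) : 0 <= K -> exists2 C : R, 0 <= C &
  forall s t : R, 0 <= s -> 0 <= t -> s ^+ 2 <= K -> t ^+ 2 <= K ->
  `|(s ^+ 2 + t ^+ 2) / 2 * (k t - k s) - (virial_nl t - virial_nl s)| <= C * (t - s) ^+ 2.
Proof.
move=> K0; have [L L0 HL] := k_lip K0.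
exists (2 * (K + 1) * L); first by apply: mulr_ge0 => //; lra.
suff P s t : 0 <= s -> s <= t -> t ^+ 2 <= K ->
  `|(s ^+ 2 + t ^+ 2) / 2 * (k t - k s) - (virial_nl t - virial_nl s)| <=
  2 * (K + 1) * L * (t - s) ^+ 2.
  move=> s t s0 t0 sK tK; have [st|/ltW ts] := leP s t; first exact: P.
  have -> : (s ^+ 2 + t ^+ 2) / 2 * (k t - k s) - (virial_nl t - virial_nl s) =
    - ((t ^+ 2 + s ^+ 2) / 2 * (k s - k t) - (virial_nl s - virial_nl t)) by field.
  have -> : (t - s) ^+ 2 = (s - t) ^+ 2 by ring.
  by rewrite normrN; exact: P.
move=> s0 st tK; set c := k s + k t.
have t1 := sqr_le_bound K0 tK.
(* The left side is the increment of [hh] over [[s, t]]. With [c = k s + k t] the derivative of [hh]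
   becomes [z ((k z - k s) + (k z - k t))], of size [t - s] by the Lipschitz bound. *)
pose hh z := Gam z - c / 2 * z ^+ 2.
pose h' (z : R) : R := z * ((k z - k s) + (k z - k t)).
have dh z : is_derive z (1 : R) hh (h' z).
  have dG := Gam_prim.2 z.
  have dq : is_derive z (1 : R) (fun z => c / 2 * z ^+ 2) (c * z).
    by apply: is_derive_eq; rewrite /GRing.scale/=; field.
  have := is_deriveB dG dq; congr is_derive; rewrite /h' /c /k.
  by ring.
have -> : (s ^+ 2 + t ^+ 2) / 2 * (k t - k s) - (virial_nl t - virial_nl s) =
    hh t - hh s - 0 * (t - s).
  by rewrite /hh /virial_nl /c -/(k t) -/(k s); field.
have -> : 2 * (K + 1) * L * (t - s) ^+ 2 = 2 * (K + 1) * L * (t - s) * `|t - s|.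
  by rewrite ger0_norm ?subr_ge0//; ring.
have cg : {within `[s, t], continuous hh}.
  apply: derivable_within_continuous => z _; have [dz _] := dh z; exact: dz.
have [z] := MVT_segment st (fun z _ => dh z) cg.
rewrite in_itv/= => /andP[sz zt] ->; rewrite mul0r subr0 normrM ler_wpM2r//.
have z0 : 0 <= z by lra.
have zK : z ^+ 2 <= K by nra.
have sK : s ^+ 2 <= K by nra.
have l1 := HL z s z0 s0 zK sK; have l2 := HL z t z0 (le_trans z0 zt) zK tK.
rewrite [`|z - s|]ger0_norm ?subr_ge0// in l1; rewrite distrC [`|z - t|]distrC [`|t - z|]ger0_norm ?subr_ge0// in l2.
rewrite normrM ger0_norm//.
have -> : 2 * (K + 1) * L * (t - s) = (K + 1) * (2 * L * (t - s)) by ring.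
apply: ler_pM => //; first by lra.
apply: le_trans (ler_normD _ _) _; rewrite [`|k z - k t|]distrC.
have : L * (z - s) <= L * (t - s) by apply: ler_wpM2l => //; lra.
have : L * (t - z) <= L * (t - s) by apply: ler_wpM2l => //; lra.
move: l1 l2; rewrite /k; lra.
Qed.

(** The factor [s + t] keeps the bound at the scale of the density, so that its integral is
    controlled by L^2 norms. *)
Lemma virial_nl_lip (K : R) : 0 <= K -> exists2 C : R, 0 <= C &
  forall s t : R, 0 <= s -> 0 <= t -> s ^+ 2 <= K -> t ^+ 2 <= K ->
  `|virial_nl t - virial_nl s| <= C * ((s + t) * `|t - s|).
Proof.
move=> K0; have [L L0 HL] := k_lip K0; have [C C0 HC] := trapezoid K0.
exists ((K + 1) * L + C); first by apply: addr_ge0 => //; apply: mulr_ge0 => //; lra.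
move=> s t s0 t0 sK tK; have := HC s t s0 t0 sK tK; have := HL t s t0 s0 tK sK.
have s1 := sqr_le_bound K0 sK; have t1 := sqr_le_bound K0 tK.
rewrite -/(k t) -/(k s); set G := virial_nl t - virial_nl s; set Q := _ / 2 * _ => h1 h2.
have d0 := normr_ge0 (t - s).
have : `|Q| <= (K + 1) * L * ((s + t) * `|t - s|).
  rewrite /Q normrM ger0_norm; last by apply: divr_ge0 => //; apply: addr_ge0; exact: sqr_ge0.
  apply: (@le_trans _ _ ((s ^+ 2 + t ^+ 2) / 2 * (L * `|t - s|))).
    by apply: ler_wpM2l => //; apply: divr_ge0 => //; apply: addr_ge0; exact: sqr_ge0.
  have -> : (K + 1) * L * ((s + t) * `|t - s|) = ((K + 1) * (s + t)) * (L * `|t - s|) by ring.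
  apply: ler_wpM2r; first exact: mulr_ge0.
  have := mulr_ge0 s0 s0; have := mulr_ge0 t0 t0; nra.
have : C * (t - s) ^+ 2 <= C * ((s + t) * `|t - s|).
  apply: ler_wpM2l => //; rewrite -(real_normK (num_real (t - s))) expr2 ler_wpM2r//.
  by rewrite ler_norml; apply/andP; split; lra.
have : `|G| <= `|Q| + `|Q - G|.
  by have -> : `|G| = `|Q - (Q - G)|; [congr (`|_|); ring|exact: ler_normB].
lra.
Qed.

Definition vdens (u v : R -> R) x := virial_nl (Num.sqrt (dens u v x)).
Definition gdens (u v : R -> R) x := Gam (Num.sqrt (dens u v x)).

Lemma dens_ge0 (u v : R -> R) x : 0 <= dens u v x.
Proof. by rewrite addr_ge0// sqr_ge0. Qed.

Lemma virialE (u v : R -> R) x :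
  vdens u v x = dens u v x * pot f u v x - gdens u v x.
Proof. by rewrite /vdens /virial_nl /gdens sqr_sqrtr// dens_ge0. Qed.

Lemma sqrt_cont_dens (u v : R -> R) : continuous u -> continuous v ->
  continuous (fun x => Num.sqrt (dens u v x)).
Proof.
move=> cu cv x; apply: (@continuous_comp _ _ _ (dens u v) Num.sqrt); last exact: sqrt_continuous.
have -> : dens u v = fun x => u x * u x + v x * v x.
  by apply/funext => z; rewrite /dens !expr2.
by apply: continuousD; apply: continuousM; (exact: cu || exact: cv).
Qed.

Lemma vdens_cont (u v : R -> R) : continuous u -> continuous v -> continuous (vdens u v).
Proof.
move=> cu cv x; apply: (@continuous_comp _ _ _ (fun x => Num.sqrt (dens u v x)) virial_nl).
  exact: sqrt_cont_dens.
exact: virial_nl_cont.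
Qed.

Lemma modulus_lip (a b c d : R) :
  (Num.sqrt (c ^+ 2 + d ^+ 2) - Num.sqrt (a ^+ 2 + b ^+ 2)) ^+ 2 <= (c - a) ^+ 2 + (d - b) ^+ 2.
Proof.
set s := Num.sqrt (c ^+ 2 + d ^+ 2); set t := Num.sqrt (a ^+ 2 + b ^+ 2).
have s2 : s ^+ 2 = c ^+ 2 + d ^+ 2 by rewrite sqr_sqrtr// addr_ge0// sqr_ge0.
have t2 : t ^+ 2 = a ^+ 2 + b ^+ 2 by rewrite sqr_sqrtr// addr_ge0// sqr_ge0.
have s0 : 0 <= s by exact: sqrtr_ge0.
have t0 : 0 <= t by exact: sqrtr_ge0.
have st : a * c + b * d <= s * t.
  apply: le_trans (ler_norm _) _; rewrite -(@ler_pXn2r _ 2)// ?nnegrE ?mulr_ge0//.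
  rewrite real_normK ?num_real// exprMn s2 t2; have := sqr_ge0 (a * d - b * c); nra.
by rewrite sqrrB s2 t2; lra.
Qed.

(** Polarization writes the scalar product as [(s^2 + t^2 - d) / 2], with [s], [t] the moduli and
    [d] the squared increment; then [trapezoid] applies. Thus the nonlinear term of
    [bilinear_derivative] is minus an increment of the virial density, up to a quadratic error. The
    two points [x] and [y] differ for space translations. *)
Lemma nl_error (K : R) : 0 <= K -> exists2 C : R, 0 <= C &
  forall (u v al be : R -> R) x y, dens u v x <= K -> dens al be y <= K ->
  `|(u x * al y + v x * be y) * (pot f u v x - pot f al be y) + (vdens al be y - vdens u v x)| <=
  C * ((al y - u x) ^+ 2 + (be y - v x) ^+ 2).
Proof.
move=> K0; have [C C0 HC] := trapezoid K0.
have [B HB] := k0_bounded k_cont K.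
exists (C + `|B|); first by rewrite addr_ge0.
move=> u v al be x y uK aK.
set s := Num.sqrt (dens u v x); set t := Num.sqrt (dens al be y).
have s2 : s ^+ 2 = dens u v x by rewrite sqr_sqrtr// dens_ge0.
have t2 : t ^+ 2 = dens al be y by rewrite sqr_sqrtr// dens_ge0.
have s0 : 0 <= s by exact: sqrtr_ge0.
have t0 : 0 <= t by exact: sqrtr_ge0.
have sK : s ^+ 2 <= K by rewrite s2.
have tK : t ^+ 2 <= K by rewrite t2.
have := HC s t s0 t0 sK tK.
rewrite !potE -/s -/t /vdens -/s -/t.
have ml : (t - s) ^+ 2 <= (al y - u x) ^+ 2 + (be y - v x) ^+ 2 by exact: modulus_lip.
set d := _ + (be y - v x) ^+ 2 in ml *.
have -> : u x * al y + v x * be y = (s ^+ 2 + t ^+ 2 - d) / 2.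
  by rewrite s2 t2 /d /dens; field.
have kB z : 0 <= z -> z ^+ 2 <= K -> `|k z| <= `|B|.
  by move=> z0 zK; apply: le_trans (HB z z0 zK) _; exact: ler_norm.
have k1 := kB s s0 sK; have k2 := kB t t0 tK.
rewrite -/(k t) -/(k s); set G := virial_nl t - virial_nl s; set Q := _ / 2 * _ => h2.
have d0 : 0 <= d by rewrite /d addr_ge0// sqr_ge0.
have -> : (s ^+ 2 + t ^+ 2 - d) / 2 * (k s - k t) + G = - (Q - G) + d / 2 * (k t - k s).
  by rewrite /Q; field.
apply: le_trans (ler_normD _ _) _; rewrite normrN [(C + _) * d]mulrDl; apply: lerD.
  by apply: le_trans h2 _; exact: ler_wpM2l.
rewrite normrM ger0_norm; last by apply: divr_ge0.
have -> : `|B| * d = d / 2 * (`|B| + `|B|) by field.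
apply: ler_wpM2l; first exact: divr_ge0.
by apply: le_trans (ler_normB _ _) _; exact: (lerD k2 k1).
Qed.

(** Young's inequality with a free parameter: after integration, a small [l] controls the L^2 norms,
    and closeness in L^2 the second term. *)
Lemma vdens_diff (K : R) : 0 <= K -> exists2 C : R, 0 <= C &
  forall (u v al be : R -> R) x l, 0 < l -> dens u v x <= K -> dens al be x <= K ->
  `|vdens al be x - vdens u v x| <=
  C * (l * (dens u v x + dens al be x) + l^-1 * ((al x - u x) ^+ 2 + (be x - v x) ^+ 2)).
Proof.
move=> K0; have [C C0 HC] := virial_nl_lip K0; exists C => // u v al be x l l0 uK aK.
rewrite /vdens; set s := Num.sqrt (dens u v x); set t := Num.sqrt (dens al be x).
have s2 : s ^+ 2 = dens u v x by rewrite sqr_sqrtr// dens_ge0.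
have t2 : t ^+ 2 = dens al be x by rewrite sqr_sqrtr// dens_ge0.
have s0 : 0 <= s by exact: sqrtr_ge0.
have t0 : 0 <= t by exact: sqrtr_ge0.
have sK : s ^+ 2 <= K by rewrite s2.
have tK : t ^+ 2 <= K by rewrite t2.
apply: le_trans (HC s t s0 t0 sK tK) _; apply: ler_wpM2l => //.
have ml : (t - s) ^+ 2 <= (al x - u x) ^+ 2 + (be x - v x) ^+ 2 by exact: modulus_lip.
rewrite -s2 -t2.
apply: (@le_trans _ _ (l * (s ^+ 2 + t ^+ 2) + l^-1 * (t - s) ^+ 2)); last first.
  by rewrite lerD2l ler_wpM2l// invr_ge0 ltW.
rewrite -(real_normK (num_real (t - s))).
move: (`|t - s|) (normr_ge0 (t - s)) => d d0.
have -> : l * (s ^+ 2 + t ^+ 2) + l^-1 * d ^+ 2 = l * (s ^+ 2 + t ^+ 2 + (l^-1 * d) ^+ 2).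
  by field; rewrite gt_eqF.
have -> : (s + t) * d = l * ((s + t) * (l^-1 * d)) by field; rewrite gt_eqF.
apply: ler_wpM2l; first exact: ltW.
move: (l^-1 * d) => z; have := sqr_ge0 (s - z / 2); have := sqr_ge0 (t - z / 2); nra.
Qed.

Lemma vdens_le (K : R) : 0 <= K -> exists2 C : R, 0 <= C &
  forall (u v : R -> R) x, dens u v x <= K -> `|vdens u v x| <= C * dens u v x.
Proof.
move=> K0; have [C C0 HC] := virial_nl_lip K0; exists C => // u v x uK.
have t0 : 0 <= Num.sqrt (dens u v x) by exact: sqrtr_ge0.
have t2 : Num.sqrt (dens u v x) ^+ 2 = dens u v x by rewrite sqr_sqrtr// dens_ge0.
have z2 : (0 : R) ^+ 2 <= K by rewrite expr0n.
have := HC 0 _ (lexx 0) t0 z2; rewrite t2 => /(_ uK).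
by rewrite virial_nl0 !subr0 add0r [`|Num.sqrt _|]ger0_norm// -expr2 t2.
Qed.

End nonlinearity.

(** * Conservation of mass and energy *)

Section conservation_laws.
Variable R : realType.
Local Notation mu := (@lebesgue_measure R).
Implicit Types (g p q phi psi kap : R -> R) (D E : set (measurableTypeR R)).

Lemma int_eq0 D g : measurable D -> (forall x, D x -> g x = 0) -> \int[mu]_(x in D) g x = 0.
Proof.
move=> mD g0; rewrite (@eq_int _ _ _ (fun=> 0))// Rintegral_cst// mul0r//.
Qed.

Lemma H1_curve_cst phi phix : HS phi phix -> H1_curve (fun=> phi) (fun=> phix).
Proof.
move=> H; split => // s e e0; exists 1 => // s' _.
by rewrite N2_subrr ltW.
Qed.

Lemma weak_dt_test (c cx : R -> R -> R) (t : R) p q phi phix :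
  (forall t, HS (c t) (cx t)) -> weak_dt c t p q -> sqi setT p -> sqi setT q -> HS phi phix ->
  is_derive t (1 : R) (fun s => \int[mu]_x (c s x * phi x))
    (\int[mu]_x (p x * phix x) + \int[mu]_x (q x * phi x)).
Proof.
move=> hc dc sp sq hp; apply/is_derive_epsP => e e0.
have [r r0 Hr] := weak_dt_pair dc sp sq (H1_curve_cst hp) e0.
exists r => // y yr.
have [->|yt] := eqVneq y t; first by rewrite !subrr mulr0 normr0 mulr0 subrr normr0.
have h0 : y - t != 0 by rewrite subr_eq0.
have := Hr _ h0 yr; rewrite [t + (y - t)]addrC subrK [(y - t) * _]mulrC.
congr (_ <= _); congr (`|_ - _|).
have [_ s1 _] := hc y; have [_ s2 _] := hc t; have [_ s3 _] := hp.
rewrite -RintegralB//; [|exact: sqi_itgM|exact: sqi_itgM].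
by apply: eq_int => x _; ring.
Qed.

(** Interpolation between H^{-1} and H^1. The increment over [[s, s + h]] serves as a fixed test
    function for itself: the pairing has a time derivative bounded by a constant times the H^1 norm
    of the increment, which is small by continuity in H^1. The squared L^2 increment is therefore
    [o(h)]. *)
Lemma H1_curve_dual_lip (c cx p q : R -> R -> R) (t0 B r0 : R) : H1_curve c cx ->
  (forall t, weak_dt c t (p t) (q t)) -> (forall t, sqi setT (p t)) -> (forall t, sqi setT (q t)) ->
  0 < r0 -> 0 <= B ->
  (forall t, `|t - t0| < r0 -> \int[mu]_x p t x ^+ 2 <= B /\ \int[mu]_x q t x ^+ 2 <= B) ->
  forall e : R, 0 < e -> exists2 r : R, 0 < r & forall s h, `|s - t0| < r -> 0 < h -> h < r ->
    \int[mu]_x (c (s + h) x - c s x) ^+ 2 <= e * h.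
Proof.
move=> cc dc sp sq r00 B0 HB e e0; have [H1 H2] := cc.
have B1 : 0 < 4 * (B + 1) by lra.
have e2 : 0 < e / 2 by rewrite divr_gt0.
(* Both ends of the increment are this close to the state at [t0], so its squared H^1 norm is at
   most four times this constant. *)
have [r1 r10 Hr1] := H2 t0 ((e / 2) ^+ 2 / (4 * (B + 1))) (divr_gt0 (exprn_gt0 2 e2) B1).
have [m [m0 m1 m2]] : exists m : R, [/\ 0 < m, m <= r0 & m <= r1].
  by exists (Num.min r0 r1); rewrite lt_min r00 r10 ge_min lexx ge_min lexx orbT.
exists (m / 2); first by rewrite divr_gt0.
move=> s h st h0 hr.
have near_t u : s <= u -> u <= s + h -> `|u - t0| < m.
  by move=> su us; move: st; rewrite !ltr_norml => /andP[? ?]; apply/andP; split; lra.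
have d1 := Hr1 s ltac:(apply: lt_le_trans (near_t _ _ _) m2; lra).
have d2 := Hr1 (s + h) ltac:(apply: lt_le_trans (near_t _ _ _) m2; lra).
pose phi x := c (s + h) x - c s x; pose phix x := cx (s + h) x - cx s x.
have hp : HS phi phix by exact: HS_sub.
have Np : N2 phi phix <= (e / 2) ^+ 2 / (B + 1).
  have := N2_add (HS_sub (H1 (s + h)) (H1 t0)) (HS_scale (-1) (HS_sub (H1 s) (H1 t0))).
  rewrite N2_scale; last exact: HS_sub.
  have -> : (fun x => c (s + h) x - c t0 x + -1 * (c s x - c t0 x)) = phi.
    by apply/funext => x; rewrite /phi; ring.
  have -> : (fun x => cx (s + h) x - cx t0 x + -1 * (cx s x - cx t0 x)) = phix.
    by apply/funext => x; rewrite /phix; ring.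
  rewrite sqrrN expr1n mul1r => /le_trans; apply.
  have -> : (e / 2) ^+ 2 / (B + 1) = 2 * ((e / 2) ^+ 2 / (4 * (B + 1))) + 2 * ((e / 2) ^+ 2 / (4 * (B + 1))).
    by field; rewrite gt_eqF//; lra.
  lra.
pose m_ u := \int[mu]_x (c u x * phi x).
have dm u : is_derive u (1 : R) m_ (\int[mu]_x (p u x * phix x) + \int[mu]_x (q u x * phi x)).
  exact: weak_dt_test H1 (dc u) (sp u) (sq u) hp.
have [_ p1 p2] := hp.
have bm u : s <= u -> u <= s + h -> `|\int[mu]_x (p u x * phix x) + \int[mu]_x (q u x * phi x)| <= e.
  move=> su us; have [b1 b2] := HB u (lt_le_trans (near_t u su us) m1).
  have BN : B * ((e / 2) ^+ 2 / (B + 1)) <= (e / 2) ^+ 2.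
    rewrite mulrA ler_pdivrMr; last lra.
    by rewrite mulrC ler_wpM2l ?sqr_ge0//; lra.
  rewrite (splitr e); apply: le_trans (ler_normD _ _) _; apply: lerD.
    apply: (int_CS_le measurableT (sp u) p2 b1 _ BN (ltW e2)).
    by apply: le_trans Np; rewrite /N2 lerDr; exact: int_sq_ge0.
  apply: (int_CS_le measurableT (sq u) p1 b2 _ BN (ltW e2)).
  by apply: le_trans Np; rewrite /N2 lerDl; exact: int_sq_ge0.
have sh : s <= s + h by lra.
have cg : {within `[s, s + h], continuous m_}.
  by apply: derivable_within_continuous => u _; have [du _] := dm u; exact: du.
have [u] := MVT_segment sh (fun u _ => dm u) cg.
rewrite in_itv/= => /andP[su us].
have -> : m_ (s + h) - m_ s = \int[mu]_x (c (s + h) x - c s x) ^+ 2.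
  have [_ s1 _] := H1 (s + h); have [_ s2 _] := H1 s.
  rewrite /m_ -RintegralB//; [|exact: sqi_itgM|exact: sqi_itgM].
  by apply: eq_int => x _; rewrite /phi; ring.
move=> ->; rewrite [s + h - s]addrAC subrr add0r ler_wpM2r ?(ltW h0)//.
exact: le_trans (ler_norm _) (bm u su us).
Qed.

Variables (f Gam : R -> R).
Hypothesis k_cont : continuous (fun s : R => f (s ^+ 2)).
Hypothesis k_lip : lipschitz_on_bounded f.
Hypothesis Gam_prim : primitive_nl f Gam.

Variables a ax b bx : R -> R -> R.
Hypothesis sol : real_solution f a ax b bx.

Definition H1sq (t : R) := N2 (a t) (ax t) + N2 (b t) (bx t).

Let ca : H1_curve a ax. Proof. by case: sol. Qed.
Let cb : H1_curve b bx. Proof. by case: sol. Qed.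
Let ha t : HS (a t) (ax t). Proof. exact: ca.1. Qed.
Let hb t : HS (b t) (bx t). Proof. exact: cb.1. Qed.
Let sa t : sqi setT (a t). Proof. by case: (ha t). Qed.
Let sb t : sqi setT (b t). Proof. by case: (hb t). Qed.
Let sax t : sqi setT (ax t). Proof. by case: (ha t). Qed.
Let sbx t : sqi setT (bx t). Proof. by case: (hb t). Qed.
Let cta t : continuous (a t). Proof. by case: (ha t) => /ac_cont. Qed.
Let ctb t : continuous (b t). Proof. by case: (hb t) => /ac_cont. Qed.

Lemma dens_bound t x : dens (a t) (b t) x <= H1sq t.
Proof. by apply: lerD; apply: HS_sup. Qed.

Lemma H1sq_ge0 t : 0 <= H1sq t.
Proof. by apply: addr_ge0; exact: N2_ge0. Qed.

Lemma H1sq_locally_bounded t0 : exists2 r : R, 0 < r &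
  forall t, `|t - t0| < r -> H1sq t <= 2 * H1sq t0 + 4.
Proof.
have [r1 r10 H1] := H1_curve_bounded t0 ca; have [r2 r20 H2] := H1_curve_bounded t0 cb.
exists (Num.min r1 r2); first by rewrite lt_min r10 r20.
by move=> t; rewrite lt_min => /andP[/H1 h1 /H2 h2]; rewrite /H1sq; lra.
Qed.

Lemma dens_itg t : itg setT (dens (a t) (b t)).
Proof. by apply: itgD => //; [exact: (sa t).2|exact: (sb t).2]. Qed.

Lemma int_dens t : \int[mu]_x dens (a t) (b t) x =
  \int[mu]_x a t x ^+ 2 + \int[mu]_x b t x ^+ 2.
Proof. by rewrite -RintegralD//; [exact: (sa t).2|exact: (sb t).2]. Qed.

Lemma int_dens_le t : \int[mu]_x dens (a t) (b t) x <= H1sq t.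
Proof.
rewrite int_dens /H1sq /N2; have := int_sq_ge0 setT (ax t); have := int_sq_ge0 setT (bx t); lra.
Qed.

Lemma multiplier1 : multiplier (fun=> 1 : R) (fun=> 0) 1.
Proof.
split => //; last by move=> x; rewrite normr1 normr0.
by apply: ac_C1; exact: cst_continuous.
Qed.

(** The solution is paired with [i] times itself. Both have the same modulus, so the potentials
    cancel and only the flux through [kap] remains. *)
Lemma weighted_mass_derivative psi kap (M t : R) : multiplier psi kap M ->
  is_derive t (1 : R) (fun t => \int[mu]_x (psi x * dens (a t) (b t) x))
    (2 * \int[mu]_x (kap x * (bx t x * a t x - ax t x * b t x))).
Proof.
move=> mp; have [_ mk bk] := mp.
have := bilinear_derivative k_cont t sol (real_solution_rot k_cont sol) mp.
rewrite /symp.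
have -> : (fun t => \int[mu]_x (psi x * (a t x * a t x - b t x * - b t x))) =
  (fun t => \int[mu]_x (psi x * dens (a t) (b t) x)).
  by apply/funext => s; apply: eq_int => x _; rewrite /dens; ring.
congr is_derive.
have -> : \int[mu]_x (psi x * ((a t x * - b t x + b t x * a t x) *
    (pot f (a t) (b t) x - pot f (fun x0 => - b t x0) (a t) x))) = 0.
  by apply: int_eq0 => // x _; rewrite /pot /dens sqrrN [b t x ^+ 2 + _]addrC subrr mulr0 mulr0.
have K1 g : sqi setT g -> sqi setT (fun x => kap x * g x).
  by move=> sg; apply: (sqiM (M := M)) => // x _; exact: (bk x).2.
rewrite addr0 -RintegralZl//; last first.
  apply: (eq_itg measurableT _ (itgB measurableT (sqi_itgM measurableT (K1 _ (sbx t)) (sa t))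
     (sqi_itgM measurableT (K1 _ (sax t)) (sb t)))) => x _; ring.
by apply: eq_int => x _; ring.
Qed.

Lemma mass_conserved s t :
  \int[mu]_x dens (a s) (b s) x = \int[mu]_x dens (a t) (b t) x.
Proof.
apply: (is_derive_0_is_cst (f := fun t => \int[mu]_x dens (a t) (b t) x)) => u.
have := weighted_mass_derivative u multiplier1.
have -> : (fun t => \int[mu]_x (1 * dens (a t) (b t) x)) = (fun t => \int[mu]_x dens (a t) (b t) x).
  by apply/funext => z; apply: eq_int => x _; rewrite mul1r.
congr is_derive.
by rewrite int_eq0 ?mulr0// => x _; rewrite mul0r.
Qed.

Lemma vdens_itg t : itg setT (vdens f Gam (a t) (b t)).
Proof.
have [C C0 HC] := vdens_le k_lip Gam_prim (H1sq_ge0 t).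
apply: (itg_dom measurableT _ (itgZ C measurableT (dens_itg t))).
  by apply: cont_meas => //; exact: vdens_cont.
by move=> x _; apply: HC; exact: dens_bound.
Qed.

Lemma gdens_itg t : itg setT (gdens Gam (a t) (b t)).
Proof.
have h : itg setT (fun x => dens (a t) (b t) x * pot f (a t) (b t) x).
  apply: (eq_itg measurableT _ (itgD measurableT
    (sqi_itgM measurableT (sa t) (pot_sqi k_cont (ha t) (hb t) (sa t)))
    (sqi_itgM measurableT (sb t) (pot_sqi k_cont (ha t) (hb t) (sb t))))) => x _.
  by rewrite /dens; ring.
apply: (eq_itg measurableT _ (itgB measurableT h (vdens_itg t))) => x _.
by rewrite virialE; ring.
Qed.

Lemma vdens_time_cont t0 (e : R) : 0 < e -> exists2 r : R, 0 < r & forall t, `|t - t0| < r ->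
  \int[mu]_x `|vdens f Gam (a t) (b t) x - vdens f Gam (a t0) (b t0) x| <= e.
Proof.
move=> e0; have [r1 r10 H1] := H1sq_locally_bounded t0.
have K0 : 0 <= 2 * H1sq t0 + 4 by have := H1sq_ge0 t0; lra.
move: (2 * H1sq t0 + 4) K0 H1 => K K0 H1.
have [C C0 HC] := vdens_diff k_lip Gam_prim K0.
have CK : 0 < 4 * (C + 1) * (K + 1) by rewrite !mulr_gt0//; lra.
(* [l] is fixed first and makes the contribution of the L^2 norms at most [e / 2]; the bound [d] on
   the squared H^1 distance is then chosen depending on [l]. *)
pose l := e / (4 * (C + 1) * (K + 1)).
have l0 : 0 < l by exact: divr_gt0.
have [d [d0 dC]] : exists d : R, 0 < d /\ C * (l^-1 * (d + d)) <= e / 2.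
  exists (l * (e / (4 * (C + 1)))); split.
    by rewrite mulr_gt0// divr_gt0// mulr_gt0//; lra.
  have -> : C * (l^-1 * (l * (e / (4 * (C + 1))) + l * (e / (4 * (C + 1))))) = (e / 2) * (C / (C + 1)).
    by field; rewrite (gt_eqF l0)/= gt_eqF//; lra.
  rewrite ger_pMr ?divr_gt0// ler_pdivrMr; lra.
have lC : C * (l * (K + K)) <= e / 2.
  have -> : C * (l * (K + K)) = (e / 2) * ((C * K) / ((C + 1) * (K + 1))).
    by rewrite /l; field; rewrite !gt_eqF//; lra.
  rewrite ger_pMr ?divr_gt0// ler_pdivrMr; last by rewrite mulr_gt0//; lra.
  by rewrite mul1r; nra.
have [r2 r20 H2] := ca.2 t0 d d0; have [r3 r30 H3] := cb.2 t0 d d0.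
exists (Num.min r1 (Num.min r2 r3)); first by rewrite !lt_min r10 r20 r30.
move=> t; rewrite !lt_min => /andP[/H1 h1 /andP[/H2 h2 /H3 h3]].
have h10 : H1sq t0 <= K by apply: H1; rewrite subrr normr0.
have si : itg setT (fun x => C * (l * (dens (a t0) (b t0) x + dens (a t) (b t) x) +
    l^-1 * ((a t x - a t0 x) ^+ 2 + (b t x - b t0 x) ^+ 2))).
  apply: itgZ => //; apply: itgD => //; apply: itgZ => //; apply: itgD => //; try exact: dens_itg.
    exact: (sqiB measurableT (sa t) (sa t0)).2.
  exact: (sqiB measurableT (sb t) (sb t0)).2.
apply: (@le_trans _ _ (\int[mu]_x (C * (l * (dens (a t0) (b t0) x + dens (a t) (b t) x) +
    l^-1 * ((a t x - a t0 x) ^+ 2 + (b t x - b t0 x) ^+ 2))))).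
  apply: le_int => //; first by apply: itg_norm; apply: itgB => //; exact: vdens_itg.
  move=> x _; apply: HC => //; first exact: le_trans (dens_bound t0 x) h10.
  exact: le_trans (dens_bound t x) h1.
have ia : itg setT (fun x => (a t x - a t0 x) ^+ 2) by exact: (sqiB measurableT (sa t) (sa t0)).2.
have ib : itg setT (fun x => (b t x - b t0 x) ^+ 2) by exact: (sqiB measurableT (sb t) (sb t0)).2.
have id0 := dens_itg t0; have id1 := dens_itg t.
have idd := itgD measurableT id0 id1; have iab := itgD measurableT ia ib.
have lidd := itgZ l measurableT idd; have liab := itgZ l^-1 measurableT iab.
have ii := itgD measurableT lidd liab.
rewrite RintegralZl// (RintegralD measurableT lidd liab) RintegralZl//.
rewrite (RintegralD measurableT id0 id1) RintegralZl// (RintegralD measurableT ia ib).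
rewrite mulrDr (splitr e); apply: lerD.
  apply: le_trans lC; apply: ler_wpM2l => //; apply: ler_wpM2l; first exact: ltW.
  by apply: lerD; [exact: le_trans (int_dens_le t0) h10|exact: le_trans (int_dens_le t) h1].
apply: le_trans dC; apply: ler_wpM2l => //; apply: ler_wpM2l; first by rewrite invr_ge0 ltW.
apply: lerD.
  by apply: le_trans h2; rewrite /N2 lerDl; exact: int_sq_ge0.
by apply: le_trans h3; rewrite /N2 lerDl; exact: int_sq_ge0.
Qed.

Definition hn (n : nat) : R := n.+1%:R^-1.

Lemma hn_gt0 n : 0 < hn n.
Proof. by rewrite invr_gt0. Qed.

Lemma hn_cvg : hn n @[n --> \oo] --> (0 : R).
Proof. exact: cvg_harmonic. Qed.

Lemma hn_lt (r : R) : 0 < r -> \forall n \near \oo, hn n < r.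
Proof.
move=> r0; have /cvgrPdist_lt/(_ r r0) := hn_cvg; apply: filterS => n.
by rewrite sub0r normrN gtr0_norm ?hn_gt0.
Qed.

Lemma derive_seq g (t d : R) : is_derive t (1 : R) g d ->
  (hn n)^-1 * (g (t + hn n) - g t) @[n --> \oo] --> d.
Proof.
move=> /is_derive_epsP H; apply/cvgrPdist_le => e e0.
have [r r0 Hr] := H e e0; apply: filterS (hn_lt r0) => n hr.
have h0 := hn_gt0 n.
have := Hr (t + hn n); rewrite [t + hn n - t]addrAC subrr add0r gtr0_norm// => /(_ hr).
rewrite [`|d - _|]distrC -[X in _ -> `|X| <= _](_ : (hn n)^-1 * (g (t + hn n) - g t - d * hn n) = _).
  by rewrite [e * _]mulrC normrM gtr0_norm ?invr_gt0// ler_pdivrMl.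
by field; rewrite gt_eqF.
Qed.

Lemma pot_sq_le (K B : R) t g : (forall s, 0 <= s -> s ^+ 2 <= K -> `|f (s ^+ 2)| <= B) ->
  H1sq t <= K -> sqi setT g ->
  \int[mu]_x (pot f (a t) (b t) x * g x) ^+ 2 <= B ^+ 2 * \int[mu]_x g x ^+ 2.
Proof.
move=> HB tK sg; apply: int_sq_mul => //.
  by apply: cont_meas => //; exact: pot_meas.
move=> x; rewrite potE; apply: HB; first exact: sqrtr_ge0.
by rewrite sqr_sqrtr ?dens_ge0//; exact: le_trans (dens_bound t x) tK.
Qed.

Lemma time_increment_small t0 (e : R) : 0 < e -> exists2 r : R, 0 < r &
  forall s h, `|s - t0| < r -> 0 < h -> h < r ->
    \int[mu]_x (a (s + h) x - a s x) ^+ 2 <= e * h /\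
    \int[mu]_x (b (s + h) x - b s x) ^+ 2 <= e * h.
Proof.
move=> e0; have [r0 r00 Hr0] := H1sq_locally_bounded t0.
have K0 : 0 <= 2 * H1sq t0 + 4 by have := H1sq_ge0 t0; lra.
move: (2 * H1sq t0 + 4) K0 Hr0 => K K0 Hr0.
have [B HB] := k0_bounded k_cont K.
have B2K : 0 <= B ^+ 2 * K by rewrite mulr_ge0// sqr_ge0.
have [_ _ da db] := sol.
have i0 D g : 0 <= \int[mu]_(x in D) g x ^+ 2 by exact: int_sq_ge0.
have pa t : sqi setT (fun x => pot f (a t) (b t) x * a t x) by exact: pot_sqi.
have pb t : sqi setT (fun x => pot f (a t) (b t) x * b t x) by exact: pot_sqi.
have intN2 g : \int[mu]_x (- g x) ^+ 2 = \int[mu]_x g x ^+ 2.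
  by apply: eq_int => x _; rewrite sqrrN.
have bnd t : `|t - t0| < r0 -> [/\ \int[mu]_x ax t x ^+ 2 <= K + B ^+ 2 * K,
   \int[mu]_x bx t x ^+ 2 <= K + B ^+ 2 * K,
   \int[mu]_x (pot f (a t) (b t) x * a t x) ^+ 2 <= K + B ^+ 2 * K &
   \int[mu]_x (pot f (a t) (b t) x * b t x) ^+ 2 <= K + B ^+ 2 * K].
  move=> /Hr0 tK; have := pot_sq_le HB tK (sa t); have := pot_sq_le HB tK (sb t).
  have : B ^+ 2 * \int[mu]_x a t x ^+ 2 <= B ^+ 2 * K.
    apply: ler_wpM2l; first exact: sqr_ge0.
    apply: le_trans tK; rewrite /H1sq /N2; have := i0 setT (ax t); have := i0 setT (bx t).
    by have := i0 setT (b t); lra.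
  have : B ^+ 2 * \int[mu]_x b t x ^+ 2 <= B ^+ 2 * K.
    apply: ler_wpM2l; first exact: sqr_ge0.
    apply: le_trans tK; rewrite /H1sq /N2; have := i0 setT (ax t); have := i0 setT (bx t).
    by have := i0 setT (a t); lra.
  move: tK; rewrite /H1sq /N2; have := i0 setT (ax t); have := i0 setT (bx t).
  have := i0 setT (a t); have := i0 setT (b t).
  by split; lra.
have KB0 : 0 <= K + B ^+ 2 * K by lra.
have [r1 r10 H1] := H1_curve_dual_lip ca da sbx pb r00 KB0
  (fun t ht => conj (let: And4 _ h _ _ := bnd t ht in h) (let: And4 _ _ _ h := bnd t ht in h)) e0.
have bnd2 t : `|t - t0| < r0 -> \int[mu]_x (- ax t x) ^+ 2 <= K + B ^+ 2 * K /\
   \int[mu]_x (- (pot f (a t) (b t) x * a t x)) ^+ 2 <= K + B ^+ 2 * K.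
  by move=> /bnd[h1 _ h3 _]; rewrite !intN2.
have [r2 r20 H2] := H1_curve_dual_lip cb db (fun t => sqiN measurableT (sax t))
  (fun t => sqiN measurableT (pa t)) r00 KB0 bnd2 e0.
exists (Num.min r1 r2); first by rewrite lt_min r10 r20.
by move=> s h; rewrite !lt_min => /andP[s1 s2] h0 /andP[h1 h2]; split; [exact: H1|exact: H2].
Qed.

Lemma vint_cont : continuous (fun t => \int[mu]_x vdens f Gam (a t) (b t) x).
Proof.
apply/continuous_epsP => t0 e e0; have [r r0 Hr] := vdens_time_cont t0 e0.
exists r => // t /Hr; apply: le_trans.
rewrite -RintegralB//; [|exact: vdens_itg|exact: vdens_itg].
by apply: le_normr_Rintegral => //; apply: itgB => //; exact: vdens_itg.
Qed.

Definition energy t := \int[mu]_x ax t x ^+ 2 + \int[mu]_x bx t x ^+ 2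
  + \int[mu]_x gdens Gam (a t) (b t) x.

(* A solution in H^1 cannot be tested against its own time derivative. Instead [X n] pairs it with
   its time translate by [hn n]: this tends to [- energy], while the derivative of [X n] is bounded
   by the squared L^2 increment over [hn n], which tends to 0. *)
Lemma energy_conserved s1 s2 : energy s1 = energy s2.
Proof.
(* By [nl_error] the derivative of the pairing is close to minus a time increment of the integrated
   virial density. The increment of the antiderivative [P] compensates it, and also turns the limit
   of the pairing into minus the energy. *)
have [P dP] := antiderivative_exists vint_cont.
pose V t := \int[mu]_x vdens f Gam (a t) (b t) x.
pose X n s := (hn n)^-1 * symp (fun=> 1) (a s) (b s) (a (s + hn n)) (b (s + hn n)) +
  (hn n)^-1 * (P (s + hn n) - P s).
pose Y n s := \int[mu]_x (1 * ((a s x * a (s + hn n) x + b s x * b (s + hn n) x) *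
    (pot f (a s) (b s) x - pot f (a (s + hn n)) (b (s + hn n)) x))).
pose X' n s := (hn n)^-1 * (Y n s) + (hn n)^-1 * (V (s + hn n) - V s).
have dX n u : is_derive u (1 : R) (X n) (X' n u).
  have := bilinear_derivative k_cont u sol (real_solution_time (hn n) sol) multiplier1.
  rewrite [X in X + _]int_eq0// ?add0r => [d1|x _]; last by rewrite mul0r.
  have d2 : is_derive u (1 : R) (fun s => P (s + hn n) - P s) (V (u + hn n) - V u).
    apply: is_deriveB.
    have /is_derive_epsP H := dP (u + hn n).
    apply/is_derive_epsP => e e0; have [r r0 Hr] := H e e0; exists r => // y yr.
    have E : y + hn n - (u + hn n) = y - u by ring.
    by have := Hr (y + hn n); rewrite E => /(_ yr).
  have := is_deriveD (is_deriveZ ((hn n)^-1) d1) (is_deriveZ ((hn n)^-1) d2).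
  by [].
have cX u : X n u @[n --> \oo] --> - energy u.
  have [_ _ da db] := sol.
  have pa : sqi setT (fun x => pot f (a u) (b u) x * a u x) by exact: pot_sqi.
  have pb : sqi setT (fun x => pot f (a u) (b u) x * b u x) by exact: pot_sqi.
  have c1 := derive_seq (weak_dt_test hb (db u) (sqiN measurableT (sax u)) (sqiN measurableT pa) (ha u)).
  have c2 := derive_seq (weak_dt_test ha (da u) (sbx u) pb (hb u)).
  have c3 := derive_seq (dP u).
  have := cvgD (cvgB c1 c2) c3.
  have -> : - energy u =
    \int[mu]_x (- ax u x * ax u x) + \int[mu]_x (- (pot f (a u) (b u) x * a u x) * a u x) -
    (\int[mu]_x (bx u x * bx u x) + \int[mu]_x (pot f (a u) (b u) x * b u x * b u x)) +
    \int[mu]_x vdens f Gam (a u) (b u) x.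
    have e1 : \int[mu]_x (- ax u x * ax u x) = - \int[mu]_x ax u x ^+ 2.
      rewrite -intN//; last exact: (sax u).2.
      by apply: eq_int => x _; ring.
    have e2 : \int[mu]_x (bx u x * bx u x) = \int[mu]_x bx u x ^+ 2.
      by apply: eq_int => x _; ring.
    have iaa := sqi_itgM measurableT pa (sa u); have ibb := sqi_itgM measurableT pb (sb u).
    have e3 : \int[mu]_x (- (pot f (a u) (b u) x * a u x) * a u x) =
        - \int[mu]_x (pot f (a u) (b u) x * a u x * a u x).
      by rewrite -intN//; apply: eq_int => x _; ring.
    have e4 : \int[mu]_x vdens f Gam (a u) (b u) x =
        \int[mu]_x (pot f (a u) (b u) x * a u x * a u x) +
        \int[mu]_x (pot f (a u) (b u) x * b u x * b u x) - \int[mu]_x gdens Gam (a u) (b u) x.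
      have iab := itgD measurableT iaa ibb; have ig := gdens_itg u.
      rewrite -(RintegralD measurableT iaa ibb) -(RintegralB measurableT iab ig).
      by apply: eq_int => x _; rewrite virialE /dens; ring.
    by rewrite /energy e1 e2 e3 e4; ring.
  suff -> : X^~ u = fun n => (hn n)^-1 * (\int[mu]_x (b (u + hn n) x * a u x) -
      \int[mu]_x (b u x * a u x)) - (hn n)^-1 * (\int[mu]_x (a (u + hn n) x * b u x) -
      \int[mu]_x (a u x * b u x)) + (hn n)^-1 * (P (u + hn n) - P u) by move=> cv; exact: cv.
  apply/funext => n /=; rewrite /X; congr (_ + _).
  rewrite -mulrBr; congr (_ * _).
  have j1 : itg setT (fun x => b (u + hn n) x * a u x) by exact: sqi_itgM.
  have j2 : itg setT (fun x => b u x * a u x) by exact: sqi_itgM.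
  have j3 : itg setT (fun x => a (u + hn n) x * b u x) by exact: sqi_itgM.
  have j4 : itg setT (fun x => a u x * b u x) by exact: sqi_itgM.
  have -> : \int[mu]_x (a u x * b u x) = \int[mu]_x (b u x * a u x).
    by apply: eq_int => x _; rewrite mulrC.
  rewrite /symp opprB [X in _ = X](_ : _ = \int[mu]_x (b (u + hn n) x * a u x) -
    \int[mu]_x (a (u + hn n) x * b u x)); last by ring.
  by rewrite -RintegralB//; apply: eq_int => x _; ring.
have dE u : is_derive u (1 : R) (fun t => - energy t) 0.
  apply: (limit_derivative dX cX) => e e0.
  have [r0 r00 Hr0] := H1sq_locally_bounded u.
  have K0 : 0 <= 2 * H1sq u + 4 by have := H1sq_ge0 u; lra.
  move: (2 * H1sq u + 4) K0 Hr0 => K K0 Hr0.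
  have [C C0 HC] := nl_error k_cont k_lip Gam_prim K0.
  (* The squared increments of [a] and [b], each at most this constant times [hn n], then contribute
     at most [e * hn n] after multiplication by [C]. *)
  have eC : 0 < e / (2 * (C + 1)) by rewrite divr_gt0// mulr_gt0//; lra.
  have [r1 r10 Hr1] := time_increment_small u eC.
  have [m [m0 m1 m2]] : exists m : R, [/\ 0 < m, m <= r0 & m <= r1].
    by exists (Num.min r0 r1); rewrite lt_min r00 r10 ge_min lexx ge_min lexx orbT.
  exists (m / 2); first by rewrite divr_gt0.
  apply: filterS (hn_lt (divr_gt0 m0 (ltr0n R 2))) => n hnm t tu.
  have h0 := hn_gt0 n.
  have tn0 : `|t - u| < r0 by lra.
  have tn1 : `|t + hn n - u| < r0.
    by move: tu; rewrite !ltr_norml => /andP[? ?]; apply/andP; split; lra.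
  have [d1 d2] := Hr1 t (hn n) ltac:(lra) h0 ltac:(lra).
  rewrite subr0 /X' -mulrDr normrM gtr0_norm ?invr_gt0// ler_pdivrMl//.
  have ih : itg setT (fun x => 1 * ((a t x * a (t + hn n) x + b t x * b (t + hn n) x) *
    (pot f (a t) (b t) x - pot f (a (t + hn n)) (b (t + hn n)) x))).
    have p1 s g : sqi setT g -> sqi setT (fun x => pot f (a s) (b s) x * g x) by exact: pot_sqi.
    apply: (eq_itg measurableT _ (itgD measurableT
      (sqi_itgM measurableT (sa (t + hn n)) (sqiB measurableT (p1 t _ (sa t)) (p1 (t + hn n) _ (sa t))))
      (sqi_itgM measurableT (sb (t + hn n)) (sqiB measurableT (p1 t _ (sb t)) (p1 (t + hn n) _ (sb t)))))) => x _.
    ring.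
  have iv1 := vdens_itg (t + hn n); have iv0 := vdens_itg t; have ivv := itgB measurableT iv1 iv0.
  rewrite /Y /V -(RintegralB measurableT iv1 iv0) -(RintegralD measurableT ih ivv).
  have ida := (sqiB measurableT (sa (t + hn n)) (sa t)).2.
  have idb := (sqiB measurableT (sb (t + hn n)) (sb t)).2.
  have idd := itgD measurableT ida idb.
  apply: int_norm => //; first exact: itgD.
  apply: (@le_trans _ _ (\int[mu]_x (C * ((a (t + hn n) x - a t x) ^+ 2 + (b (t + hn n) x - b t x) ^+ 2)))).
    apply: le_int => //; [by apply: itg_norm; exact: itgD|exact: itgZ|].
    move=> x _; rewrite mul1r; apply: HC.
      exact: le_trans (dens_bound _ _) (Hr0 _ tn0).
    exact: le_trans (dens_bound _ _) (Hr0 _ tn1).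
  rewrite RintegralZl// (RintegralD measurableT ida idb).
  apply: (@le_trans _ _ (C * (e / (2 * (C + 1)) * hn n + e / (2 * (C + 1)) * hn n))).
    by apply: ler_wpM2l => //; exact: lerD.
  have -> : C * (e / (2 * (C + 1)) * hn n + e / (2 * (C + 1)) * hn n) = hn n * e * (C / (C + 1)).
    by field; rewrite gt_eqF//; lra.
  rewrite ger_pMr ?mulr_gt0// ler_pdivrMr; lra.
by apply: oppr_inj; exact: (is_derive_0_is_cst (f := fun t => - energy t)).
Qed.

End conservation_laws.

(** * The half-line weight *)

Section half_line_weight.
Variable R : realType.
Local Notation mu := (@lebesgue_measure R).
Implicit Types (g w d p q : R -> R) (D E : set (measurableTypeR R)).

Definition kappa (x : R) : R := if 0 < x then expR (- x) else 0.

Lemma kappa_ge0 x : 0 <= kappa x.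
Proof. by rewrite /kappa; case: ifP => // _; exact: expR_ge0. Qed.

Lemma kappa_le1 x : kappa x <= 1.
Proof.
by rewrite /kappa; case: ifP => [x0|_]; rewrite ?ler01// -expR0 ler_expR; lra.
Qed.

Lemma kappa_abs x : `|kappa x| <= 1.
Proof. by rewrite ger0_norm ?kappa_ge0// kappa_le1. Qed.

Lemma expRN_cont (c : R) : continuous (fun x : R => expR (c * x)).
Proof.
move=> x; apply: (@continuous_comp _ _ _ (fun x => c * x) expR); last exact: continuous_expR.
by apply: cvgM; [exact: cvg_cst|exact: cvg_id].
Qed.

Lemma kappa_meas : measurable_fun setT kappa.
Proof.
have -> : kappa = (fun x => expR (-1 * x)) \_ `]0, +oo[.
  apply/funext => x; rewrite patchE /kappa mulN1r.
  have -> : (x \in `]0, +oo[%classic) = (0 < x); last by [].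
  by apply/idP/idP => [/set_mem/=|h]; [|apply/mem_set => /=]; rewrite in_itv/= andbT.
apply/(measurable_restrictT _ _).1 => //; apply: cont_meas => //; exact: expRN_cont.
Qed.

Lemma kappa_sqi x y : sqi `[x, y] kappa.
Proof.
have h : sqi `[x, y] (fun z => kappa z * 1).
  apply: (@sqiM _ _ _ _ 1) => //; last by apply: sqi_cont; exact: cst_continuous.
    by apply: measurable_funTS; exact: kappa_meas.
  by move=> z _; exact: kappa_abs.
by move: h; congr sqi; apply/funext => z; rewrite mulr1.
Qed.

Lemma ac_expR (c : R) : ac (fun x => expR (c * x)) (fun x => c * expR (c * x)).
Proof.
apply: ac_C1; last first.
  by move=> x; apply: cvgM; [exact: cvg_cst|exact: expRN_cont].
move=> x.
have h : is_derive x (1 : R) (fun x => c * x) c.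
  by apply: is_derive_eq; rewrite /GRing.scale/= mulr1.
have := is_derive1_comp (is_derive_expR (c * x)) h.
by rewrite [_ * c]mulrC.
Qed.

(* [psi x = 1 - exp(-x)] on the right half line, and [0] on the left one: by oddness the virial
   identity can be localized to the half line. *)
Lemma psi_exists : exists psi : R -> R, [/\ multiplier psi kappa 1,
  forall x h, 0 <= h -> 0 <= psi x - psi (x - h) <= h &
  {ae mu, forall x, is_derive x (1 : R) psi (kappa x)}].
Proof.
have [K HK] := primitive_exists (fun x y => sqi_itg (kappa_sqi x y)).
have aK : ac (fun x => K x - K 0) kappa.
  by split; [exact: kappa_sqi|move=> x y xy; rewrite -HK//; ring].
have ik x y : itg `[x, y] kappa by exact/sqi_itg/kappa_sqi.
exists (fun x => K x - K 0); split.
- split => //; [exact: kappa_meas|move=> x; split; last exact: kappa_abs].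
  have [x0|x0] := leP 0 x.
    rewrite HK// ger0_norm; last by apply: Rintegral_ge0 => t _; exact: kappa_ge0.
    have ie : itg `[0, x] (fun t => expR (-1 * t)) by apply: itg_cont; exact: expRN_cont.
    apply: (@le_trans _ _ (\int[mu]_(t in `[0, x]) expR (-1 * t))).
      apply: le_int => // t _; rewrite /kappa mulN1r; case: ifP => // _; exact: expR_ge0.
    have := (ac_expR (-1)).2 0 x x0; rewrite RintegralZl//.
    rewrite mulr0 expR0; have := expR_ge0 (-1 * x); lra.
  rewrite -normrN opprB HK ?(ltW x0)// int_eq0 ?normr0// => t /=.
  by rewrite in_itv/= /kappa => /andP[_]; rewrite leNgt => /negbTE ->.
- move=> x h h0; have xh : x - h <= x by lra.
  rewrite (_ : _ - _ = K x - K (x - h)); last by ring.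
  rewrite HK//; apply/andP; split; first by apply: Rintegral_ge0 => t _; exact: kappa_ge0.
  apply: (@le_trans _ _ (\int[mu]_(t in `[x - h, x]) 1)); last by rewrite int_cst_itv//; lra.
  apply: le_int => //; [by apply: itg_cont; exact: cst_continuous|].
  by move=> t _; exact: kappa_le1.
- have lk : locally_integrable setT kappa.
    split; [exact: kappa_meas|exact: openT|move=> Q _ cQ].
    have [M [_ HM]] := compact_bounded cQ.
    have QM : Q `<=` `[- (M + 1), M + 1]%classic.
      by move=> x Qx; rewrite /= in_itv/= -ler_norml; apply: (HM (M + 1)) => //; rewrite ltrDl.
    have := itg_norm (ik (- (M + 1)) (M + 1)); move=> /integrableP[_]; apply: le_lt_trans.
    have mQ : measurable (Q : set (measurableTypeR R)) by exact: compact_measurable.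
    under [leRHS]eq_integral do rewrite /= normr_id.
    apply: ge0_subset_integral => //; apply/measurable_EFinP.
    by apply: measurableT_comp => //; apply: measurable_funTS; exact: kappa_meas.
  by apply: (ae_imp (lebesgue_differentiation lk)) => x; exact: ac_lebesgue_pt.
Qed.

Lemma kappa_sqiM g : sqi setT g -> sqi setT (fun x => kappa x * g x).
Proof.
move=> sg; apply: (sqiM (M := 1)) => //; first exact: kappa_meas.
by move=> x _; exact: kappa_abs.
Qed.

Lemma kappa_itg g : itg setT g -> itg setT (fun x => kappa x * g x).
Proof.
move=> gi; apply: (itg_dom measurableT _ (itg_norm gi)).
  by apply: measurable_funM; [exact: kappa_meas|exact: itg_meas gi].
move=> x _; rewrite normrM -[leRHS]mul1r ler_wpM2r//; exact: kappa_abs.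
Qed.

Lemma expR_ray_itg g : itg setT g -> itg `[0, +oo[ (fun x => expR (-1 * x) * g x).
Proof.
move=> gi; have gr : itg `[0, +oo[ g by apply: itgS gi.
apply: (itg_dom (mray 0) _ (itg_norm gr)).
  by apply: measurable_funM; [apply: cont_meas => //; exact: expRN_cont|exact: itg_meas gr].
move=> x /=; rewrite in_itv/= andbT => x0; rewrite normrM -[leRHS]mul1r ler_wpM2r//.
by rewrite ger0_norm ?expR_ge0// -[leRHS]expR0 ler_expR; lra.
Qed.

Lemma int_kappa g : itg setT g ->
  \int[mu]_x (kappa x * g x) = \int[mu]_(x in `[0, +oo[) (expR (-1 * x) * g x).
Proof.
move=> gi; have ir := expR_ray_itg gi.
rewrite -Rintegral_itv_obnd_cbnd; last first.
  apply: (itgS (mray 0) _ _ ir) => // x /=; by rewrite !in_itv/= !andbT => /ltW.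
rewrite [RHS]Rintegral_mkcond; apply: eq_int => x _; rewrite patchE /kappa mulN1r.
have -> : (x \in `]0, +oo[%classic) = (0 < x).
  by apply/idP/idP => [/set_mem/=|h]; [|apply/mem_set => /=]; rewrite in_itv/= andbT.
by case: ifP => // _; rewrite mul0r.
Qed.

(* [(exp(-x) F)' = exp(-x) (F' - F)], without boundary term since [F 0 = 0]. *)
Lemma int_kappa_exact F F' : ac F F' -> itg setT F -> itg setT F' -> F 0 = 0 ->
  \int[mu]_x (kappa x * (F' x - F x)) = 0.
Proof.
move=> aF iF iF' F0; have iD := itgB measurableT iF' iF.
rewrite int_kappa//; have aE := ac_mul (ac_expR (-1)) aF.
rewrite (@int_ray R (fun x => expR (-1 * x) * F x) _ 0 (expR_ray_itg iF) (expR_ray_itg iD)).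
  by rewrite F0 mulr0 oppr0.
move=> x y _ xy; rewrite aE.2//; apply: eq_int => t _; ring.
Qed.

(** The vanishing integral of [kappa ((g d)' - g d)] is added. It removes [d'], which matters
    because [d] will be an increment of [g] to be divided by its step: its own derivative would lead
    to a second derivative of [g]. *)
Lemma kappa_ibp g w d d' : HS g w -> HS d d' -> g 0 = 0 ->
  \int[mu]_x (kappa x * (w x * d x - g x * d' x)) =
  \int[mu]_x (kappa x * (2 * w x - g x) * d x).
Proof.
move=> [a1 a2 a3] [b1 b2 b3] g0.
have i1 := sqi_itgM measurableT a3 b2; have i2 := sqi_itgM measurableT a2 b3.
have i3 := sqi_itgM measurableT a2 b2.
have := int_kappa_exact (ac_mul a1 b1) i3 (itgD measurableT i1 i2); rewrite g0 mul0r => /(_ erefl) Z.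
rewrite -[LHS]addr0 -{}Z -RintegralD//; last 2 first.
- by apply: kappa_itg; exact: itgB.
- by apply: kappa_itg; apply: itgB => //; exact: itgD.
by apply: eq_int => x _; ring.
Qed.

(* The form left by the linear part of the virial identity after completing the square. *)
Definition Aform g w := \int[mu]_x (kappa x * (w x - g x / 2) ^+ 2).

Lemma half_sqi g w : HS g w -> sqi setT (fun x => w x - g x / 2).
Proof.
move=> [a1 a2 a3]; apply: sqiB => //.
by have := sqiZ 2^-1 measurableT a2; congr sqi; apply/funext => x; rewrite mulrC.
Qed.

Lemma Aform_ge0 g w : 0 <= Aform g w.
Proof. by apply: Rintegral_ge0 => x _; rewrite mulr_ge0 ?kappa_ge0// sqr_ge0. Qed.

(** The integrand exceeds [2 kappa (w - g / 2)^2] by half of [kappa ((g^2)' - g^2)], whose integral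
    vanishes. *)
Lemma kappa_form g w : HS g w -> g 0 = 0 ->
  \int[mu]_x (kappa x * (2 * w x - g x) * w x) = 2 * Aform g w.
Proof.
move=> hs g0; have [a1 a2 a3] := hs.
have i1 := sqi_itgM measurableT a3 a2; have i2 := sqi_itgM measurableT a2 a3.
have i3 := sqi_itgM measurableT a2 a2; have i4 := (half_sqi hs).2.
have := int_kappa_exact (ac_mul a1 a1) i3 (itgD measurableT i1 i2); rewrite g0 mul0r => /(_ erefl) Z.
have ik := kappa_itg i4; have i5 := kappa_itg (itgB measurableT (itgD measurableT i1 i2) i3).
rewrite -[RHS]addr0 -[X in _ + X](mulr0 (1 / 2)) -{}Z /Aform.
rewrite -!RintegralZl// -RintegralD//; [|exact: itgZ|exact: itgZ].
by apply: eq_int => x _; field.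
Qed.

(** On the right half line [kappa (w - g / 2)^2] is the square of the derivative of [exp(-x/2) g];
    the bound is [ac_holder] for this function, starting from its zero at the origin. *)
Lemma Aform_pointwise g w x : HS g w -> g 0 = 0 -> 0 <= x ->
  g x ^+ 2 <= x * expR x * Aform g w.
Proof.
move=> hs g0 x0; have [a1 a2 a3] := hs.
have aE := ac_mul (ac_expR (- (1 / 2))) a1.
have := ac_holder aE x0; rewrite g0 mulr0 !subr0 exprMn.
have E2 : expR (- (1 / 2) * x) ^+ 2 = (expR x)^-1.
  by rewrite expr2 -expRD -expRN; congr expR; field.
rewrite E2 => H.
have ex : 0 < expR x by exact: expR_gt0.
rewrite -ler_pdivlMl ?invr_gt0// in H.
have {}H : g x ^+ 2 <= x * expR x * \int[mu]_(t in `[0, x])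
   (- (1 / 2) * expR (- (1 / 2) * t) * g t + expR (- (1 / 2) * t) * w t) ^+ 2.
  by apply: le_trans H _; rewrite invrK mulrA [expR x * x]mulrC.
apply: le_trans H _; apply: ler_wpM2l; first by rewrite mulr_ge0// ltW.
have ik := kappa_itg (half_sqi hs).2.
have E t : (- (1 / 2) * expR (- (1 / 2) * t) * g t + expR (- (1 / 2) * t) * w t) ^+ 2 =
    expR (- t) * (w t - g t / 2) ^+ 2.
  have -> : expR (- t) = expR (- (1 / 2) * t) ^+ 2.
    by rewrite expr2 -expRD; congr expR; field.
  by field.
rewrite -Rintegral_itv_obnd_cbnd; last first.
  apply: (itgS (mitv 0 x) _ _ (aE.1 0 x).2) => // t /=.
  by rewrite !in_itv/= => /andP[/ltW -> ->].
rewrite (@eq_int _ _ _ (fun t => kappa t * (w t - g t / 2) ^+ 2)); last first.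
  by move=> t /=; rewrite in_itv/= => /andP[t0 _]; rewrite E /kappa t0.
by apply: ge0_int_subset => // t; rewrite mulr_ge0 ?kappa_ge0// sqr_ge0.
Qed.

(** The map [s |-> |s| s] has a first-order Taylor error at most the square of the increment, which
    is a quadratic error as in [ac_of_quadratic_error]. *)
Lemma ac_absM g w : ac g w -> ac (fun x => `|g x| * g x) (fun x => 2 * (`|g x| * w x)).
Proof.
move=> gw; have cg := ac_cont gw.
have cn : continuous (fun x => `|g x|).
  by move=> x; apply: cvg_norm; exact: cg.
have s1 x y : sqi `[x, y] (fun t => `|g t| * w t) by apply: sqi_contM => //; exact: gw.1.
apply: (@ac_of_quadratic_error _ _ _ (fun t => 3 * w t ^+ 2)).
- by move=> x y; apply: sqiZ.
- by move=> x y; apply: itgZ => //; exact: (gw.1 x y).2.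
move=> x y xy; set A := \int[mu]_(t in `[x, y]) `|w t|.
have A0 : 0 <= A by apply: Rintegral_ge0.
have HA : A ^+ 2 <= _ := int_abs_sq xy (gw.1 x y).
have DA t : x <= t -> t <= y -> `|g t - g x| <= A.
  by move=> xt ty; exact: ac_near gw xt ty.
have iw := sqi_itg (gw.1 x y).
have inw := itg_norm iw.
have -> : \int[mu]_(t in `[x, y]) `|3 * w t ^+ 2| = 3 * \int[mu]_(t in `[x, y]) w t ^+ 2.
  rewrite -RintegralZl//; last exact: (gw.1 x y).2.
  by apply: eq_int => t _; rewrite ger0_norm// mulr_ge0// sqr_ge0.
apply: (@le_trans _ _ (3 * A ^+ 2)); last by lra.
have E : \int[mu]_(t in `[x, y]) (2 * (`|g t| * w t)) =
    2 * `|g x| * (g y - g x) + \int[mu]_(t in `[x, y]) (2 * ((`|g t| - `|g x|) * w t)).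
  rewrite gw.2// -RintegralZl// -RintegralD//; last 2 first.
  - exact: itgZ.
  - apply: itgZ => //.
    apply: (eq_itg (mitv x y) _ (itgB (mitv x y) (sqi_itg (s1 x y)) (itgZ `|g x| (mitv x y) iw))).
    by move=> t _; ring.
  by apply: eq_int => t _; ring.
rewrite E opprD addrA.
have h1 : `|(`|g y| * g y - `|g x| * g x) - 2 * `|g x| * (g y - g x)| <= A ^+ 2.
  apply: (@le_trans _ _ ((g y - g x) ^+ 2)).
    rewrite ler_norml; apply/andP.
    have q1 := sqr_ge0 (g y - g x); have q2 := sqr_ge0 (g x); have q3 := sqr_ge0 (g y).
    case: (ger0P (g y)) => gy; case: (ger0P (g x)) => gx.
    - by split; nra.
    - by have := mulr_ge0_le0 gy (ltW gx); split; nra.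
    - by have := mulr_le0_ge0 (ltW gy) gx; split; nra.
    - by split; nra.
  by rewrite -(real_normK (num_real (g y - g x))) lerXn2r ?nnegrE//; exact: DA.
have i3 : itg `[x, y] (fun t => 2 * ((`|g t| - `|g x|) * w t)).
  apply: itgZ => //.
  apply: (eq_itg (mitv x y) _ (itgB (mitv x y) (sqi_itg (s1 x y)) (itgZ `|g x| (mitv x y) iw))).
  by move=> t _; ring.
have h2 : `|\int[mu]_(t in `[x, y]) (2 * ((`|g t| - `|g x|) * w t))| <= 2 * A ^+ 2.
  have -> : 2 * A ^+ 2 = \int[mu]_(t in `[x, y]) (2 * A * `|w t|).
    by rewrite RintegralZl// -/A; ring.
  apply: int_norm => //; apply: le_int => //; [exact: itg_norm|exact: itgZ|].
  move=> t /=; rewrite in_itv/= => /andP[xt ty].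
  rewrite !normrM normr_nat -mulrA ler_wpM2l// ler_wpM2r//.
  by apply: le_trans (DA t xt ty); exact: ler_dist_dist.
apply: le_trans (ler_normB _ _) _.
have -> : 3 * A ^+ 2 = A ^+ 2 + 2 * A ^+ 2 by ring.
exact: lerD.
Qed.

(** With [F = |g|^3], the integral of [kappa (3 |g| g w - |g|^3)] vanishes. Adding it to nine times
    the form weighted by [|g|], minus a quarter of the cubic term, completes the square
    [(3 (w - g / 2) + g / 2)^2]. This gives the constant [36 = 4 * 9]. *)
Lemma cubic_le g w (M : R) : HS g w -> g 0 = 0 -> (forall x, `|g x| <= M) ->
  itg setT (fun x => `|g x| ^+ 3) /\
  \int[mu]_x (kappa x * `|g x| ^+ 3) <= 36 * M * Aform g w.
Proof.
move=> hs g0 gM; have [a1 a2 a3] := hs.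
have cg := ac_cont a1.
have cn : continuous (fun x => `|g x|) by move=> x; apply: cvg_norm; exact: cg.
have mn : measurable_fun setT (fun x => `|g x|) by exact: cont_meas.
have nM x : setT x -> `| `|g x| | <= M by rewrite normr_id.
have sgn p : sqi setT p -> sqi setT (fun x => `|g x| * p x) by move=> sp; exact: sqiM mn nM sp.
have i1 := sqi_itgM measurableT (sgn _ a2) a2.
have i3 : itg setT (fun x => `|g x| ^+ 3).
  apply: (eq_itg measurableT _ i1) => x _.
  by rewrite exprS real_normK ?num_real//; ring.
split => //.
have i2 := sqi_itgM measurableT (sgn _ a3) a2.
have i4 := sqi_itgM measurableT (sgn _ a2) a3.
have sz := half_sqi hs; have iz := sz.2.
have igz := sqi_itgM measurableT (sgn _ sz) sz.
have aF := ac_mul (ac_absM a1) a1.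
have iF' : itg setT (fun x => 2 * (`|g x| * w x) * g x + `|g x| * g x * w x).
  apply: (eq_itg measurableT _ (itgD measurableT (itgZ 2 measurableT i2) i4)) => x _; ring.
have := int_kappa_exact aF i1 iF'; rewrite g0 mulr0 => /(_ erefl) Z.
have k1 := kappa_itg (itgB measurableT iF' i1); have k3 := kappa_itg i3.
have kz := kappa_itg iz; have kgz := kappa_itg igz.
have h1 : 1 / 4 * \int[mu]_x (kappa x * `|g x| ^+ 3) <=
    9 * \int[mu]_x (kappa x * (`|g x| * (w x - g x / 2) * (w x - g x / 2))).
  rewrite -subr_ge0 -[X in 0 <= X]addr0 -[X in 0 <= _ + X]Z -!RintegralZl//.
  have z1 := itgZ 9 measurableT kgz; have z2 := itgZ (1 / 4) measurableT k3.
  have z3 := itgB measurableT z1 z2.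
  rewrite -(RintegralB measurableT z1 z2) -(RintegralD measurableT z3 k1).
  apply: Rintegral_ge0 => x _.
  have -> : 9 * (kappa x * (`|g x| * (w x - g x / 2) * (w x - g x / 2))) -
      1 / 4 * (kappa x * `|g x| ^+ 3) +
      kappa x * (2 * (`|g x| * w x) * g x + `|g x| * g x * w x - `|g x| * g x * g x) =
    kappa x * (`|g x| * (9 * (w x - g x / 2) ^+ 2 - 1 / 4 * `|g x| ^+ 2 +
       3 * g x * w x - g x ^+ 2)) by field.
  apply: mulr_ge0; first exact: kappa_ge0.
  apply: mulr_ge0 => //; rewrite real_normK ?num_real//.
  have -> : 9 * (w x - g x / 2) ^+ 2 - 1 / 4 * g x ^+ 2 + 3 * g x * w x - g x ^+ 2 =
    (3 * (w x - g x / 2) + g x / 2) ^+ 2 by field.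
  exact: sqr_ge0.
have h2 : \int[mu]_x (kappa x * (`|g x| * (w x - g x / 2) * (w x - g x / 2))) <= M * Aform g w.
  rewrite /Aform -RintegralZl//; apply: le_int => //; first exact: itgZ.
  move=> x _; rewrite [M * _]mulrCA; apply: ler_wpM2l; first exact: kappa_ge0.
  by rewrite -mulrA -expr2; apply: ler_wpM2r; [exact: sqr_ge0|exact: gM].
move: h1 h2; move: (\int[mu]_x _) (\int[mu]_x _) (Aform g w) => s q A; clear.
move=> h1 h2; lra.
Qed.

End half_line_weight.

(** * The virial identity *)

Section virial.
Variable R : realType.
Local Notation mu := (@lebesgue_measure R).
Local Notation hn := (@hn R).
Implicit Types (g w p q : R -> R) (D E : set (measurableTypeR R)).

Definition dq (n : nat) g x := (hn n)^-1 * (g (x + hn n) - g x).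

Lemma dq_sqi n g w : HS g w -> sqi setT (dq n g).
Proof. by move=> hs; apply: sqiZ => //; have [_] := HS_sub (HS_shift (hn n) hs) hs. Qed.

Lemma dq_le n g w : HS g w -> \int[mu]_x dq n g x ^+ 2 <= \int[mu]_x w x ^+ 2.
Proof.
move=> hs; have h0 := @hn_gt0 R n; have := HS_diff_le h0 hs.
rewrite -ler_pdivrMl ?exprn_gt0//; apply: le_trans; rewrite -RintegralZl//.
  by rewrite le_eqVlt; apply/orP; left; apply/eqP; apply: eq_int => x _; rewrite /dq exprMn exprVn.
by have [_ [_ ]] := HS_sub (HS_shift (hn n) hs) hs.
Qed.

Lemma dq_sub n g w p q : HS g w -> HS p q ->
  \int[mu]_x (dq n g x - dq n p x) ^+ 2 <= \int[mu]_x (w x - q x) ^+ 2.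
Proof.
move=> hg hp; have := dq_le n (HS_sub hg hp); apply: le_trans.
rewrite le_eqVlt; apply/orP; left; apply/eqP; apply: eq_int => x _; rewrite /dq; ring.
Qed.

Lemma int_triangle3 (z z0 d d0 w0 : R -> R) (e A1 B1 A2 B2 : R) :
  sqi setT z -> sqi setT z0 -> sqi setT d -> sqi setT d0 -> sqi setT w0 -> 0 <= e ->
  \int[mu]_x (z x - z0 x) ^+ 2 <= A1 -> \int[mu]_x d x ^+ 2 <= B1 -> A1 * B1 <= (e / 3) ^+ 2 ->
  \int[mu]_x z0 x ^+ 2 <= A2 -> \int[mu]_x (d x - d0 x) ^+ 2 <= B2 -> A2 * B2 <= (e / 3) ^+ 2 ->
  `|\int[mu]_x (z0 x * d0 x) - \int[mu]_x (z0 x * w0 x)| <= e / 3 ->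
  `|\int[mu]_x (z x * d x) - \int[mu]_x (z0 x * w0 x)| <= e.
Proof.
move=> sz sz0 sd sd0 sw0 e0 a1 b1 ab1 a2 b2 ab2 h3.
have e3 : 0 <= e / 3 by rewrite divr_ge0.
have h1 := int_CS_le measurableT (sqiB measurableT sz sz0) sd a1 b1 ab1 e3.
have h2 := int_CS_le measurableT sz0 (sqiB measurableT sd sd0) a2 b2 ab2 e3.
have -> : \int[mu]_x (z x * d x) - \int[mu]_x (z0 x * w0 x) =
  \int[mu]_x ((z x - z0 x) * d x) + \int[mu]_x (z0 x * (d x - d0 x)) +
  (\int[mu]_x (z0 x * d0 x) - \int[mu]_x (z0 x * w0 x)).
  have i1 := sqi_itgM measurableT sz sd; have i2 := sqi_itgM measurableT sz0 sd.
  have i3 := sqi_itgM measurableT sz0 sd0.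
  have -> : \int[mu]_x ((z x - z0 x) * d x) = \int[mu]_x (z x * d x) - \int[mu]_x (z0 x * d x).
    by rewrite -RintegralB//; apply: eq_int => x _; ring.
  have -> : \int[mu]_x (z0 x * (d x - d0 x)) = \int[mu]_x (z0 x * d x) - \int[mu]_x (z0 x * d0 x).
    by rewrite -RintegralB//; apply: eq_int => x _; ring.
  ring.
have -> : e = e / 3 + e / 3 + e / 3 by field.
apply: le_trans (ler_normD _ _) (lerD _ h3).
exact: le_trans (ler_normD _ _) (lerD h1 h2).
Qed.

(** The factor that [kappa_ibp] leaves in front of the increment. *)
Definition kz g w x := kappa x * (2 * w x - g x).

Lemma kz_sqi g w : HS g w -> sqi setT (kz g w).
Proof.
by move=> [_ a2 a3]; apply: kappa_sqiM; apply: sqiB => //; exact: sqiZ.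
Qed.

Lemma kz_sub g w p q : HS g w -> HS p q ->
  \int[mu]_x (kz g w x - kz p q x) ^+ 2 <= 8 * N2 (fun x => g x - p x) (fun x => w x - q x).
Proof.
move=> [_ a2 a3] [_ b2 b3].
have s1 := sqiB measurableT a2 b2; have s3 := sqiB measurableT a3 b3.
have s2 := sqiZ 2 measurableT s3; have s4 := sqiB measurableT s2 s1.
apply: (@le_trans _ _ (\int[mu]_x (2 * (w x - q x) - (g x - p x)) ^+ 2)).
  have -> : (fun x => (kz g w x - kz p q x) ^+ 2) =
    (fun x => (kappa x * (2 * (w x - q x) - (g x - p x))) ^+ 2).
    by apply/funext => x; rewrite /kz; ring.
  have := int_sq_mul (@kappa_meas R) (@kappa_abs R) s4; rewrite expr1n mul1r; exact.
apply: le_trans (int_sqD measurableT s2 (sqiN measurableT s1)) _.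
have -> : \int[mu]_x (2 * (w x - q x)) ^+ 2 = 4 * \int[mu]_x (w x - q x) ^+ 2.
  by rewrite -RintegralZl//; [apply: eq_int => x _; ring|exact: s3.2].
have -> : \int[mu]_x (- (g x - p x)) ^+ 2 = \int[mu]_x (g x - p x) ^+ 2.
  by apply: eq_int => x _; ring.
rewrite /N2; have := int_sq_ge0 setT (fun x => g x - p x); lra.
Qed.

(** Difference quotients converge only weakly, at each fixed time. Uniformity near [t0] comes from
    continuity in H^1: by [dq_sub], the quotients at two times differ in L^2 by at most the distance
    of the derivatives, for every [n]. *)
Lemma quadratic_unif (c cx : R -> R -> R) (t0 : R) : H1_curve c cx ->
  forall e : R, 0 < e -> exists2 r : R, 0 < r & \forall n \near \oo, forall t, `|t - t0| < r ->
    `|\int[mu]_x (kz (c t) (cx t) x * dq n (c t) x) -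
      \int[mu]_x (kz (c t0) (cx t0) x * cx t0 x)| <= e.
Proof.
move=> cc e e0; have [H1 H2] := cc.
have [r1 r10 Hr1] := H1_curve_bounded t0 cc.
have N0 := N2_ge0 (c t0) (cx t0); move: N0 Hr1; move: (N2 (c t0) (cx t0)) => N N0 Hr1.
have [Z [Z0 HZ]] : exists Z : R, 0 < Z /\ \int[mu]_x kz (c t0) (cx t0) x ^+ 2 <= Z.
  exists (\int[mu]_x kz (c t0) (cx t0) x ^+ 2 + 1).
  by have := int_sq_ge0 setT (kz (c t0) (cx t0)); split; lra.
have e3 : 0 < e / 3 by rewrite divr_gt0.
have N2p : 0 < 8 * (2 * N + 2) by lra.
(* The factor 8 is that of [kz_sub], and [2 N + 2] bounds the norm near [t0]. *)
have [et [et0 E1 E2]] : exists et : R, [/\ 0 < et, 8 * et * (2 * N + 2) <= (e / 3) ^+ 2 &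
    Z * et <= (e / 3) ^+ 2].
  exists (Num.min ((e / 3) ^+ 2 / (8 * (2 * N + 2))) ((e / 3) ^+ 2 / Z)); split.
  - by rewrite lt_min !divr_gt0 ?exprn_gt0.
  - rewrite mulrAC -ler_pdivlMl// mulrC; first by rewrite ge_min lexx.
  - by rewrite mulrC -ler_pdivlMr// ge_min lexx orbT.
have [r2 r20 Hr2] := H2 t0 et et0.
exists (Num.min r1 r2); first by rewrite lt_min r10 r20.
have := HS_diff_quot_weak (H1 t0) (kz_sqi (H1 t0)) (@hn_gt0 R) (@hn_cvg R).
move=> /cvgrPdist_le/(_ _ e3); apply: filterS => n Hn t.
rewrite lt_min => /andP[/Hr1 tN /Hr2 te].
have [_ _ b0] := H1 t0.
apply: (int_triangle3 (z0 := kz (c t0) (cx t0)) (d0 := dq n (c t0)) (A1 := 8 * et) (B1 := 2 * N + 2)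
  (A2 := Z) (B2 := et)) => //; try exact: kz_sqi; try exact: dq_sqi (H1 _).
- exact: ltW.
- by apply: le_trans (kz_sub (H1 t) (H1 t0)) _; rewrite ler_wpM2l.
- apply: le_trans (dq_le n (H1 t)) _; apply: le_trans tN; rewrite /N2 lerDr; exact: int_sq_ge0.
- apply: le_trans (dq_sub n (H1 t) (H1 t0)) _; apply: le_trans te; rewrite /N2 lerDr.
  exact: int_sq_ge0.
- by rewrite distrC; exact: Hn.
Qed.

Variables (f Gam : R -> R).
Hypothesis k_cont : continuous (fun s : R => f (s ^+ 2)).
Hypothesis k_lip : lipschitz_on_bounded f.
Hypothesis Gam_prim : primitive_nl f Gam.

Variables a ax b bx : R -> R -> R.
Hypothesis sol : real_solution f a ax b bx.
Hypothesis a0 : forall t, a t 0 = 0.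
Hypothesis b0 : forall t, b t 0 = 0.

Let ca : H1_curve a ax. Proof. by case: sol. Qed.
Let cb : H1_curve b bx. Proof. by case: sol. Qed.
Let ha t : HS (a t) (ax t). Proof. exact: ca.1. Qed.
Let hb t : HS (b t) (bx t). Proof. exact: cb.1. Qed.
Let sa t : sqi setT (a t). Proof. by case: (ha t). Qed.
Let sb t : sqi setT (b t). Proof. by case: (hb t). Qed.
Let sax t : sqi setT (ax t). Proof. by case: (ha t). Qed.
Let sbx t : sqi setT (bx t). Proof. by case: (hb t). Qed.
Let cta t : continuous (a t). Proof. by case: (ha t) => /ac_cont. Qed.
Let ctb t : continuous (b t). Proof. by case: (hb t) => /ac_cont. Qed.
Local Notation vd t := (vdens f Gam (a t) (b t)).
Let ivd t : itg setT (vd t). Proof. exact: (vdens_itg k_cont k_lip Gam_prim sol t). Qed.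

Definition virial psi t := \int[mu]_x (psi x * (a t x * bx t x - b t x * ax t x)).

Definition virial_rate t := 2 * (Aform (a t) (ax t) + Aform (b t) (bx t)) +
  \int[mu]_x (kappa x * vd t x).

(** Here the space increment has been moved from the virial density onto [psi]. The quotients of
    [psi] lie in [[0, 1]] and tend to [kappa] almost everywhere, so dominated convergence settles
    the time [t0]; continuity in time of the density in L^1 gives uniformity near [t0]. *)
Lemma psi_vd_unif psi (t0 : R) : multiplier psi (@kappa R) 1 ->
  (forall x h, 0 <= h -> 0 <= psi x - psi (x - h) <= h) ->
  {ae mu, forall x, is_derive x (1 : R) psi (kappa x)} ->
  forall e : R, 0 < e -> exists2 r : R, 0 < r & \forall n \near \oo, forall t, `|t - t0| < r ->
    `|(hn n)^-1 * \int[mu]_x ((psi x - psi (x - hn n)) * vd t x) -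
      \int[mu]_x (kappa x * vd t0 x)| <= e.
Proof.
move=> [apsi mk bpsi] psih psid e e0.
have mpsi : measurable_fun setT psi by apply: cont_meas => //; exact: ac_cont apsi.
have e2 : 0 < e / 2 by rewrite divr_gt0.
have [r r0 Hr] := vdens_time_cont k_cont k_lip Gam_prim sol t0 e2; exists r => //.
pose q n x := (hn n)^-1 * (psi x - psi (x - hn n)).
have q01 n x : 0 <= q n x <= 1.
  have h0 := @hn_gt0 R n; have /andP[h1 h2] := psih x (hn n) (ltW h0).
  by rewrite /q mulr_ge0 ?invr_ge0 ?(ltW h0)//= ler_pdivrMl// mulr1.
have mq n : measurable_fun setT (q n).
  apply: measurable_funM => //; apply: measurable_funB => //.
  apply: cont_meas => // x; apply: (@continuous_comp _ _ _ (fun x => x - hn n) psi).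
    by apply: cvgB; [exact: cvg_id|exact: cvg_cst].
  exact: ac_cont apsi _.
have qM n g : itg setT g -> itg setT (fun x => q n x * g x).
  move=> gi; apply: (itg_dom measurableT _ (itg_norm gi)).
    by apply: measurable_funM; [exact: mq|exact: itg_meas gi].
  move=> x _; have /andP[h1 h2] := q01 n x.
  by rewrite normrM ger0_norm// -[leRHS]mul1r ler_wpM2r.
have eq n t : (hn n)^-1 * \int[mu]_x ((psi x - psi (x - hn n)) * vd t x) =
    \int[mu]_x (q n x * vd t x).
  rewrite -RintegralZl//; first by apply: eq_int => x _; rewrite /q mulrA.
  apply: (eq_itg measurableT _ (itgZ (hn n) measurableT (qM n _ (ivd t)))) => x _.
  by rewrite /q; field; rewrite gt_eqF// hn_gt0.
have : \int[mu]_x (q n x * vd t0 x) @[n --> \oo] --> \int[mu]_x (kappa x * vd t0 x).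
  apply: (dct (g := fun x => `|vd t0 x|) measurableT _ _ _ (itg_norm (ivd t0)) _).2.
  - by move=> n; exact: itg_meas (qM n _ (ivd t0)).
  - by apply: itg_meas; exact: kappa_itg.
  - apply: (ae_imp psid) => x /is_derive_epsP dx _.
    apply: cvgM; last exact: cvg_cst.
    apply/cvgrPdist_le => e' e'0; have [r' r'0 Hr'] := dx e' e'0.
    apply: filterS (hn_lt r'0) => n hnr; have h0 := @hn_gt0 R n.
    have := Hr' (x - hn n); have -> : x - hn n - x = - hn n by ring.
    rewrite normrN gtr0_norm// => /(_ hnr).
    rewrite /q -[X in _ -> X <= _](_ : (hn n)^-1 * `|psi (x - hn n) - psi x - kappa x * - hn n| = _).
      by rewrite [e' * _]mulrC ler_pdivrMl.
    rewrite -[X in X * _]gtr0_norm ?invr_gt0// -normrM; congr (`|_|).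
    by field; rewrite gt_eqF.
  - move=> n x _; have /andP[h1 h2] := q01 n x.
    by rewrite normrM [`|q n x|]ger0_norm// -[leRHS]mul1r ler_wpM2r.
move=> /cvgrPdist_le/(_ _ e2); apply: filterS => n Hn t /Hr ht.
rewrite eq.
have -> : \int[mu]_x (q n x * vd t x) - \int[mu]_x (kappa x * vd t0 x) =
  \int[mu]_x (q n x * (vd t x - vd t0 x)) +
  (\int[mu]_x (q n x * vd t0 x) - \int[mu]_x (kappa x * vd t0 x)).
  rewrite addrA; congr (_ - _); have i1 := qM n _ (itgB measurableT (ivd t) (ivd t0)).
  have i2 := qM n _ (ivd t0); rewrite -(RintegralD measurableT i1 i2).
  by apply: eq_int => x _; ring.
rewrite (splitr e); apply: le_trans (ler_normD _ _) _; apply: lerD; last by rewrite distrC.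
have ii := itgB measurableT (ivd t) (ivd t0).
apply: int_norm => //; first exact: qM.
apply: le_trans ht; apply: le_int => //; [by apply: itg_norm; exact: qM|exact: itg_norm|].
move=> x _; have /andP[h1 h2] := q01 n x.
by rewrite normrM ger0_norm// -[leRHS]mul1r ler_wpM2r.
Qed.

(* The pairings [X n] of the solution with its difference quotients in space are differentiable in
   time; they tend to [virial], and their derivatives tend to [virial_rate] uniformly near [t0]. *)
Lemma virial_derivative psi t0 : multiplier psi (@kappa R) 1 ->
  (forall x h, 0 <= h -> 0 <= psi x - psi (x - h) <= h) ->
  {ae mu, forall x, is_derive x (1 : R) psi (kappa x)} ->
  is_derive t0 (1 : R) (virial psi) (virial_rate t0).
Proof.
move=> mp psih psid; have [apsi mk bpsi] := mp.
have mpsi : measurable_fun setT psi by apply: cont_meas => //; exact: ac_cont apsi.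
have psiM g : sqi setT g -> sqi setT (fun x => psi x * g x).
  by move=> sg; apply: (sqiM (M := 1)) => // x _; exact: (bpsi x).1.
have psiI g : itg setT g -> itg setT (fun x => psi x * g x).
  move=> gi; apply: (itg_dom measurableT _ (itg_norm gi)).
    by apply: measurable_funM => //; exact: itg_meas gi.
  by move=> x _; rewrite normrM -[leRHS]mul1r ler_wpM2r//; exact: (bpsi x).1.
pose sh n (c : R -> R -> R) t x := c t (x + hn n).
pose X n t := (hn n)^-1 * symp psi (a t) (b t) (sh n a t) (sh n b t).
pose Q1 n t := \int[mu]_x (kappa x * ((bx t x * sh n b t x - sh n ax t x * a t x) +
     (ax t x * sh n a t x - sh n bx t x * b t x))).
pose Q2 n t := \int[mu]_x (psi x * ((a t x * sh n a t x + b t x * sh n b t x) *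
     (pot f (a t) (b t) x - pot f (sh n a t) (sh n b t) x))).
have dX n t : is_derive t (1 : R) (X n) ((hn n)^-1 * (Q1 n t + Q2 n t)).
  have d := bilinear_derivative k_cont t sol (real_solution_shift k_cont (hn n) sol) mp.
  exact: (is_deriveZ (hn n)^-1 d).
have cX t : X n t @[n --> \oo] --> virial psi t.
  have c1 := HS_diff_quot_weak (hb t) (psiM _ (sa t)) (@hn_gt0 R) (@hn_cvg R).
  have c2 := HS_diff_quot_weak (ha t) (psiM _ (sb t)) (@hn_gt0 R) (@hn_cvg R).
  have := cvgB c1 c2.
  have -> : \int[mu]_x (psi x * a t x * bx t x) - \int[mu]_x (psi x * b t x * ax t x) =
     virial psi t.
    have i1 := sqi_itgM measurableT (psiM _ (sa t)) (sbx t).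
    have i2 := sqi_itgM measurableT (psiM _ (sb t)) (sax t).
    by rewrite /virial -RintegralB//; apply: eq_int => x _; ring.
  suff -> : X^~ t = fun n => \int[mu]_x (psi x * a t x * ((hn n)^-1 * (b t (x + hn n) - b t x))) -
       \int[mu]_x (psi x * b t x * ((hn n)^-1 * (a t (x + hn n) - a t x))).
    by move=> cv; exact: cv.
  apply/funext => n; rewrite /X /symp -RintegralZl//; last first.
    apply: (eq_itg measurableT _ (itgB measurableT (sqi_itgM measurableT (psiM _ (sa t)) (sqi_shift (hn n) (sb t)))
      (sqi_itgM measurableT (psiM _ (sb t)) (sqi_shift (hn n) (sa t))))) => x _.
    by rewrite /sh; ring.
  have i1 := sqi_itgM measurableT (psiM _ (sa t)) (dq_sqi n (hb t)).
  have i2 := sqi_itgM measurableT (psiM _ (sb t)) (dq_sqi n (ha t)).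
  by rewrite -(RintegralB measurableT i1 i2); apply: eq_int => x _; rewrite /dq /sh; ring.
apply: (limit_derivative dX cX) => e e0.
have e4 : 0 < e / 4 by rewrite divr_gt0.
have [r1 r10 Hr1] := H1sq_locally_bounded sol t0.
have K0 : 0 <= 2 * H1sq a ax b bx t0 + 4 by have := H1sq_ge0 a ax b bx t0; lra.
move: (2 * H1sq a ax b bx t0 + 4) K0 Hr1 => K K0 Hr1.
have [C C0 HC] := nl_error k_cont k_lip Gam_prim K0.
have [r2 r20 Hr2] := quadratic_unif t0 ca e4.
have [r3 r30 Hr3] := quadratic_unif t0 cb e4.
have [r4 r40 Hr4] := psi_vd_unif t0 mp psih psid e4.
exists (Num.min (Num.min r1 r2) (Num.min r3 r4)); first by rewrite !lt_min r10 r20 r30 r40.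
have CK : 0 < 4 * (C * K + 1) by have := mulr_ge0 C0 K0; lra.
near=> n => t; rewrite !lt_min => /andP[/andP[t1 t2] /andP[t3 t4]].
have h0 := @hn_gt0 R n; have tK := Hr1 t t1.
have B2 : `|\int[mu]_x (kz (a t) (ax t) x * dq n (a t) x) -
      \int[mu]_x (kz (a t0) (ax t0) x * ax t0 x)| <= e / 4.
  by move: t t2 {t1 t3 t4 tK}; near: n; exact: Hr2.
have B3 : `|\int[mu]_x (kz (b t) (bx t) x * dq n (b t) x) -
      \int[mu]_x (kz (b t0) (bx t0) x * bx t0 x)| <= e / 4.
  by move: t t3 {t1 t2 t4 tK B2}; near: n; exact: Hr3.
have B4 : `|(hn n)^-1 * \int[mu]_x ((psi x - psi (x - hn n)) * vd t x) -
      \int[mu]_x (kappa x * vd t0 x)| <= e / 4.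
  by move: t t4 {t1 t2 t3 tK B2 B3}; near: n; exact: Hr4.
have hC : hn n * (4 * (C * K + 1)) <= e.
  rewrite -ler_pdivlMr// ltW//; near: n; apply: hn_lt; exact: divr_gt0.
(* The translate may be replaced by the increment, since the extra terms cancel; [kappa_ibp] then
   removes the derivative of the increment. *)
have E1 : (hn n)^-1 * Q1 n t = \int[mu]_x (kz (a t) (ax t) x * dq n (a t) x) +
    \int[mu]_x (kz (b t) (bx t) x * dq n (b t) x).
  have hda := HS_sub (HS_shift (hn n) (ha t)) (ha t).
  have hdb := HS_sub (HS_shift (hn n) (hb t)) (hb t).
  have Ea := kappa_ibp (ha t) hda (a0 t); have Eb := kappa_ibp (hb t) hdb (b0 t).
  have [_ da2 da3] := hda; have [_ db2 db3] := hdb.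
  have ia := kappa_itg (itgB measurableT (sqi_itgM measurableT (sax t) da2) (sqi_itgM measurableT (sa t) da3)).
  have ib := kappa_itg (itgB measurableT (sqi_itgM measurableT (sbx t) db2) (sqi_itgM measurableT (sb t) db3)).
  have -> : Q1 n t = \int[mu]_x (kz (a t) (ax t) x * (a t (x + hn n) - a t x)) +
     \int[mu]_x (kz (b t) (bx t) x * (b t (x + hn n) - b t x)).
    rewrite /kz -Ea -Eb -(RintegralD measurableT ia ib).
    by apply: eq_int => x _; rewrite /sh; ring.
  rewrite mulrDr -!RintegralZl//; last 2 first.
  - by apply: sqi_itgM => //; exact: kz_sqi.
  - by apply: sqi_itgM => //; exact: kz_sqi.
  by congr (_ + _); apply: eq_int => x _; rewrite /dq; ring.
pose W x := (a t x * sh n a t x + b t x * sh n b t x) *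
     (pot f (a t) (b t) x - pot f (sh n a t) (sh n b t) x).
have sha := sqi_shift (hn n) (sa t); have shb := sqi_shift (hn n) (sb t).
have pp g : sqi setT g -> sqi setT (fun x => pot f (a t) (b t) x * g x) by exact: pot_sqi.
have ps g : sqi setT g -> sqi setT (fun x => pot f (sh n a t) (sh n b t) x * g x).
  exact: (pot_sqi k_cont (HS_shift (hn n) (ha t)) (HS_shift (hn n) (hb t))).
have iW : itg setT W.
  apply: (eq_itg measurableT _ (itgD measurableT
      (sqi_itgM measurableT sha (sqiB measurableT (pp _ (sa t)) (ps _ (sa t))))
      (sqi_itgM measurableT shb (sqiB measurableT (pp _ (sb t)) (ps _ (sb t)))))) => x _.
  by rewrite /W /sh; ring.
have ivs : itg setT (fun x => vd t (x + hn n)) by exact: itg_shift.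
pose Z x := W x + (vd t (x + hn n) - vd t x).
have iZ : itg setT Z by apply: itgD => //; exact: itgB.
(* The nonlinear factor is minus the space increment of the virial density, up to [Z]; translating
   the integral moves this increment onto [psi]. *)
have E2 : Q2 n t = \int[mu]_x (psi x * Z x) + \int[mu]_x ((psi x - psi (x - hn n)) * vd t x).
  have pshift : itg setT (fun x => psi (x - hn n) * vd t x).
    have := itg_shift (- hn n) (psiI _ ivs); apply: eq_itg => // x _.
    by rewrite subrK.
  have e1 : \int[mu]_x (psi (x - hn n) * vd t x) = \int[mu]_x (psi x * vd t (x + hn n)).
    by rewrite -(int_shift (hn n) pshift); apply: eq_int => x _; rewrite addrK.
  have -> : \int[mu]_x ((psi x - psi (x - hn n)) * vd t x) =
      \int[mu]_x (psi x * vd t x) - \int[mu]_x (psi x * vd t (x + hn n)).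
    have ip := psiI _ (ivd t).
    rewrite -e1 -(RintegralB measurableT ip pshift); apply: eq_int => x _; ring.
  have i1 := psiI _ iZ; have i2 := psiI _ (ivd t); have i3 := psiI _ ivs.
  have i23 := itgB measurableT i2 i3.
  rewrite -(RintegralB measurableT i2 i3) -(RintegralD measurableT i1 i23).
  by apply: eq_int => x _; rewrite /Z /W; ring.
(* By [nl_error] and [HS_diff_le] the L^1 norm of [Z] is at most [C K (hn n)^2], so one power of the
   step survives the division. *)
have B1 : `|(hn n)^-1 * \int[mu]_x (psi x * Z x)| <= e / 4.
  rewrite normrM gtr0_norm ?invr_gt0// ler_pdivrMl//.
  have ida := (sqiB measurableT sha (sa t)).2; have idb := (sqiB measurableT shb (sb t)).2.
  have idd := itgD measurableT ida idb.
  apply: int_norm => //; first exact: psiI.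
  apply: (@le_trans _ _ (\int[mu]_x (C * ((a t (x + hn n) - a t x) ^+ 2 + (b t (x + hn n) - b t x) ^+ 2)))).
    apply: le_int => //; [by apply: itg_norm; exact: psiI|exact: itgZ|].
    move=> x _; rewrite normrM -[leRHS]mul1r; apply: ler_pM => //; first exact: (bpsi x).1.
    have := HC (a t) (b t) (a t) (b t) x (x + hn n) (le_trans (dens_bound sol t x) tK)
       (le_trans (dens_bound sol t (x + hn n)) tK).
    by [].
  rewrite RintegralZl// (RintegralD measurableT ida idb).
  have d1 := HS_diff_le h0 (ha t); have d2 := HS_diff_le h0 (hb t).
  have : \int[mu]_x ax t x ^+ 2 + \int[mu]_x bx t x ^+ 2 <= K.
    apply: le_trans tK; rewrite /H1sq /N2.
    have := int_sq_ge0 setT (a t); have := int_sq_ge0 setT (b t); lra.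
  move=> d3.
  apply: (@le_trans _ _ (C * (hn n ^+ 2 * K))).
    apply: ler_wpM2l => //; apply: le_trans (lerD d1 d2) _.
    by rewrite -mulrDr; apply: ler_wpM2l => //; exact: sqr_ge0.
  have -> : C * (hn n ^+ 2 * K) = hn n * (hn n * (C * K)) by ring.
  apply: ler_wpM2l; first exact: ltW.
  by rewrite ler_pdivlMr//; apply: le_trans hC; rewrite -mulrA; apply: ler_wpM2l; [exact: ltW|lra].
have F1 := kappa_form (ha t0) (a0 t0); have F2 := kappa_form (hb t0) (b0 t0).
rewrite mulrDr E1 E2 mulrDr /virial_rate mulrDr -F1 -F2.
move: B1 B2 B3 B4; rewrite /kz.
set j1 := (hn n)^-1 * _; set j2 := \int[mu]_x _; set j3 := \int[mu]_x _; set j4 := \int[mu]_x _.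
set j5 := \int[mu]_x _; set j6 := (hn n)^-1 * _; set j7 := \int[mu]_x _ => B1 B2 B3 B4.
have -> : j2 + j4 + (j1 + j6) - (j3 + j5 + j7) = j1 + (j2 - j3) + (j4 - j5) + (j6 - j7) by ring.
have -> : e = e / 4 + e / 4 + e / 4 + e / 4 by field.
apply: le_trans (ler_normD _ _) (lerD _ B4).
apply: le_trans (ler_normD _ _) (lerD _ B3).
exact: le_trans (ler_normD _ _) (lerD B1 B2).
Unshelve. all: by end_near. Qed.

End virial.

(** * Local decay *)

Section decay.
Variable R : realType.
Local Notation mu := (@lebesgue_measure R).
Implicit Types (g w p q : R -> R) (D E : set (measurableTypeR R)).

Lemma derive_increase (J dJ : R -> R) (s t m : R) : s <= t ->
  (forall u, is_derive u (1 : R) J (dJ u)) -> (forall u, s <= u -> u <= t -> m <= dJ u) ->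
  m * (t - s) <= J t - J s.
Proof.
move=> st dJJ mJ.
have cg : {within `[s, t], continuous J}.
  by apply: derivable_within_continuous => u _; have [du _] := dJJ u; exact: du.
have [u] := MVT_segment st (fun u _ => dJJ u) cg.
rewrite in_itv/= => /andP[su ut] ->; rewrite ler_wpM2r ?subr_ge0//; exact: mJ.
Qed.

(* Barbalat's lemma: if [H > e] at a late time, then [J] still grows by a fixed amount. *)
Lemma barbalat (J dJ H dH : R -> R) (c B K : R) : 0 < c -> 0 < K ->
  (forall t, is_derive t (1 : R) J (dJ t)) -> (forall t, is_derive t (1 : R) H (dH t)) ->
  (forall t, 0 <= H t) -> (forall t, c * H t <= dJ t) -> (forall t, `|dH t| <= K) ->
  (forall t, J t <= B) ->
  forall e : R, 0 < e -> exists T, forall t, T <= t -> H t <= e.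
Proof.
move=> c0 K0 dJJ dHH H0 HJ HK JB e e0.
(* Once [H > e], the bound [K] on its derivative keeps [H] above [e / 2] for a time [e / (2 K)];
   [eta] is the growth of [J] during that time. *)
pose eta := c * (e / 2) * (e / (2 * K)).
have eta0 : 0 < eta.
  by apply: mulr_gt0; [apply: mulr_gt0 => //; exact: divr_gt0|apply: divr_gt0 => //; exact: mulr_gt0].
have Jmono s t : s <= t -> J s <= J t.
  move=> st; have := derive_increase (m := 0) st dJJ; rewrite mul0r subr_ge0; apply.
  by move=> u _ _; apply: le_trans (HJ u); rewrite mulr_ge0// ltW.
have hs : has_sup (range J).
  by split; [exists (J 0), 0|exists B => _ [t _ <-]].
have [_ [T _ <-] HT] := sup_adherent eta0 hs.
exists T => t Tt; rewrite leNgt; apply/negP => et.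
have tau0 : 0 < e / (2 * K) by rewrite divr_gt0// mulr_gt0.
have tt : t <= t + e / (2 * K) by lra.
have Hu u : t <= u -> u <= t + e / (2 * K) -> e / 2 <= H u.
  move=> tu ut.
  have bK v : - K <= dH v by have := HK v; rewrite ler_norml => /andP[].
  have h := derive_increase (m := - K) tu dHH (fun v _ _ => bK v).
  have : K * (u - t) <= e / 2.
    have -> : e / 2 = K * (e / (2 * K)) by field; rewrite gt_eqF.
    by apply: ler_wpM2l; [exact: ltW|lra].
  lra.
have := derive_increase (m := c * (e / 2)) tt dJJ.
have -> : t + e / (2 * K) - t = e / (2 * K) by ring.
rewrite -/eta => h.
have {}h : eta <= J (t + e / (2 * K)) - J t.
  by apply: h => u tu ut; apply: le_trans (HJ u); apply: ler_wpM2l; [exact: ltW|exact: Hu].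
have : J (t + e / (2 * K)) <= sup (range J).
  by apply: (sup_upper_bound hs); exists (t + e / (2 * K)).
have := Jmono _ _ Tt; lra.
Qed.

(** The exponent is chosen so that, against the pointwise growth [|x| exp |x|] of the quadratic
    form, an integrable Gaussian [exp (- x^2)] is left over. *)
Definition gweight (x : R) := expR (- (2 * x ^+ 2)).
Definition gweight' (x : R) := - (4 * x) * gweight x.

Lemma gweight_derive (x : R) : is_derive x (1 : R) gweight (gweight' x).
Proof.
have h : is_derive x (1 : R) (fun x => - (2 * x ^+ 2)) (- (4 * x)).
  by apply: is_derive_eq; rewrite /GRing.scale/=; ring.
have := @is_derive1_comp _ expR (fun x => - (2 * x ^+ 2)) x _ _ (is_derive_expR _) h.
by rewrite /gweight' /gweight mulrC.
Qed.

Lemma gweight_gt0 (x : R) : 0 < gweight x.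
Proof. exact: expR_gt0. Qed.

Lemma gweight_le1 (x : R) : gweight x <= 1.
Proof. by rewrite /gweight -[leRHS]expR0 ler_expR oppr_le0 mulr_ge0// sqr_ge0. Qed.

Lemma gweight_cont : continuous gweight.
Proof. by move=> x; apply/differentiable_continuous/derivable1_diffP; have [] := gweight_derive x. Qed.

Lemma gweight'_cont : continuous gweight'.
Proof.
move=> x; apply: cvgM; last exact: gweight_cont.
by apply: cvgN; apply: cvgM; [exact: cvg_cst|exact: cvg_id].
Qed.

Lemma gweight_multiplier : multiplier gweight gweight' 4.
Proof.
split; [by apply: ac_C1; [exact: gweight_derive|exact: gweight'_cont]|exact: cont_meas measurableT gweight'_cont|].
move=> x; have w1 := gweight_le1 x; have w0 := gweight_gt0 x.
split; first by rewrite gtr0_norm//; lra.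
rewrite normrM normrN normrM normr_nat (gtr0_norm w0) -mulrA ler_piMr//.
rewrite /gweight expRN ler_pdivrMr ?expR_gt0// mul1r.
have := expR_ge1Dx (2 * x ^+ 2); rewrite -(real_normK (num_real x)).
have := sqr_ge0 (`|x| - 1); nra.
Qed.

Variables (f Gam : R -> R).
Hypothesis k_cont : continuous (fun s : R => f (s ^+ 2)).
Hypothesis k_lip : lipschitz_on_bounded f.
Hypothesis Gam_prim : primitive_nl f Gam.

Variables a ax b bx : R -> R -> R.
Hypothesis sol : real_solution f a ax b bx.
Hypothesis a0 : forall t, a t 0 = 0.
Hypothesis b0 : forall t, b t 0 = 0.
Hypothesis dens_even : forall t x, dens (a t) (b t) (- x) = dens (a t) (b t) x.
Variable B : R.
Hypothesis H1B : forall t, H1sq a ax b bx t <= B.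
Hypothesis rateA : forall t, Aform (a t) (ax t) + Aform (b t) (bx t) <= virial_rate f Gam a ax b bx t.

Let ca : H1_curve a ax. Proof. by case: sol. Qed.
Let cb : H1_curve b bx. Proof. by case: sol. Qed.
Let ha t : HS (a t) (ax t). Proof. exact: ca.1. Qed.
Let hb t : HS (b t) (bx t). Proof. exact: cb.1. Qed.
Let sa t : sqi setT (a t). Proof. by case: (ha t). Qed.
Let sb t : sqi setT (b t). Proof. by case: (hb t). Qed.
Let sax t : sqi setT (ax t). Proof. by case: (ha t). Qed.
Let sbx t : sqi setT (bx t). Proof. by case: (hb t). Qed.

Let idens t : itg setT (dens (a t) (b t)). Proof. exact: (dens_itg sol t). Qed.

Definition wmass t := \int[mu]_x (gweight x * dens (a t) (b t) x).

Let iw g : itg setT g -> itg setT (fun x => gweight x * g x).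
Proof.
move=> gi; apply: (itg_dom measurableT _ (itg_norm gi)).
  apply: measurable_funM; [exact: cont_meas measurableT gweight_cont|exact: itg_meas gi].
move=> x _; rewrite normrM (gtr0_norm (gweight_gt0 x)) -[leRHS]mul1r ler_wpM2r//.
exact: gweight_le1.
Qed.

Lemma cross_bound (psi : R -> R) (M t : R) : measurable_fun (setT : set (measurableTypeR R)) psi -> (forall x, `|psi x| <= M) ->
  itg setT (fun x => psi x * (a t x * bx t x - b t x * ax t x)) /\
  `|\int[mu]_x (psi x * (a t x * bx t x - b t x * ax t x))| <= M * B.
Proof.
move=> mp pM; have M0 : 0 <= M by apply: le_trans (pM 0).
have i1 := sqi_itgM measurableT (sa t) (sbx t); have i2 := sqi_itgM measurableT (sb t) (sax t).
have i12 := itgB measurableT i1 i2.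
have ip : itg setT (fun x => psi x * (a t x * bx t x - b t x * ax t x)).
  apply: (itg_dom measurableT _ (itgZ M measurableT (itg_norm i12))).
    by apply: measurable_funM => //; exact: itg_meas i12.
  by move=> x _; rewrite normrM ler_wpM2r.
split => //; apply: int_norm => //.
have j1 := itgD measurableT (sa t).2 (sax t).2; have j2 := itgD measurableT (sb t).2 (sbx t).2.
have j := itgD measurableT j1 j2.
apply: (@le_trans _ _ (M * H1sq a ax b bx t)); last by apply: ler_wpM2l.
have -> : H1sq a ax b bx t = \int[mu]_x (a t x ^+ 2 + ax t x ^+ 2 + (b t x ^+ 2 + bx t x ^+ 2)).
  rewrite (RintegralD measurableT j1 j2) (RintegralD measurableT (sa t).2 (sax t).2).
  by rewrite (RintegralD measurableT (sb t).2 (sbx t).2).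
rewrite -RintegralZl//; apply: le_int => //; [exact: itg_norm|exact: itgZ|].
move=> x _; rewrite normrM; apply: ler_pM => //.
rewrite ler_norml; apply/andP.
have q1 := sqr_ge0 (a t x - bx t x); have q2 := sqr_ge0 (a t x + bx t x).
have q3 := sqr_ge0 (b t x - ax t x); have q4 := sqr_ge0 (b t x + ax t x).
have q5 := sqr_ge0 (a t x); have q6 := sqr_ge0 (b t x).
have q7 := sqr_ge0 (ax t x); have q8 := sqr_ge0 (bx t x).
by split; nra.
Qed.

(** The pointwise bound [Aform_pointwise] holds for [x >= 0] and carries over to [x < 0] by evenness
    of the density. Then [|x| exp |x| <= exp (2 |x|) <= exp (1 + x^2)], and the weight leaves
    [exp 1] times the Gaussian. *)
Lemma wmass_le_Aform : exists2 c : R, 0 < c & forall t,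
  c * wmass t <= Aform (a t) (ax t) + Aform (b t) (bx t).
Proof.
have [G [G0 GE]] : exists G : R, 0 < G /\ \int[mu]_x gauss_fun x <= G.
  exists (\int[mu]_x gauss_fun x + 1); split; last by lra.
  apply: (@lt_le_trans _ _ (0 + 1)); first by rewrite add0r.
  by rewrite lerD2r; apply: Rintegral_ge0 => x _; exact: gauss_fun_ge0.
have e1 := @expR_gt0 R 1.
exists (expR 1 * G)^-1; first by rewrite invr_gt0 mulr_gt0.
move=> t; rewrite ler_pdivrMl ?mulr_gt0//.
set A := Aform (a t) (ax t) + Aform (b t) (bx t).
have A0 : 0 <= A by apply: addr_ge0; exact: Aform_ge0.
have dle x : dens (a t) (b t) x <= `|x| * expR `|x| * A.
  have -> : dens (a t) (b t) x = dens (a t) (b t) `|x|.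
    by have [_|_] := ger0P x; rewrite ?dens_even.
  by rewrite /A mulrDr; apply: lerD; apply: Aform_pointwise.
have ig : itg setT (@gauss_fun R) by exact: integrableT_gauss.
apply: (@le_trans _ _ (\int[mu]_x (expR 1 * A * gauss_fun x))).
  apply: le_int => //; [exact: iw|exact: itgZ|move=> x _].
  have : gweight x * dens (a t) (b t) x <= gweight x * (`|x| * expR `|x| * A).
    by apply: ler_wpM2l; [exact/ltW/gweight_gt0|exact: dle].
  move=> /le_trans; apply.
  have -> : expR 1 * A * gauss_fun x = expR 1 * gauss_fun x * A by ring.
  rewrite mulrA; apply: ler_wpM2r => //.
  have -> : expR 1 * gauss_fun x = gweight x * expR (1 + x ^+ 2).
    by rewrite /gauss_fun /gweight -!expRD; congr expR; ring.
  apply: ler_wpM2l; first exact/ltW/gweight_gt0.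
  apply: (@le_trans _ _ (expR `|x| * expR `|x|)).
    by apply: ler_wpM2r; [exact: expR_ge0|apply: le_trans (expR_ge1Dx _); lra].
  rewrite -expRD ler_expR -(real_normK (num_real x)).
  have := sqr_ge0 (`|x| - 1); nra.
rewrite RintegralZl//.
have -> : expR 1 * G * A = expR 1 * A * G by ring.
by apply: ler_wpM2l => //; rewrite mulr_ge0// ltW.
Qed.

Lemma wmass_vanishes (e : R) : 0 < e -> exists T, forall t, T <= t -> wmass t <= e.
Proof.
have [psi [mp psih psid]] := psi_exists R.
have [apsi _ bpsi] := mp.
have mpsi : measurable_fun setT psi by apply: cont_meas => //; exact: ac_cont apsi.
have [c c0 Hc] := wmass_le_Aform.
have B0 : 0 <= B by apply: le_trans (H1B 0); exact: H1sq_ge0.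
(* The factor 4 bounds [gweight']; adding 1 keeps the constant positive even if [B = 0]. *)
have K0 : 0 < 2 * (4 * B) + 1 by lra.
have [_ mw' bw'] := gweight_multiplier.
apply: (barbalat (J := virial a ax b bx psi) (dJ := virial_rate f Gam a ax b bx) (H := wmass)
  (dH := fun t => 2 * \int[mu]_x (gweight' x * (bx t x * a t x - ax t x * b t x)))
  (c := c) (B := B) (K := 2 * (4 * B) + 1)) => //.
- by move=> t; exact: virial_derivative.
- by move=> t; exact: weighted_mass_derivative gweight_multiplier.
- move=> t; apply: Rintegral_ge0 => x _; apply: mulr_ge0; first exact/ltW/gweight_gt0.
  exact: dens_ge0.
- by move=> t; apply: le_trans (Hc t) (rateA t).
- move=> t; have := (cross_bound t mw' (fun x => (bw' x).2)).2.
  have -> : \int[mu]_x (gweight' x * (bx t x * a t x - ax t x * b t x)) =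
     \int[mu]_x (gweight' x * (a t x * bx t x - b t x * ax t x)).
    by apply: eq_int => x _; ring.
  rewrite normrM normr_nat; lra.
- move=> t; have := (cross_bound t mpsi (fun x => (bpsi x).1)).2.
  rewrite mul1r => /(le_trans (ler_norm _)); exact.
Qed.

(** The square of [gweight g] at [x] is an integral over the ray. The derivative of the weight
    contributes [8 = 2 * 4], and Young's inequality splits the other term. With [l] large, the
    bounded gradient counts little and the weighted mass decides. *)
Lemma weighted_sup g w (l x : R) : HS g w -> 0 < l ->
  (gweight x * g x) ^+ 2 <= (8 + l) * \int[mu]_x (gweight x * g x ^+ 2) + l^-1 * \int[mu]_x w x ^+ 2.
Proof.
move=> hs l0; have [a1 a2 a3] := hs.
have hp := HS_mul gweight_multiplier hs; have [p1 p2 p3] := hp.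
rewrite -[leLHS]opprK -(HS_sq_ray x hp); apply: le_trans (ler_norm _) _; rewrite normrN.
have ip := sqi_itgM measurableT p2 p3; have ip2 := itgZ 2 measurableT ip.
have iwg := iw a2.2.
apply: (le_trans (le_normr_Rintegral _ _)) => //; first by apply: (itgS _ _ _ ip2).
apply: (@le_trans _ _ (\int[mu]_t `|2 * (gweight t * g t * (gweight' t * g t + gweight t * w t))|)).
  by apply: ge0_int_subset => //; exact: itg_norm.
have i1 := itgZ (8 + l) measurableT iwg; have i2 := itgZ l^-1 measurableT a3.2.
rewrite -!RintegralZl//; last exact: a3.2.
rewrite -(RintegralD measurableT i1 i2); apply: le_int => //.
- exact: itg_norm.
- exact: itgD.
move=> t _; have w1 := gweight_le1 t; have w0 := gweight_gt0 t.
have [_ _ bw] := gweight_multiplier; have w4 := (bw t).2.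
have -> : 2 * (gweight t * g t * (gweight' t * g t + gweight t * w t)) =
  2 * gweight' t * (gweight t * g t ^+ 2) + 2 * (gweight t ^+ 2 * g t) * w t by ring.
rewrite [(8 + l) * _]mulrDl -addrA; apply: le_trans (ler_normD _ _) _; apply: lerD.
  rewrite normrM [`|gweight t * _|]ger0_norm; last by rewrite mulr_ge0 ?sqr_ge0// ltW.
  apply: ler_wpM2r; first by rewrite mulr_ge0 ?sqr_ge0// ltW.
  rewrite normrM normr_nat; lra.
apply: (@le_trans _ _ (l * (gweight t ^+ 2 * g t) ^+ 2 + l^-1 * w t ^+ 2)).
  rewrite ler_norml; apply/andP.
  have E : l * (gweight t ^+ 2 * g t) ^+ 2 + l^-1 * w t ^+ 2 =
    l * ((gweight t ^+ 2 * g t) ^+ 2 + (l^-1 * w t) ^+ 2) by field; rewrite gt_eqF.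
  have F : 2 * (gweight t ^+ 2 * g t) * w t = l * (2 * (gweight t ^+ 2 * g t) * (l^-1 * w t)).
    by field; rewrite gt_eqF.
  rewrite E F; move: (gweight t ^+ 2 * g t) (l^-1 * w t) => y z.
  split.
    by rewrite -mulrN ler_pM2l//; have := sqr_ge0 (y + z); nra.
  by rewrite ler_pM2l//; have := sqr_ge0 (y - z); nra.
rewrite lerD2r; apply: ler_wpM2l; first exact: ltW.
rewrite exprMn; apply: ler_wpM2r; first exact: sqr_ge0.
rewrite -exprM; have -> : gweight t = gweight t ^+ 1 by [].
rewrite -exprM; apply: ler_wiXn2l => //; exact: ltW.
Qed.

Theorem real_local_decay (n e : R) : 0 < e ->
  exists T, forall t, T <= t -> forall x, `|x| <= n -> dens (a t) (b t) x <= e.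
Proof.
(* [m] bounds the square of the weight from below on [[- n, n]]; [l] is then taken so large that the
   gradient term of [weighted_sup] is at most [e * m / 2]. *)
move=> e0; have [m [m0 mE]] : exists m : R, 0 < m /\ m = expR (- (4 * n ^+ 2)).
  by eexists; split; last reflexivity; exact: expR_gt0.
have B0 : 0 <= B by apply: le_trans (H1B 0); exact: H1sq_ge0.
have em0 : 0 < e * m by rewrite mulr_gt0.
have [l [l0 lE]] : exists l : R, 0 < l /\ l * (e * m / 2) = B + 1.
  exists (2 * (B + 1) / (e * m)); split; first by rewrite divr_gt0// mulr_gt0//; lra.
  by field; rewrite !gt_eqF.
have l8 : 0 < 2 * (8 + l) by lra.
have [T HT] := wmass_vanishes (divr_gt0 em0 l8).
exists T => t Tt x xn.
have xw : m <= gweight x ^+ 2.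
  rewrite mE /gweight [X in _ <= X]expr2 -expRD ler_expR.
  have : x ^+ 2 <= n ^+ 2.
    by rewrite -(real_normK (num_real x)) lerXn2r// nnegrE// (le_trans _ xn).
  lra.
have h1 := weighted_sup x (ha t) l0; have h2 := weighted_sup x (hb t) l0.
have E : wmass t = \int[mu]_x (gweight x * a t x ^+ 2) + \int[mu]_x (gweight x * b t x ^+ 2).
  have ia := iw (sa t).2; have ib := iw (sb t).2.
  by rewrite -(RintegralD measurableT ia ib); apply: eq_int => z _; rewrite /dens; ring.
rewrite -(ler_pM2l m0); apply: (@le_trans _ _ (gweight x ^+ 2 * dens (a t) (b t) x)).
  by apply: ler_wpM2r => //; exact: dens_ge0.
have -> : gweight x ^+ 2 * dens (a t) (b t) x = (gweight x * a t x) ^+ 2 + (gweight x * b t x) ^+ 2.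
  by rewrite /dens; ring.
apply: le_trans (lerD h1 h2) _.
rewrite addrACA -!mulrDr -E.
have W : (8 + l) * wmass t <= e * m / 2.
  have := HT t Tt; rewrite ler_pdivlMr//; lra.
have N : \int[mu]_x ax t x ^+ 2 + \int[mu]_x bx t x ^+ 2 <= B.
  apply: le_trans (H1B t); rewrite /H1sq /N2.
  have := int_sq_ge0 setT (a t); have := int_sq_ge0 setT (b t); lra.
have V : l^-1 * (\int[mu]_x ax t x ^+ 2 + \int[mu]_x bx t x ^+ 2) <= e * m / 2.
  rewrite ler_pdivrMl//; apply: le_trans N _.
  by rewrite lE lerDl.
rewrite [m * e]mulrC; lra.
Qed.

End decay.

(** * Small data and the defocusing case *)

Section nonlinearity.
Variable R : realType.
Implicit Types (f Gam g : R -> R).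

Lemma locally_lipschitzP g : locally_lipschitz g -> forall c : R, exists r : R, 0 < r /\
  exists L : R, 0 <= L /\ forall s t : R, `|s - c| < r -> `|t - c| < r -> `|g s - g t| <= L * `|s - t|.
Proof.
move=> hg c; have [r r0 Hr] := hg c; exists r; split => //.
move: Hr; rewrite /lipschitz_on => -[M [Mr HM]].
exists (`|M| + 1); split; first by have := normr_ge0 M; lra.
move=> s t sc tc.
have MM : M < `|M| + 1 by have := ler_norm M; lra.
have := HM _ MM (s, t); apply; split; rewrite /= -ball_normE/= distrC//.
Qed.

(** Continuity induction on the right end of an interval [[0, m]] with a Lipschitz bound: at the
    supremum of such [m], the local constant extends the bound a little further, with the larger of
    the two constants. *)
Lemma locally_lipschitz_itv g (M : R) : locally_lipschitz g -> 0 <= M ->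
  exists2 L : R, 0 <= L & forall s t : R, 0 <= s -> s <= t -> t <= M ->
    `|g s - g t| <= L * (t - s).
Proof.
move=> hg M0.
pose S := [set m : R | 0 <= m <= M /\ exists2 L : R, 0 <= L &
  forall s t : R, 0 <= s -> s <= t -> t <= m -> `|g s - g t| <= L * (t - s)].
have S0 : S 0.
  split; first by rewrite lexx.
  exists 0 => // s t s0 st t0; have -> : s = t by lra.
  by rewrite !subrr normr0 mulr0.
have hS : has_sup S by split; [exists 0|exists M => m [/andP[]]].
pose c := sup S.
have [r [r0 [L1 [L10 H1]]]] := locally_lipschitzP hg c.
have r2 : 0 < r / 2 by lra.
have [m [/andP[m0 mM] [L2 L20 H2]] cm] := sup_adherent r2 hS.
have mc : m <= c by apply: sup_upper_bound => //; split; [rewrite m0 mM|exists L2].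
have cE : c = sup S by [].
have {}cm : c - r / 2 < m by exact: cm.
(* This lies beyond the supremum [c] unless it is capped by [M]; as it belongs to [S], it must equal
   [M]. *)
pose m' := Num.min M (c + r / 2).
have m'M : m' <= M by rewrite ge_min lexx.
have m'c : m' <= c + r / 2 by rewrite ge_min lexx orbT.
have m'0 : 0 <= m' by rewrite le_min M0/=; lra.
have L12 : 0 <= Num.max L1 L2 by rewrite le_max L10.
have LL1 : L1 <= Num.max L1 L2 by rewrite le_max lexx.
have LL2 : L2 <= Num.max L1 L2 by rewrite le_max lexx orbT.
have Hm' : forall s t : R, 0 <= s -> s <= t -> t <= m' -> `|g s - g t| <= Num.max L1 L2 * (t - s).
  move: (Num.max L1 L2) LL1 LL2 L12 => L LL1 LL2 L12 s t s0 st tm.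
  have [tm2|mt] := leP t m.
    by apply: le_trans (H2 _ _ s0 st tm2) _; apply: ler_wpM2r => //; lra.
  have nearc (x : R) : c - r / 2 < x -> x <= m' -> `|x - c| < r.
    by move=> x1 x2; rewrite ltr_norml; apply/andP; split; lra.
  have tc : `|t - c| < r by apply: nearc => //; lra.
  have [sm|ms] := ltP s m.
    have mc' : `|m - c| < r by apply: nearc; lra.
    have h1 := H2 _ _ s0 (ltW sm) (lexx m); have h2 := H1 _ _ mc' tc.
    have h3 : `|m - t| = t - m by rewrite distrC gtr0_norm ?subr_gt0.
    rewrite h3 in h2.
    have -> : g s - g t = (g s - g m) + (g m - g t) by ring.
    apply: le_trans (ler_normD _ _) _.
    have : L2 * (m - s) <= L * (m - s) by apply: ler_wpM2r => //; lra.
    have : L1 * (t - m) <= L * (t - m) by apply: ler_wpM2r => //; lra.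
    lra.
  have sc : `|s - c| < r by apply: nearc; lra.
  apply: le_trans (H1 _ _ sc tc) _; rewrite distrC ger0_norm ?subr_ge0//.
  by apply: ler_wpM2r => //; lra.
have Sm' : S m' by split; [rewrite m'0 m'M|exists (Num.max L1 L2)].
have m'lec : m' <= c by apply: sup_upper_bound.
have : m' = M.
  by move: m'lec; rewrite /m'; have [//|h] := leP M (c + r / 2); lra.
by move=> <-; exists (Num.max L1 L2).
Qed.

Lemma locally_lipschitz_cont g : locally_lipschitz g -> continuous g.
Proof.
move=> hg; apply/continuous_epsP => c e e0.
have [r [r0 [L [L0 H]]]] := locally_lipschitzP hg c.
exists (Num.min r (e / (L + 1))); first by rewrite lt_min r0 divr_gt0//; lra.
move=> t; rewrite lt_min => /andP[tr te].
have cr : `|c - c| < r by rewrite subrr normr0.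
apply: le_trans (H _ _ tr cr) _.
move: te; rewrite ltr_pdivlMr; last by lra.
have := normr_ge0 (t - c); nra.
Qed.

Lemma lipschitz_on_boundedP f : locally_lipschitz (fun s : R => f (s ^+ 2)) -> lipschitz_on_bounded f.
Proof.
move=> hf K K0; have K1 : 0 <= K + 1 by lra.
have [L L0 H] := locally_lipschitz_itv hf K1; exists L => // s t s0 t0 sK tK.
have sb : s <= K + 1 by exact: sqr_le_bound.
have tb : t <= K + 1 by exact: sqr_le_bound.
have [st|ts] := leP s t.
  by apply: le_trans (H _ _ s0 st tb) _; rewrite distrC ger0_norm ?subr_ge0.
rewrite distrC; apply: le_trans (H _ _ t0 (ltW ts) sb) _.
by rewrite ger0_norm// subr_ge0 ltW.
Qed.

Lemma primitive_nl_exists f : continuous (fun s : R => f (s ^+ 2)) -> exists Gam, primitive_nl f Gam.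
Proof.
move=> fc; have c2 : continuous (fun s : R => 2 * s * f (s ^+ 2)).
  move=> s; apply: cvgM; last exact: fc.
  by apply: cvgM; [exact: cvg_cst|exact: cvg_id].
have [G dG] := antiderivative_exists c2; exists (fun s => G s - G 0); split; first by rewrite subrr.
move=> s; have dGs := dG s.
by apply: is_derive_eq; rewrite subr0.
Qed.

Lemma Gam_mean f Gam (s : R) : primitive_nl f Gam -> 0 <= s ->
  exists2 x : R, 0 <= x <= s & Gam s = 2 * x * f (x ^+ 2) * s.
Proof.
move=> [G0 dG] s0.
have cg : {within `[0, s], continuous Gam}.
  by apply: derivable_within_continuous => u _; have [du _] := dG u; exact: du.
have [x] := MVT_segment s0 (fun u _ => dG u) cg.
by rewrite in_itv/= G0 !subr0 => xs ->; exists x.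
Qed.

Lemma Gam_ge0 f Gam (s : R) : primitive_nl f Gam -> (forall s : R, 0 <= s -> 0 <= f s) -> 0 <= s ->
  0 <= Gam s.
Proof.
move=> Gp f0 s0; have [x /andP[x0 _] ->] := Gam_mean Gp s0.
by rewrite !mulr_ge0// f0// sqr_ge0.
Qed.

(** With [f (s^2)] frozen, the function [x^2 f (s^2) - Gam x] vanishes at 0 and has derivative
    [2 x (f (s^2) - f (x^2))], nonnegative on [[0, s]] by monotonicity. *)
Lemma virial_nl_ge0 f Gam (s : R) : primitive_nl f Gam -> {in Num.nneg &, {homo f : x y / x <= y}} ->
  0 <= s -> 0 <= virial_nl f Gam s.
Proof.
move=> [G0 dG] fm s0; rewrite /virial_nl.
pose h x := x ^+ 2 * f (s ^+ 2) - Gam x.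
have dh (x : R) : is_derive x (1 : R) h (2 * x * f (s ^+ 2) - 2 * x * f (x ^+ 2)).
  have dGx := dG x; rewrite /h; apply: is_derive_eq.
  by rewrite /GRing.scale/=; ring.
have cg : {within `[0, s], continuous h}.
  by apply: derivable_within_continuous => u _; have [du _] := dh u; exact: du.
have [x] := MVT_segment s0 (fun u _ => dh u) cg.
rewrite in_itv/= /h G0 expr0n/= mul0r !subr0 => /andP[x0 xs] ->.
apply: mulr_ge0 => //; rewrite -mulrBr; apply: mulr_ge0; first by lra.
by rewrite subr_ge0 fm ?nnegrE ?sqr_ge0// lerXn2r.
Qed.

Lemma Gam_growth f Gam (C be s : R) : primitive_nl f Gam -> 0 <= be -> 0 <= C ->
  (forall s : R, 0 <= s -> `|f s| <= C * s `^ be) -> 0 <= s ->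
  `|Gam s| <= 2 * C * s ^+ 2 * (s ^+ 2) `^ be.
Proof.
move=> Gp be0 C0 fC s0; have [x /andP[x0 xs] ->] := Gam_mean Gp s0.
rewrite !normrM normr_nat (ger0_norm x0) (ger0_norm s0).
have h : `|f (x ^+ 2)| <= C * (s ^+ 2) `^ be.
  apply: le_trans (fC _ (sqr_ge0 _)) _; apply: ler_wpM2l => //.
  by apply: ge0_ler_powR; rewrite ?nnegrE ?sqr_ge0// lerXn2r.
have -> : 2 * C * s ^+ 2 * (s ^+ 2) `^ be = 2 * s * (C * (s ^+ 2) `^ be) * s by ring.
apply: ler_wpM2r => //; apply: ler_pM => //; first by rewrite mulr_ge0.
by apply: ler_wpM2l.
Qed.

(** The upper bound on [p] enters here, as [be <= 2]: it reduces the power of the density to its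
    square, which [dens_sq_le] bounds linearly in the gradient. *)
Lemma powR_le1Dsq (x be : R) : 0 <= x -> 0 <= be <= 2 -> x `^ be <= 1 + x ^+ 2.
Proof.
move=> x0 /andP[be0 be2]; have [x1|x1] := leP x 1.
  apply: (@le_trans _ _ 1); last by rewrite lerDl sqr_ge0.
  have -> : 1 = 1 `^ be :> R by rewrite powR1.
  by apply: ge0_ler_powR; rewrite ?nnegrE.
apply: (@le_trans _ _ (x ^+ 2)); last by rewrite lerDr.
by rewrite -powR_mulrn//; apply: ler_powR => //; exact: ltW.
Qed.

(** As [f 0 = 0], the Lipschitz bound gives [|f (s^2)| <= L s], so both terms of [virial_nl] are
    cubic, with constants [L] and [2 L]. *)
Lemma virial_nl_cubic f Gam (L s : R) : primitive_nl f Gam -> f 0 = 0 -> 0 <= L ->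
  (forall s t : R, 0 <= s -> 0 <= t -> s ^+ 2 <= 1 -> t ^+ 2 <= 1 ->
    `|f (s ^+ 2) - f (t ^+ 2)| <= L * `|s - t|) ->
  0 <= s -> s <= 1 -> `|virial_nl f Gam s| <= 3 * L * s ^+ 3.
Proof.
move=> Gp f0 L0 fL s0 s1.
have fs (x : R) : 0 <= x -> x <= 1 -> `|f (x ^+ 2)| <= L * x.
  move=> x0 x1; have := fL x 0 x0 (lexx _).
  rewrite expr0n/= f0 !subr0 (ger0_norm x0); apply => //; exact: exprn_ile1.
rewrite /virial_nl; apply: le_trans (ler_normB _ _) _.
have h1 : `|s ^+ 2 * f (s ^+ 2)| <= L * s ^+ 3.
  rewrite normrM (ger0_norm (sqr_ge0 s)).
  have -> : L * s ^+ 3 = s ^+ 2 * (L * s) by ring.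
  by apply: ler_wpM2l; [exact: sqr_ge0|exact: fs].
have h2 : `|Gam s| <= 2 * L * s ^+ 3.
  have [x /andP[x0 xs] ->] := Gam_mean Gp s0.
  rewrite !normrM normr_nat (ger0_norm x0) (ger0_norm s0).
  have -> : 2 * L * s ^+ 3 = 2 * s * (L * s) * s by ring.
  apply: ler_wpM2r => //; apply: ler_pM => //; [by rewrite mulr_ge0|by apply: ler_wpM2l|].
  by apply: le_trans (fs _ x0 (le_trans xs s1)) _; apply: ler_wpM2l.
lra.
Qed.

End nonlinearity.

(** * Bounds on the H^1 norm and criteria for decay *)

Section decay_criteria.
Variable R : realType.
Local Notation mu := (@lebesgue_measure R).
Variables (f : R -> R).
Hypothesis f_lip : locally_lipschitz (fun s : R => f (s ^+ 2)).
Let k_cont : continuous (fun s : R => f (s ^+ 2)).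
Proof. exact: locally_lipschitz_cont f_lip. Qed.
Let k_lip : lipschitz_on_bounded f.
Proof. exact: lipschitz_on_boundedP. Qed.

Definition odd_real_solution (a ax b bx : R -> R -> R) :=
  [/\ real_solution f a ax b bx, forall t x, a t (- x) = - a t x &
      forall t x, b t (- x) = - b t x].

Definition real_decay (a b : R -> R -> R) := forall n e : R, 0 < e ->
  exists T, forall t, T <= t -> forall x, `|x| <= n -> dens (a t) (b t) x <= e.

(** [virial_rate] contains the quadratic form twice: one copy may be spent on the nonlinear term,
    the other drives the decay. *)
Lemma odd_real_decay Gam a ax b bx (B : R) : primitive_nl f Gam -> odd_real_solution a ax b bx ->
  (forall t, H1sq a ax b bx t <= B) ->
  (forall t, - (Aform (a t) (ax t) + Aform (b t) (bx t)) <=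
     \int[mu]_x (kappa x * vdens f Gam (a t) (b t) x)) ->
  real_decay a b.
Proof.
move=> Gp [sol oa ob] HB HV n e e0.
have o0 (c : R -> R) : (forall x, c (- x) = - c x) -> c 0 = 0.
  by move=> oc; have := oc 0; rewrite oppr0; lra.
apply: (real_local_decay k_cont k_lip Gp sol _ _ _ HB) => //.
- by move=> t; exact: o0 (oa t).
- by move=> t; exact: o0 (ob t).
- by move=> t x; rewrite /dens oa ob !sqrrN.
- by move=> t; have := HV t; rewrite /virial_rate; lra.
Qed.

Section conservation.
Variables (Gam : R -> R) (a ax b bx : R -> R -> R).
Hypothesis Gp : primitive_nl f Gam.
Hypothesis sol : real_solution f a ax b bx.
Local Notation mass t := (\int[mu]_x a t x ^+ 2 + \int[mu]_x b t x ^+ 2).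
Local Notation grad t := (\int[mu]_x ax t x ^+ 2 + \int[mu]_x bx t x ^+ 2).
Local Notation gint t := (\int[mu]_x gdens Gam (a t) (b t) x).

Lemma massE s t : mass s = mass t.
Proof.
by have := mass_conserved k_cont sol s t; rewrite !(int_dens sol).
Qed.

Lemma H1sqE t : H1sq a ax b bx t = mass t + grad t.
Proof. by rewrite /H1sq /N2 addrACA. Qed.

Lemma mass_ge0 t : 0 <= mass t.
Proof. by apply: addr_ge0; exact: int_sq_ge0. Qed.

Lemma grad_ge0 t : 0 <= grad t.
Proof. by apply: addr_ge0; exact: int_sq_ge0. Qed.

Lemma grad_energy s t : grad t = grad s + gint s - gint t.
Proof. have := energy_conserved k_cont k_lip Gp sol t s; rewrite /energy; lra. Qed.

Lemma H1sq_defocusing t : (forall s : R, 0 <= s -> 0 <= f s) ->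
  H1sq a ax b bx t <= mass 0 + grad 0 + gint 0.
Proof.
move=> f0; rewrite H1sqE (massE t 0) (grad_energy 0 t).
have : 0 <= gint t by apply: Rintegral_ge0 => x _; apply: (Gam_ge0 Gp f0); exact: sqrtr_ge0.
lra.
Qed.

Lemma dens_sq_le t x : dens (a t) (b t) x ^+ 2 <= 8 * (mass t * grad t).
Proof.
have [ca cb _ _] := sol; have ha := HS_sup4 x (ca.1 t); have hb := HS_sup4 x (cb.1 t).
have p1 := int_sq_ge0 setT (a t); have p2 := int_sq_ge0 setT (b t).
have p3 := int_sq_ge0 setT (ax t); have p4 := int_sq_ge0 setT (bx t).
move: ha hb p1 p2 p3 p4.
move: (\int[mu]_x a t x ^+ 2) (\int[mu]_x b t x ^+ 2) (\int[mu]_x ax t x ^+ 2)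
  (\int[mu]_x bx t x ^+ 2) => A B C D ha hb A0 B0 C0 D0.
have AD : 0 <= A * D by exact: mulr_ge0.
have BC : 0 <= B * C by exact: mulr_ge0.
have := sqr_ge0 (a t x ^+ 2 - b t x ^+ 2); rewrite /dens.
move: ha hb; rewrite -[4%N]/(2 * 2)%N !exprM.
move: AD BC; clear; move: (a t x ^+ 2) (b t x ^+ 2) => y z AD BC ha hb yz.
have -> : 8 * ((A + B) * (C + D)) = 8 * (A * C) + 8 * (B * D) + 8 * (A * D) + 8 * (B * C) by ring.
move: (A * C) (B * D) (A * D) (B * C) AD BC ha hb yz => ac bd ad bc AD BC ha hb yz.
have -> : (y + z) ^+ 2 = 2 * y ^+ 2 + 2 * z ^+ 2 - (y - z) ^+ 2 by ring.
lra.
Qed.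

(** The potential energy density is at most [2 C dens] times the power [be] of the density, and this
    power is at most [1 + 8 grad] by [dens_sq_le]. The bound is linear in the gradient, with the
    conserved mass as a factor. *)
Lemma gint_le (C be : R) t : 0 <= be <= 2 -> 0 <= C ->
  (forall s : R, 0 <= s -> `|f s| <= C * s `^ be) -> mass t <= 1 ->
  `|gint t| <= 2 * C * (1 + 8 * grad t) * mass t.
Proof.
move=> be02 C0 fC m1; have be0 : 0 <= be by case/andP: be02.
have g0 := grad_ge0 t; have m0 := mass_ge0 t.
have ig : itg setT (gdens Gam (a t) (b t)) by exact: (gdens_itg k_cont k_lip Gp sol t).
have id : itg setT (dens (a t) (b t)) by exact: (dens_itg sol t).
have -> : mass t = \int[mu]_x dens (a t) (b t) x by rewrite (int_dens sol).
rewrite -RintegralZl//; apply: int_norm => //; apply: le_int => //.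
- exact: itg_norm.
- exact: itgZ.
move=> x _; have d0 := dens_ge0 (a t) (b t) x.
have sq : Num.sqrt (dens (a t) (b t) x) ^+ 2 = dens (a t) (b t) x by rewrite sqr_sqrtr.
apply: (le_trans (Gam_growth Gp be0 C0 fC (sqrtr_ge0 _))); rewrite sq.
have h : dens (a t) (b t) x `^ be <= 1 + 8 * grad t.
  apply: le_trans (powR_le1Dsq d0 be02) _; rewrite lerD2l.
  apply: le_trans (dens_sq_le t x) _; rewrite ler_pM2l//.
  by rewrite -[leRHS]mul1r ler_wpM2r.
have -> : 2 * C * (1 + 8 * grad t) * dens (a t) (b t) x =
  2 * C * dens (a t) (b t) x * (1 + 8 * grad t) by ring.
by apply: ler_wpM2l => //; rewrite !mulr_ge0.
Qed.

(** Since [32 C] times the mass is at most 1, the potential energy at time [t] costs at most [2 C]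
    times the mass plus half of the gradient at time [t]. Conservation of energy then bounds this
    gradient by three times the initial one plus [8 C] times the mass. *)
Lemma H1sq_small (C be d : R) : 0 <= be <= 2 -> 0 <= C ->
  (forall s : R, 0 <= s -> `|f s| <= C * s `^ be) ->
  H1sq a ax b bx 0 <= d -> d <= 1 -> 32 * C * d <= 1 ->
  forall t, H1sq a ax b bx t <= (4 + 8 * C) * d.
Proof.
move=> be02 C0 fC Hd d1 Cd t; move: Hd; rewrite !H1sqE (massE t 0) => Hd.
have m0 := mass_ge0 0; have g0 := grad_ge0 0; have gt := grad_ge0 t.
have m1 : mass 0 <= 1 by apply: le_trans (le_trans _ Hd) d1; rewrite lerDl.
have h0 := gint_le (t := 0) be02 C0 fC m1.
have ht : `|gint t| <= 2 * C * (1 + 8 * grad t) * mass 0.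
  by rewrite -(massE t 0); apply: (gint_le be02 C0 fC); rewrite (massE t 0).
have E := grad_energy 0 t.
move: (mass 0) (grad 0) (grad t) (gint 0) (gint t) m0 g0 gt Hd m1 h0 ht E => m g g' i i'.
move=> m0 g0 g'0 Hd m1; rewrite !ler_norml => /andP[h1 h2] /andP[h3 h4] E.
have q : 32 * C * m <= 1.
  by apply: le_trans Cd; apply: ler_wpM2l; [rewrite mulr_ge0|lra].
have q0 : 0 <= C * m by exact: mulr_ge0.
have q1 : C * m <= C * d by apply: ler_wpM2l => //; lra.
have qg x : 0 <= x -> C * m * x <= x / 32.
  move=> x0; have : 0 <= (1 - 32 * C * m) * x by apply: mulr_ge0 => //; rewrite subr_ge0.
  lra.
have := qg _ g0; have := qg _ g'0.
lra.
Qed.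

End conservation.

Theorem defocusing_decay a ax b bx : (forall s : R, 0 <= s -> 0 <= f s) ->
  {in Num.nneg &, {homo f : x y / x <= y}} ->
  odd_real_solution a ax b bx -> real_decay a b.
Proof.
move=> f0 fm osol; have [sol _ _] := osol.
have [Gam Gp] := primitive_nl_exists k_cont.
apply: (odd_real_decay Gp osol (fun t => H1sq_defocusing Gp sol t f0)) => t.
apply: (@le_trans _ _ 0); first by rewrite oppr_le0 addr_ge0// Aform_ge0.
apply: Rintegral_ge0 => x _; apply: mulr_ge0; first exact: kappa_ge0.
by apply: virial_nl_ge0 => //; exact: sqrtr_ge0.
Qed.

Theorem small_decay (C be : R) : 0 < be <= 2 -> 0 <= C ->
  (forall s : R, 0 <= s -> `|f s| <= C * s `^ be) ->
  exists2 d : R, 0 < d & forall a ax b bx, odd_real_solution a ax b bx ->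
    H1sq a ax b bx 0 <= d -> real_decay a b.
Proof.
move=> /andP[be0 be2] C0 fC.
have be02 : 0 <= be <= 2 by rewrite (ltW be0).
have f0 : f 0 = 0.
  apply/eqP; rewrite -normr_le0; apply: le_trans (fC 0 (lexx _)) _.
  by rewrite powR0 ?mulr0// gt_eqF.
have [Gam Gp] := primitive_nl_exists k_cont.
have [L L0 fL] := k_lip ler01.
have L1' : 0 < 1 + 432 * L by lra.
(* [432 = 12 * 36]: the nonlinear density is at most [12 L] times the sum of the cubes, and
   [cubic_le] costs [36 r] for functions bounded by [r]. A product at most 1 means that one copy of
   the quadratic form absorbs it. *)
have [r [r0 r1 rL]] : exists r : R, [/\ 0 < r, r <= 1 & 432 * L * r <= 1].
  exists (1 + 432 * L)^-1; split; [by rewrite invr_gt0|by rewrite invf_le1//; lra|].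
  by rewrite ler_pdivrMr// mul1r; lra.
have C4 : 0 < 4 + 32 * C by lra.
(* As [r <= 1], this single equation yields [d <= 1], [32 C d <= 1] and [(4 + 8 C) d <= r^2]. *)
have [d [d0 dr]] : exists d : R, 0 < d /\ (4 + 32 * C) * d = r ^+ 2.
  exists (r ^+ 2 / (4 + 32 * C)); split; first by rewrite divr_gt0// exprn_gt0.
  by rewrite mulrC divfK// gt_eqF.
have r21 : r ^+ 2 <= 1 by rewrite exprn_ile1// ltW.
exists d => // a ax b bx osol Hd; have [sol oa ob] := osol.
have Cd0 : 0 <= C * d by rewrite mulr_ge0// ltW.
have d1 : d <= 1 by lra.
have Cd : 32 * C * d <= 1 by lra.
have HB t : H1sq a ax b bx t <= r ^+ 2.
  apply: le_trans (H1sq_small Gp sol be02 C0 fC Hd d1 Cd t) _.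
  by rewrite -dr; lra.
apply: (odd_real_decay Gp osol HB) => t.
have dB x : dens (a t) (b t) x <= r ^+ 2 by apply: le_trans (dens_bound sol t x) (HB t).
have aB x : `|a t x| <= r.
  rewrite -(@ler_pXn2r _ 2)// ?nnegrE ?(ltW r0)// real_normK ?num_real//.
  by apply: le_trans (dB x); rewrite lerDl sqr_ge0.
have bB x : `|b t x| <= r.
  rewrite -(@ler_pXn2r _ 2)// ?nnegrE ?(ltW r0)// real_normK ?num_real//.
  by apply: le_trans (dB x); rewrite lerDr sqr_ge0.
have o0 (c : R -> R) : (forall x, c (- x) = - c x) -> c 0 = 0.
  by move=> oc; have := oc 0; rewrite oppr0; lra.
have [ca cb _ _] := sol.
have [ia Ia] := cubic_le (ca.1 t) (o0 _ (oa t)) aB.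
have [ib Ib] := cubic_le (cb.1 t) (o0 _ (ob t)) bB.
have iab := itgD measurableT ia ib.
have iv : itg setT (vdens f Gam (a t) (b t)) by exact: (vdens_itg k_cont k_lip Gp sol t).
(* [3 L] comes from [virial_nl_cubic], the factor 4 from convexity: [(y + z)^3 <= 4 (y^3 + z^3)]. *)
have v3 x : `|vdens f Gam (a t) (b t) x| <= 12 * L * (`|a t x| ^+ 3 + `|b t x| ^+ 3).
  have s0 := sqrtr_ge0 (dens (a t) (b t) x).
  have sq : Num.sqrt (dens (a t) (b t) x) ^+ 2 = dens (a t) (b t) x by rewrite sqr_sqrtr// dens_ge0.
  have s1 : Num.sqrt (dens (a t) (b t) x) <= 1.
    by rewrite -[leRHS]sqrtr1 ler_wsqrtr//; apply: le_trans (dB x) r21.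
  apply: le_trans (virial_nl_cubic Gp f0 L0 fL s0 s1) _.
  have sab : Num.sqrt (dens (a t) (b t) x) <= `|a t x| + `|b t x|.
    rewrite -(@ler_pXn2r _ 2)// ?nnegrE ?addr_ge0// sq /dens.
    rewrite -[a t x ^+ 2]real_normK ?num_real// -[b t x ^+ 2]real_normK ?num_real//.
    by have : 0 <= `|a t x| * `|b t x| by []; nra.
  have -> : 12 * L * (`|a t x| ^+ 3 + `|b t x| ^+ 3) = 3 * L * (4 * (`|a t x| ^+ 3 + `|b t x| ^+ 3)) by ring.
  apply: ler_wpM2l; first by rewrite mulr_ge0.
  apply: (@le_trans _ _ ((`|a t x| + `|b t x|) ^+ 3)); first by rewrite lerXn2r// nnegrE addr_ge0.
  move: (normr_ge0 (a t x)) (normr_ge0 (b t x)); move: `|a t x| `|b t x| => y z y0 z0.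
  rewrite -subr_ge0.
  have -> : 4 * (y ^+ 3 + z ^+ 3) - (y + z) ^+ 3 = 3 * ((y + z) * (y - z) ^+ 2) by ring.
  by rewrite mulr_ge0// mulr_ge0 ?sqr_ge0// addr_ge0.
have kia := kappa_itg ia; have kib := kappa_itg ib; have kiv := kappa_itg iv.
have : `|\int[mu]_x (kappa x * vdens f Gam (a t) (b t) x)| <=
    12 * L * (\int[mu]_x (kappa x * `|a t x| ^+ 3) + \int[mu]_x (kappa x * `|b t x| ^+ 3)).
  rewrite -(RintegralD measurableT kia kib).
  have kiab := itgD measurableT kia kib.
  rewrite -RintegralZl//; apply: int_norm => //; apply: le_int => //.
  - exact: itg_norm.
  - exact: itgZ.
  move=> x _; rewrite normrM ger0_norm ?kappa_ge0// -mulrDr.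
  have -> : 12 * L * (kappa x * (`|a t x| ^+ 3 + `|b t x| ^+ 3)) =
    kappa x * (12 * L * (`|a t x| ^+ 3 + `|b t x| ^+ 3)) by ring.
  by apply: ler_wpM2l => //; exact: kappa_ge0.
have Aa := Aform_ge0 (a t) (ax t); have Ab := Aform_ge0 (b t) (bx t).
move: Ia Ib rL L0 r0 Aa Ab; rewrite ler_norml.
move: (\int[mu]_x (kappa x * `|a t x| ^+ 3)) (\int[mu]_x (kappa x * `|b t x| ^+ 3))
  (\int[mu]_x (kappa x * vdens f Gam (a t) (b t) x)) (Aform (a t) (ax t)) (Aform (b t) (bx t))
  => ka kb V A B Ia Ib {}rL {}L0 {}r0 A0 B0 /andP[h _].
apply: le_trans h; rewrite lerN2.
apply: (@le_trans _ _ (12 * L * (36 * r * A + 36 * r * B))).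
  by apply: ler_wpM2l; [rewrite mulr_ge0|exact: lerD].
have -> : 12 * L * (36 * r * A + 36 * r * B) = 432 * L * r * (A + B) by ring.
by rewrite -[leRHS]mul1r; apply: ler_wpM2r => //; exact: addr_ge0.
Qed.

End decay_criteria.

(** * From complex-valued to real-valued solutions *)

Section complex_functions.
Variable R : realType.
Local Notation mu := (@lebesgue_measure R).
Local Notation Re := complex.Re.
Local Notation Im := complex.Im.
Implicit Types (g w phi : R -> R[i]) (z : R[i]).

Lemma normc_sq z : Normc.normc z ^+ 2 = Re z ^+ 2 + Im z ^+ 2.
Proof. by case: z => x y /=; rewrite sqr_sqrtr// addr_ge0// sqr_ge0. Qed.

Lemma normc_nneg z : 0 <= Normc.normc z.
Proof. by case: z => x y; exact: sqrtr_ge0. Qed.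

Lemma Re_le_normc z : `|Re z| <= Normc.normc z.
Proof.
rewrite -(@ler_pXn2r _ 2)// ?nnegrE ?normc_nneg// normc_sq real_normK ?num_real//.
by rewrite lerDl sqr_ge0.
Qed.

Lemma Im_le_normc z : `|Im z| <= Normc.normc z.
Proof.
rewrite -(@ler_pXn2r _ 2)// ?nnegrE ?normc_nneg// normc_sq real_normK ?num_real//.
by rewrite lerDr sqr_ge0.
Qed.

Lemma abs_pow2 (x : R) : `|x| `^ 2 = x ^+ 2.
Proof. by rewrite powR_mulrn// real_normK// num_real. Qed.

Lemma Lpnorm2E g : Lpnorm 2%:E g = ((\int[mu]_x (Re (g x) ^+ 2 + Im (g x) ^+ 2)%:E) `^ 2^-1)%E.
Proof.
rewrite /Lpnorm unlock; congr (_ `^ _)%E.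
by apply: eq_integral => x _ /=; rewrite abs_pow2 normc_sq.
Qed.

Lemma sq_measurable g : cmeasurable g ->
  measurable_fun (setT : set (measurableTypeR R)) (fun x => Re (g x) ^+ 2 + Im (g x) ^+ 2).
Proof. by move=> [mr mi]; apply: measurable_funD; exact: measurable_funX. Qed.

Lemma L2_sqi g : L2 g -> sqi setT (fun x => Re (g x)) /\ sqi setT (fun x => Im (g x)).
Proof.
move=> [mg]; rewrite Lpnorm2E => fin; have [mr mi] := mg.
have i : itg setT (fun x => Re (g x) ^+ 2 + Im (g x) ^+ 2).
  apply/integrableP; split; first by apply/measurable_EFinP; exact: sq_measurable.
  under eq_integral => x _ do rewrite /= ger0_norm ?addr_ge0 ?sqr_ge0//.
  rewrite ltey; apply/eqP => E; move: fin; rewrite E.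
  by rewrite poweRyr// ltxx.
split; split => //; apply: (itg_dom measurableT _ i) => //; try exact: measurable_funX.
- by move=> x _; rewrite ger0_norm ?sqr_ge0// lerDl sqr_ge0.
- by move=> x _; rewrite ger0_norm ?sqr_ge0// lerDr sqr_ge0.
Qed.

Lemma Lpnorm2_fin g (a b : R -> R) : sqi setT (fun x => Re (g x)) -> sqi setT (fun x => Im (g x)) ->
  {ae mu, forall x, Re (g x) = a x} -> {ae mu, forall x, Im (g x) = b x} ->
  measurable_fun (setT : set (measurableTypeR R)) a -> measurable_fun (setT : set (measurableTypeR R)) b ->
  Lpnorm 2%:E g = (Num.sqrt (\int[mu]_x a x ^+ 2 + \int[mu]_x b x ^+ 2))%:E.
Proof.
move=> sr si ra ib ma mb; rewrite Lpnorm2E.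
have E : (\int[mu]_x (Re (g x) ^+ 2 + Im (g x) ^+ 2)%:E =
   (\int[mu]_x a x ^+ 2 + \int[mu]_x b x ^+ 2)%R%:E)%E.
  have i := itgD measurableT sr.2 si.2.
  have -> : (\int[mu]_x (Re (g x) ^+ 2 + Im (g x) ^+ 2)%:E =
    (\int[mu]_x (Re (g x) ^+ 2 + Im (g x) ^+ 2))%R%:E)%E.
    by rewrite /Rintegral fineK//; exact: (integrable_fin_num measurableT i).
  congr EFin; rewrite (RintegralD measurableT sr.2 si.2); congr +%R.
    apply: eq_ae_int => //; [exact: itg_meas sr.2|exact: measurable_funX|].
    by apply: (ae_imp ra) => x ->.
  apply: eq_ae_int => //; [exact: itg_meas si.2|exact: measurable_funX|].
  by apply: (ae_imp ib) => x ->.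
rewrite E poweR_EFin powR12_sqrt//; apply: addr_ge0; exact: int_sq_ge0.
Qed.

Lemma sqi_L2 g : sqi setT (fun x => Re (g x)) -> sqi setT (fun x => Im (g x)) -> L2 g.
Proof.
move=> sr si; split; first by split; [exact: sr.1|exact: si.1].
by rewrite (Lpnorm2_fin sr si _ _ sr.1 si.1) ?ltry//; apply: aeW.
Qed.

Lemma ae_eq_cont (h : R -> R) : continuous h -> {ae mu, forall x, h x = 0} -> forall x, h x = 0.
Proof.
move=> ch [N [mN N0 hN]] x; apply/eqP; apply: contraT => hx.
have hx0 : 0 < `|h x| / 2 by rewrite divr_gt0// normr_gt0.
have [r r0 Hr] := (continuous_epsP h).2 ch x _ hx0.
have sub : ball x r `<=` N.
  move=> y; rewrite -ball_normE/= distrC => yr; apply: hN => /= hy.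
  by have := Hr y yr; rewrite hy sub0r normrN; have := hx; rewrite -normr_gt0; lra.
have : (mu (ball x r) <= 0)%E.
  by rewrite -N0; apply: le_measure => //; rewrite inE; [exact: mball|exact: mN].
rewrite lebesgue_measure_ball ?(ltW r0)// lee_fin.
by rewrite leNgt pmulrn_lgt0// r0.
Qed.

Lemma ae_reflect (P : R -> Prop) : {ae mu, forall x, P x} -> {ae mu, forall x, P (- x)}.
Proof.
move=> [N [mN N0 hN]]; exists ((fun x => - x) @^-1` N); split.
- by have := @oppr_measurable R setT measurableT N mN; rewrite setTI.
- by rewrite -N0; exact: (@lebesgue_measureN R N mN).
- by move=> x /= Px; apply: hN.
Qed.

End complex_functions.

(** * Continuous representatives of H^1 functions *)

Section H1_representatives.
Variable R : realType.
Local Notation mu := (@lebesgue_measure R).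
Local Notation Re := complex.Re.
Local Notation Im := complex.Im.
Implicit Types (g w phi : R -> R[i]) (z : R[i]).

Lemma Re_mul_real z (r : R) : Re (z * r%:C%C) = Re z * r.
Proof. by case: z => x y /=; ring. Qed.

Lemma Im_mul_real z (r : R) : Im (z * r%:C%C) = Im z * r.
Proof. by case: z => x y /=; ring. Qed.

Lemma Im_opp z : Im (- z) = - Im z.
Proof. by case: z. Qed.

Lemma Re_opp z : Re (- z) = - Re z.
Proof. by case: z. Qed.

Lemma complex_eq z z' : Re z = Re z' -> Im z = Im z' -> z = z'.
Proof. by case: z z' => x y [x' y'] /= -> ->. Qed.

Lemma weak_derivative_parts g w : weak_derivative g w <-> forall eta : R -> R, C1c eta ->
  (\int[mu]_x (Re (g x) * derive1 eta x) = - \int[mu]_x (Re (w x) * eta x)) /\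
  (\int[mu]_x (Im (g x) * derive1 eta x) = - \int[mu]_x (Im (w x) * eta x)).
Proof.
have E g' (h : R -> R) : cintegral (fun x => g' x * (h x)%:C%C) =
    Complex (\int[mu]_x (Re (g' x) * h x)) (\int[mu]_x (Im (g' x) * h x)).
  rewrite /cintegral; congr Complex; apply: eq_int => x _; [exact: Re_mul_real|exact: Im_mul_real].
split=> H eta he; have := H eta he; rewrite !E.
  by move=> [-> ->].
by move=> [-> ->].
Qed.

Lemma C1c_HS (eta : R -> R) : C1c eta -> HS eta (derive1 eta).
Proof.
move=> he; have ae := C1c_ac he; have [M M0 HM] := C1c_support he.
have sup (h : R -> R) : continuous h -> (forall x, M <= `|x| -> h x = 0) -> sqi setT h.
  move=> ch hM; split; first exact: cont_meas.
  have i : itg `[- M, M] (fun x => h x ^+ 2).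
    by apply: itg_cont => x; apply: (@continuous_comp _ _ _ h (fun s : R => s ^+ 2)); [exact: ch|exact: exprn_continuous].
  apply: (eq_itg (f := (fun x => h x ^+ 2) \_ `[- M, M])) => //.
    move=> x _; rewrite patchE; case: ifPn => //; rewrite notin_setE/= in_itv/= -ler_norml.
    by move=> /negP; rewrite -ltNge => /ltW /hM ->; rewrite expr0n.
  move: i; rewrite /itg integrable_mkcond//= => i.
  by rewrite -restrict_EFin.
split=> //.
  by apply: sup; [exact: ac_cont ae|move=> x /HM[]].
by apply: sup; [case: he|move=> x /HM[]].
Qed.

Lemma HS_weak_derivative g (a ax b bx : R -> R) (w : R -> R[i]) : L2 g -> HS a ax -> HS b bx ->
  {ae mu, forall x, Re (g x) = a x} -> {ae mu, forall x, Im (g x) = b x} ->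
  (forall x, Re (w x) = ax x) -> (forall x, Im (w x) = bx x) -> weak_derivative g w.
Proof.
move=> [[mr mi] _] ha hb ra ib rw iw; apply/weak_derivative_parts => eta he.
have hh := C1c_HS he.
have me : measurable_fun (setT : set (measurableTypeR R)) (derive1 eta) by case: hh => _ _ [].
have ibp (q : R -> R) (c cx : R -> R) : measurable_fun (setT : set (measurableTypeR R)) q -> HS c cx ->
    {ae mu, forall x, q x = c x} ->
    \int[mu]_x (q x * derive1 eta x) = - \int[mu]_x (cx x * eta x).
  move=> mq hc qc; rewrite (HS_ibp hc hh) opprK.
  have mc : measurable_fun (setT : set (measurableTypeR R)) c by case: hc => _ [].
  apply: eq_ae_int => //; [exact: measurable_funM|exact: measurable_funM|].
  by apply: (ae_imp qc) => x ->.
split.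
  rewrite (ibp _ _ _ mr ha ra); congr (- _); apply: eq_int => x _; rewrite rw//.
rewrite (ibp _ _ _ mi hb ib); congr (- _); apply: eq_int => x _; rewrite iw//.
Qed.

Lemma dx_spec g : H1 g -> L2 (dx g) /\ weak_derivative g (dx g).
Proof. by move=> [_ [w Lw ww]]; apply: (@xgetPex _ (fun=> 0) [set w | L2 w /\ weak_derivative g w]); exists w. Qed.

(** The derivatives are the parts of [dx g] itself, so that the second-derivative functional
    [Hm1_dxx] is expressed by the same functions. *)
Lemma H1_representative g : H1 g -> exists a b : R -> R,
  [/\ HS a (fun x => Re (dx g x)), HS b (fun x => Im (dx g x)),
      {ae mu, forall x, Re (g x) = a x} & {ae mu, forall x, Im (g x) = b x}].
Proof.
move=> hg; have [Lw /weak_derivative_parts ww] := dx_spec hg; have [Lg _] := hg.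
have [sr si] := L2_sqi Lg; have [wr wi] := L2_sqi Lw.
have [a ha ra] := weak_derivative_HS sr wr (fun eta he => (ww eta he).1).
have [b hb ib] := weak_derivative_HS si wi (fun eta he => (ww eta he).2).
by exists a, b.
Qed.

Lemma HS_ae0 (g w : R -> R) : HS g w -> {ae mu, forall x, g x = 0} -> forall x, g x = 0.
Proof. by move=> [/ac_cont cg _ _]; exact: ae_eq_cont. Qed.

(** [dx g] is an arbitrary choice. Its own continuous representatives agree with [a] and [b] almost
    everywhere, hence everywhere, and Lebesgue differentiation then identifies the derivatives
    almost everywhere. *)
Lemma H1_of_representative g (a ax b bx : R -> R) : cmeasurable g -> HS a ax -> HS b bx ->
  {ae mu, forall x, Re (g x) = a x} -> {ae mu, forall x, Im (g x) = b x} ->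
  [/\ H1 g, H1norm g = (Num.sqrt (N2 a ax + N2 b bx))%:E,
      {ae mu, forall x, Re (dx g x) = ax x} & {ae mu, forall x, Im (dx g x) = bx x}].
Proof.
move=> [mr mi] ha hb ra ib; have [_ sa sax] := ha; have [_ sb sbx] := hb.
have sr := eq_ae_sqi measurableT mr ra sa; have si := eq_ae_sqi measurableT mi ib sb.
have Lg := sqi_L2 sr si.
have hg : H1 g.
  split=> //; exists (fun x => Complex (ax x) (bx x)); first exact: sqi_L2.
  by apply: HS_weak_derivative ha hb _ _ _ _.
have [Lw _] := dx_spec hg.
have [a' [b' [ha' hb' ra' ib']]] := H1_representative hg.
have ea x : a' x = a x.
  apply/eqP; rewrite -subr_eq0; apply/eqP; move: x; apply: (HS_ae0 (HS_sub ha' ha)).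
  by apply: (ae_imp2 ra ra') => x -> ->; rewrite subrr.
have eb x : b' x = b x.
  apply/eqP; rewrite -subr_eq0; apply/eqP; move: x; apply: (HS_ae0 (HS_sub hb' hb)).
  by apply: (ae_imp2 ib ib') => x -> ->; rewrite subrr.
have {ea}ea : a' = a by apply/funext.
have {eb}eb : b' = b by apply/funext.
rewrite {}ea in ha'; rewrite {}eb in hb'.
have dr := HS_derivative_unique ha' ha; have di := HS_derivative_unique hb' hb.
split => //; have [wr wi] := L2_sqi Lw.
rewrite /H1norm (Lpnorm2_fin sr si ra ib sa.1 sb.1) (Lpnorm2_fin wr wi dr di sax.1 sbx.1).
have p1 := int_sq_ge0 setT a; have p2 := int_sq_ge0 setT b.
have p3 := int_sq_ge0 setT ax; have p4 := int_sq_ge0 setT bx.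
rewrite -!EFin_expe -EFinD poweR_EFin !sqr_sqrtr ?addr_ge0// powR12_sqrt ?addr_ge0//.
by rewrite /N2 addrACA.
Qed.

(** Tested on real functions, the bilinear pairing separates the real and imaginary parts of the
    equation. The [dx] of such a function is real only almost everywhere, since it is a chosen
    representative. *)
Lemma real_test (p px : R -> R) : HS p px ->
  [/\ H1 (fun x => (p x)%:C%C), H1norm (fun x => (p x)%:C%C) = (Num.sqrt (N2 p px))%:E,
      {ae mu, forall x, Re (dx (fun x => (p x)%:C%C) x) = px x} &
      {ae mu, forall x, Im (dx (fun x => (p x)%:C%C) x) = 0}].
Proof.
move=> hp; have [_ sp spx] := hp.
have h0 : HS (fun=> 0 : R) (fun=> 0 : R).
  have := HS_scale 0 hp; congr HS; apply/funext => x; rewrite mul0r//.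
have N0 : N2 (fun=> 0 : R) (fun=> 0 : R) = 0.
  by rewrite -[RHS](N2_subrr p px); congr N2; apply/funext => x; rewrite subrr.
have [|||h1 h2 h3 h4] := H1_of_representative (g := fun x => (p x)%:C%C) _ hp h0.
- by split => /=; [exact: sp.1|exact: measurable_cst].
- exact: aeW.
- exact: aeW.
by rewrite N0 addr0 in h2; split.
Qed.

End H1_representatives.

(** * The equation tested against real functions *)

Section solution_parts.
Variable R : realType.
Local Notation mu := (@lebesgue_measure R).
Local Notation Re := complex.Re.
Local Notation Im := complex.Im.
Implicit Types (g w phi : R -> R[i]) (z : R[i]).

Lemma cvge0_lt (T : Type) (F : set_system T) (G : T -> \bar R) (e : R) :
  G x @[x --> F] --> 0%E -> 0 < e -> F [set x | (G x < e%:E)%E].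
Proof.
move=> GF e0; apply: (GF [set y | (y < e%:E)%E]); apply: open_nbhs_nbhs.
by split; [exact: open_ereal_lt_ereal|rewrite /= lte_fin].
Qed.

Lemma Re_sub z1 z2 : Re (z1 - z2) = Re z1 - Re z2.
Proof. by case: z1 z2 => ? ? []. Qed.

Lemma Im_sub z1 z2 : Im (z1 - z2) = Im z1 - Im z2.
Proof. by case: z1 z2 => ? ? []. Qed.

Lemma Re_mul z1 z2 : Re (z1 * z2) = Re z1 * Re z2 - Im z1 * Im z2.
Proof. by case: z1 z2 => ? ? []. Qed.

Lemma Im_mul z1 z2 : Im (z1 * z2) = Re z1 * Im z2 + Im z1 * Re z2.
Proof. by case: z1 z2 => ? ? []. Qed.

Variables (a ax b bx : R -> R -> R) (u : R -> R -> R[i]).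
Hypothesis ha : forall t, HS (a t) (ax t).
Hypothesis hb : forall t, HS (b t) (bx t).
Hypothesis ra : forall t, {ae mu, forall x, Re (u t x) = a t x}.
Hypothesis ib : forall t, {ae mu, forall x, Im (u t x) = b t x}.
Hypothesis uH1 : forall t, H1 (u t).

Let mr t : measurable_fun (setT : set (measurableTypeR R)) (fun x => Re (u t x)).
Proof. by have [[[]]] := uH1 t. Qed.
Let mi t : measurable_fun (setT : set (measurableTypeR R)) (fun x => Im (u t x)).
Proof. by have [[[]]] := uH1 t. Qed.
Let ma t : measurable_fun (setT : set (measurableTypeR R)) (a t).
Proof. by have [_ []] := ha t. Qed.
Let mb t : measurable_fun (setT : set (measurableTypeR R)) (b t).
Proof. by have [_ []] := hb t. Qed.

Lemma H1norm_diff s t : H1norm (fun x => u s x - u t x) =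
  (Num.sqrt (N2 (fun x => a s x - a t x) (fun x => ax s x - ax t x) +
             N2 (fun x => b s x - b t x) (fun x => bx s x - bx t x)))%:E.
Proof.
have [] := @H1_of_representative R (fun x => u s x - u t x) _ _ _ _ _
  (HS_sub (ha s) (ha t)) (HS_sub (hb s) (hb t)) => //.
- split.
  + have -> : (fun x => Re (u s x - u t x)) = (fun x => Re (u s x) - Re (u t x)).
      by apply/funext => x; exact: Re_sub.
    exact: (measurable_funB (mr s) (mr t)).
  + have -> : (fun x => Im (u s x - u t x)) = (fun x => Im (u s x) - Im (u t x)).
      by apply/funext => x; exact: Im_sub.
    exact: (measurable_funB (mi s) (mi t)).
- by apply: (ae_imp2 (ra s) (ra t)) => x <- <-; exact: Re_sub.
- by apply: (ae_imp2 (ib s) (ib t)) => x <- <-; exact: Im_sub.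
Qed.

Lemma H1_curve_parts : continuous_in_H1 u -> H1_curve a ax /\ H1_curve b bx.
Proof.
move=> [_ cu].
have H t e : 0 < e -> exists2 r : R, 0 < r & forall s, `|s - t| < r ->
    N2 (fun x => a s x - a t x) (fun x => ax s x - ax t x) +
    N2 (fun x => b s x - b t x) (fun x => bx s x - bx t x) <= e.
  move=> e0; have s0 : 0 < Num.sqrt e by rewrite sqrtr_gt0.
  have [r /= r0 Hr] := (nbhs_ballP _ _).1 (cvge0_lt (cu t) s0).
  exists r => // s st; have := Hr s; rewrite -ball_normE/= distrC => /(_ st).
  rewrite H1norm_diff lte_fin => h; rewrite -ler_sqrt ?(ltW e0)//; exact: ltW.
split; split => // t e e0; have [r r0 Hr] := H t e e0; exists r => // s /Hr; apply: le_trans.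
  by rewrite lerDl N2_ge0.
by rewrite lerDr N2_ge0.
Qed.

(** Homogeneity transfers the bound from the unit ball to all test functions. The factor
    [1 + N2 p px], used instead of the norm, never vanishes and explains the form of [weak_dt]. *)
Lemma dual_bound (F : (R -> R[i]) -> R[i]) (X Y : (R -> R) -> (R -> R) -> R) (e : R) :
  (Hm1norm F <= e%:E)%E ->
  (forall p px, HS p px -> F (fun x => (p x)%:C%C) = Complex (X p px) (Y p px)) ->
  (forall p px (c : R), HS p px -> X (fun x => c * p x) (fun x => c * px x) = c * X p px /\
     Y (fun x => c * p x) (fun x => c * px x) = c * Y p px) ->
  forall p px, HS p px -> `|X p px| <= e * (1 + N2 p px) /\ `|Y p px| <= e * (1 + N2 p px).
Proof.
move=> Fe FE hom p px hp; have N0 := N2_ge0 p px.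
have n1 : 0 < 1 + N2 p px by lra.
pose c := (1 + N2 p px)^-1; have c0 : 0 < c by rewrite invr_gt0.
(* The scaled function lies in the unit ball of H^1, because [N2 <= (1 + N2)^2]. *)
have hc := HS_scale c hp; have [h1 h2 _ _] := real_test hc.
have le1 : (H1norm (fun x => (c * p x)%:C%C) <= 1)%E.
  rewrite h2 (N2_scale c hp) -[1%E]/(1%:E) lee_fin -[leRHS]sqrtr1; apply: ler_wsqrtr.
  rewrite /c exprVn ler_pdivrMl ?exprn_gt0// mulr1.
  have := sqr_ge0 (N2 p px); nra.
have : ((Normc.normc (F (fun x => (c * p x)%:C%C)))%:E <= e%:E)%E.
  apply: le_trans Fe; apply: ereal_sup_ubound.
  by exists (fun x => (c * p x)%:C%C).
rewrite lee_fin (FE _ _ hc); have [-> ->] := hom p px c hp => Hn.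
have hX : `|c * X p px| <= e by apply: le_trans (Re_le_normc (Complex (c * X p px) (c * Y p px))) Hn.
have hY : `|c * Y p px| <= e by apply: le_trans (Im_le_normc (Complex (c * X p px) (c * Y p px))) Hn.
move: hX hY; rewrite !normrM (gtr0_norm c0) /c !(mulrC _^-1) !ler_pdivrMr//.
Qed.

Let mp (p px : R -> R) : HS p px -> measurable_fun (setT : set (measurableTypeR R)) p.
Proof. by case=> _ []. Qed.

Lemma difference_quotient_parts t h (p px : R -> R) : HS p px ->
  Hm1_of_fun (fun x => (u (t + h) x - u t x) / h%:C%C) (fun x => (p x)%:C%C) =
  Complex (h^-1 * \int[mu]_x ((a (t + h) x - a t x) * p x))
          (h^-1 * \int[mu]_x ((b (t + h) x - b t x) * p x)).
Proof.
move=> hp; have m := mp hp; have [_ sp _] := hp; rewrite /Hm1_of_fun /cintegral.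
have hinv : (h%:C%C)^-1 = (h^-1)%:C%C by rewrite -fmorphV.
congr Complex.
  have i : itg setT (fun x => (a (t + h) x - a t x) * p x).
    by apply: sqi_itgM => //; have [_ []] := HS_sub (ha (t + h)) (ha t).
  rewrite -RintegralZl//.
  have -> : (fun x => Re ((u (t + h) x - u t x) / h%:C%C * (p x)%:C%C)) =
     (fun x => h^-1 * ((Re (u (t + h) x) - Re (u t x)) * p x)).
    by apply/funext => x; rewrite hinv !Re_mul_real mulrAC mulrC Re_sub.
  apply: eq_ae_int => //.
  - apply: measurable_funM => //; apply: measurable_funM => //; exact: measurable_funB.
  - apply: measurable_funM => //; apply: measurable_funM => //; exact: measurable_funB.
  - by apply: (ae_imp2 (ra (t + h)) (ra t)) => x -> ->.
have i : itg setT (fun x => (b (t + h) x - b t x) * p x).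
  by apply: sqi_itgM => //; have [_ []] := HS_sub (hb (t + h)) (hb t).
rewrite -RintegralZl//.
have -> : (fun x => Im ((u (t + h) x - u t x) / h%:C%C * (p x)%:C%C)) =
   (fun x => h^-1 * ((Im (u (t + h) x) - Im (u t x)) * p x)).
  by apply/funext => x; rewrite hinv !Im_mul_real mulrAC mulrC Im_sub.
apply: eq_ae_int => //.
- apply: measurable_funM => //; apply: measurable_funM => //; exact: measurable_funB.
- apply: measurable_funM => //; apply: measurable_funM => //; exact: measurable_funB.
- by apply: (ae_imp2 (ib (t + h)) (ib t)) => x -> ->.
Qed.

Hypothesis dxa : forall t, {ae mu, forall x, Re (dx (u t) x) = ax t x}.
Hypothesis dxb : forall t, {ae mu, forall x, Im (dx (u t) x) = bx t x}.

Lemma dxx_parts t (p px : R -> R) : HS p px ->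
  Hm1_dxx (u t) (fun x => (p x)%:C%C) =
  Complex (- \int[mu]_x (ax t x * px x)) (- \int[mu]_x (bx t x * px x)).
Proof.
move=> hp; have [hq _ rq iq] := real_test hp.
have [[[mdr mdi] _] _] := dx_spec (uH1 t); have [[[mqr mqi] _] _] := dx_spec hq.
have max : measurable_fun (setT : set (measurableTypeR R)) (ax t) by have [_ _ []] := ha t.
have mbx : measurable_fun (setT : set (measurableTypeR R)) (bx t) by have [_ _ []] := hb t.
have mpx : measurable_fun (setT : set (measurableTypeR R)) px by have [_ _ []] := hp.
rewrite /Hm1_dxx /cintegral; apply: complex_eq; rewrite ?Re_opp ?Im_opp /=; congr (- _).
  have -> : (fun x => Re (dx (u t) x * dx (fun x => (p x)%:C%C) x)) = (fun x =>
      Re (dx (u t) x) * Re (dx (fun x => (p x)%:C%C) x) -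
      Im (dx (u t) x) * Im (dx (fun x => (p x)%:C%C) x)).
    by apply/funext => x; exact: Re_mul.
  apply: eq_ae_int => //; [|exact: measurable_funM|].
    by apply: measurable_funB; exact: measurable_funM.
  have rq' := ae_imp2 rq iq (fun x => @conj _ _).
  by apply: (ae_imp2 (dxa t) rq') => x -> [-> ->]; rewrite mulr0 subr0.
have -> : (fun x => Im (dx (u t) x * dx (fun x => (p x)%:C%C) x)) = (fun x =>
    Re (dx (u t) x) * Im (dx (fun x => (p x)%:C%C) x) +
    Im (dx (u t) x) * Re (dx (fun x => (p x)%:C%C) x)).
  by apply/funext => x; exact: Im_mul.
apply: eq_ae_int => //; [|exact: measurable_funM|].
  by apply: measurable_funD; exact: measurable_funM.
have rq' := ae_imp2 rq iq (fun x => @conj _ _).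
by apply: (ae_imp2 (dxb t) rq') => x -> [-> ->]; rewrite mulr0 add0r.
Qed.

Variable f : R -> R.
Hypothesis k_cont : continuous (fun s : R => f (s ^+ 2)).

Lemma nonlinear_parts t (p px : R -> R) : HS p px ->
  Hm1_of_fun (fun x => (f (Normc.normc (u t x) ^+ 2))%:C%C * u t x) (fun x => (p x)%:C%C) =
  Complex (\int[mu]_x (pot f (a t) (b t) x * a t x * p x))
          (\int[mu]_x (pot f (a t) (b t) x * b t x * p x)).
Proof.
move=> hp; have m := mp hp; rewrite /Hm1_of_fun /cintegral.
have mf : measurable_fun (setT : set (measurableTypeR R)) (fun x => f (Normc.normc (u t x) ^+ 2)).
  apply: (@measurableT_comp _ _ _ _ _ _ (fun s : R => f (s ^+ 2)) _ (fun x => Normc.normc (u t x))).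
    by apply: continuous_measurable_fun; exact: k_cont.
  have -> : (fun x => Normc.normc (u t x)) = Num.sqrt \o (fun x => Re (u t x) ^+ 2 + Im (u t x) ^+ 2).
    by apply/funext => x /=; rewrite -normc_sq sqrtr_sqr ger0_norm// normc_nneg.
  apply: measurableT_comp; first by apply: continuous_measurable_fun; exact: sqrt_continuous.
  exact: (sq_measurable (conj (mr t) (mi t))).
have mpot : measurable_fun (setT : set (measurableTypeR R)) (pot f (a t) (b t)).
  by apply: cont_meas => //; apply: pot_meas => //; [case: (ha t) => /ac_cont|case: (hb t) => /ac_cont].
have E := ae_imp2 (ra t) (ib t) (fun x => @conj _ _).
congr Complex.
  have -> : (fun x => Re ((f (Normc.normc (u t x) ^+ 2))%:C%C * u t x * (p x)%:C%C)) =
      (fun x => f (Normc.normc (u t x) ^+ 2) * Re (u t x) * p x).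
    by apply/funext => x; rewrite Re_mul_real mulrC [_ * u t x]mulrC Re_mul_real; ring.
  apply: eq_ae_int => //.
  - by apply: measurable_funM => //; exact: measurable_funM.
  - by apply: measurable_funM => //; exact: measurable_funM.
  - by apply: (ae_imp E) => x [ea eb]; rewrite normc_sq ea eb.
have -> : (fun x => Im ((f (Normc.normc (u t x) ^+ 2))%:C%C * u t x * (p x)%:C%C)) =
    (fun x => f (Normc.normc (u t x) ^+ 2) * Im (u t x) * p x).
  by apply/funext => x; rewrite Im_mul_real mulrC [_ * u t x]mulrC Im_mul_real; ring.
apply: eq_ae_int => //.
- by apply: measurable_funM => //; exact: measurable_funM.
- by apply: measurable_funM => //; exact: measurable_funM.
- by apply: (ae_imp E) => x [ea eb]; rewrite normc_sq ea eb.
Qed.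

Lemma pairing_scale (q p : R -> R) (c : R) : sqi setT q -> sqi setT p ->
  \int[mu]_x (q x * (c * p x)) = c * \int[mu]_x (q x * p x).
Proof.
move=> sq sp; have i := sqi_itgM measurableT sq sp; rewrite -RintegralZl//.
by apply: eq_int => x _; ring.
Qed.

Lemma weak_dt_parts t : solves_NLS f u ->
  weak_dt a t (bx t) (fun x => pot f (a t) (b t) x * b t x) /\
  weak_dt b t (fun x => - ax t x) (fun x => - (pot f (a t) (b t) x * a t x)).
Proof.
move=> sol; have [T [_ lim] eqT] := sol t.
have [_ sa sax] := ha t; have [_ sb sbx] := hb t.
have spa := pot_sqi k_cont (ha t) (hb t) sa; have spb := pot_sqi k_cont (ha t) (hb t) sb.
pose A p px := \int[mu]_x (ax t x * px x) + \int[mu]_x (pot f (a t) (b t) x * a t x * p x).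
pose B p px := \int[mu]_x (bx t x * px x) + \int[mu]_x (pot f (a t) (b t) x * b t x * p x).
(* Multiplication by [i] turns a value [x + i y] of the time derivative into [- y + i x]; hence the
   exchange of the two parts and the sign. *)
have TE (p px : R -> R) : HS p px -> T (fun x => (p x)%:C%C) = Complex (B p px) (- A p px).
  move=> hp; have [hq _ _ _] := real_test hp.
  have := eqT _ hq; rewrite (dxx_parts t hp) (nonlinear_parts t hp) /A /B.
  case: (T _) => x y /=; move: (\int[mu]_x (ax t x * px x)) (\int[mu]_x (bx t x * px x)).
  move: (\int[mu]_x (pot f (a t) (b t) x * a t x * p x))
    (\int[mu]_x (pot f (a t) (b t) x * b t x * p x)) => P Q I J [h1 h2].
  by congr Complex; lra.
have key e : 0 < e -> exists2 r : R, 0 < r & forall h : R, h != 0 -> `|h| < r ->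
    forall p px, HS p px ->
    `|h^-1 * \int[mu]_x ((a (t + h) x - a t x) * p x) - B p px| <= e * (1 + N2 p px) /\
    `|h^-1 * \int[mu]_x ((b (t + h) x - b t x) * p x) + A p px| <= e * (1 + N2 p px).
  move=> e0; have [r /= r0 Hr] := (nbhs_ballP _ _).1 (cvge0_lt lim e0).
  exists r => // h h0 hr.
  have := Hr h; rewrite -ball_normE/= sub0r normrN => /(_ hr h0) /ltW Hh.
  apply: (dual_bound Hh).
    move=> p px hp; rewrite (difference_quotient_parts t h hp) (TE _ _ hp).
    by apply: complex_eq; rewrite ?Re_sub ?Im_sub //= opprK.
  move=> p px c hp; have [_ sp spx] := hp.
  have [_ sda _] := HS_sub (ha (t + h)) (ha t); have [_ sdb _] := HS_sub (hb (t + h)) (hb t).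
  rewrite /A /B (pairing_scale c sda sp) (pairing_scale c sdb sp).
  rewrite (pairing_scale c sax spx) (pairing_scale c sbx spx).
  rewrite (pairing_scale c spa sp) (pairing_scale c spb sp).
  by split; ring.
split => e e0; have [r r0 Hr] := key e e0; exists r => // h h0 hr p px hp.
  exact: (Hr h h0 hr p px hp).1.
have [_ sp spx] := hp.
have i1 := sqi_itgM measurableT sax spx; have i2 := sqi_itgM measurableT spa sp.
have -> : \int[mu]_x (- ax t x * px x) + \int[mu]_x (- (pot f (a t) (b t) x * a t x) * p x) = - A p px.
  rewrite /A opprD -(intN measurableT i1) -(intN measurableT i2).
  by congr (_ + _); apply: eq_int => x _; ring.
by rewrite opprK; exact: (Hr h h0 hr p px hp).2.
Qed.

End solution_parts.

(** * Local norms and the transfer to complex solutions *)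

Section local_norms.
Variable R : realType.
Local Notation mu := (@lebesgue_measure R).
Local Notation Re := complex.Re.
Local Notation Im := complex.Im.
Implicit Types (I : set (measurableTypeR R)) (g : R -> R[i]).

Lemma Lpnorm_on2_le I g (n d : R) : measurable I -> I `<=` `[- n, n] -> 0 <= n -> cmeasurable g ->
  0 <= d -> {ae mu, forall x, I x -> Normc.normc (g x) ^+ 2 <= d} ->
  (Lpnorm_on I 2%:E g <= (Num.sqrt (2 * n * d))%:E)%E.
Proof.
move=> mI In n0 mg d0 gd; rewrite /Lpnorm_on unlock.
have -> : (\int[mu]_x `|((EFin \o @Normc.normc R \o g) \_ I) x| `^ 2 =
    \int[mu]_(x in I) (Normc.normc (g x) ^+ 2)%:E)%E.
  rewrite [RHS]integral_mkcond; apply: eq_integral => x _; rewrite !patchE.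
  by case: ifPn => _ /=; rewrite abs_pow2// expr0n.
have le1 : (\int[mu]_(x in I) (Normc.normc (g x) ^+ 2)%:E <= (2 * n * d)%:E)%E.
  apply: (@le_trans _ _ (\int[mu]_(x in I) d%:E)%E).
    apply: ae_ge0_le_integral => //.
    - by move=> x _; rewrite lee_fin sqr_ge0.
    - apply/measurable_EFinP; under eq_fun do rewrite normc_sq.
      by apply: measurable_funTS; exact: sq_measurable.
  rewrite integral_cst// muleC EFinM.
  apply: lee_wpmul2r; first by rewrite lee_fin.
  apply: (@le_trans _ _ (mu `[- n, n]%classic)).
    by apply: le_measure; rewrite ?inE//.
  rewrite lebesgue_measure_itv/= lte_fin; case: ifPn => _; last by rewrite lee_fin mulr_ge0.
  by rewrite -EFinD lee_fin; lra.
have := @gt0_ler_poweR R 2^-1 _ _ _ _ _ le1.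
rewrite poweR_EFin powR12_sqrt; last by rewrite !mulr_ge0.
apply => //.
  rewrite in_itv/= leey andbT; apply: integral_ge0 => x _; rewrite lee_fin sqr_ge0//.
by rewrite in_itv/= leey andbT lee_fin !mulr_ge0.
Qed.

Lemma Lpnorm_ony_le I g (d : R) : 0 <= d ->
  {ae mu, forall x, I x -> Normc.normc (g x) ^+ 2 <= d} ->
  (Lpnorm_on I +oo%E g <= (Num.sqrt d)%:E)%E.
Proof.
move=> d0 gd; rewrite /Lpnorm_on unlock; case: ifPn => _; last by rewrite lee_fin sqrtr_ge0.
apply/ess_supP; apply: (ae_imp gd) => x h /=; rewrite patchE; case: ifPn => [xI|_].
  rewrite /= lee_fin ger0_norm ?normc_nneg// -[leLHS]ger0_norm ?normc_nneg// -sqrtr_sqr.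
  by apply: ler_wsqrtr; apply: h; move: xI; rewrite inE.
by rewrite abse0 lee_fin sqrtr_ge0.
Qed.

Lemma Lpnorm_on_ge0 I (q : \bar R) g : (0 <= Lpnorm_on I q g)%E.
Proof. exact: Lnorm_ge0. Qed.

Lemma cvg_pinfty_0 (F : R -> \bar R) : (forall t, 0 <= F t)%E ->
  (forall e : R, 0 < e -> exists T, forall t, T <= t -> (F t <= e%:E)%E) -> F t @[t --> +oo] --> 0%E.
Proof.
move=> F0 H0; have fin T e : (forall t, T <= t -> (F t <= e%:E)%E) -> forall t, T <= t -> F t \is a fin_num.
  move=> H t /H h; rewrite fin_numElt; apply/andP; split.
    by apply: lt_le_trans (F0 t); exact: ltNyr.
  by apply: le_lt_trans h _; exact: ltry.
apply/fine_cvgP; split.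
  have [T HT] := H0 1 ltr01; exists T; split; first exact: num_real.
  by move=> t /ltW; exact: fin HT t.
apply/cvgrPdist_le => e e0; have [T HT] := H0 e e0; exists T; split; first exact: num_real.
move=> t /ltW Tt; rewrite /= sub0r normrN ger0_norm; last exact: fine_ge0.
by rewrite -lee_fin fineK; [exact: HT|exact: fin HT t Tt].
Qed.

Lemma locally_decays_of_real (a b : R -> R -> R) (u : R -> R -> R[i]) :
  (forall t, cmeasurable (u t)) ->
  (forall t, {ae mu, forall x, Re (u t x) = a t x}) ->
  (forall t, {ae mu, forall x, Im (u t x) = b t x}) ->
  real_decay a b -> locally_decays u.
Proof.
move=> mu_ ra ib dec I itvI [M [_ HM]].
have mI : measurable (I : set (measurableTypeR R)) by exact: is_interval_measurable.
have [n [n0 In]] : exists n : R, 0 <= n /\ forall x, I x -> `|x| <= n.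
  exists (`|M| + 1); split; first by rewrite addr_ge0.
  by move=> x Ix; apply: (HM (`|M| + 1)) => //; rewrite (le_lt_trans (ler_norm M))// ltrDl.
apply: cvg_pinfty_0 => [t|e e0].
  by apply: adde_ge0; exact: Lpnorm_on_ge0.
have s0 := sqrtr_ge0 (2 * n).
have s1 : 0 < Num.sqrt (2 * n) + 1 by lra.
(* A density at most [c^2] on [[- n, n]] bounds the local L^2 norm by [c sqrt(2 n)] and the local
   supremum norm by [c]. *)
have [c [c0 cE]] : exists c : R, 0 < c /\ c * (Num.sqrt (2 * n) + 1) = e.
  by exists (e / (Num.sqrt (2 * n) + 1)); split; [exact: divr_gt0|rewrite divfK// gt_eqF].
have [T HT] := dec n (c ^+ 2) (exprn_gt0 _ c0).
exists T => t /HT h.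
have gd : {ae mu, forall x, I x -> Normc.normc (u t x) ^+ 2 <= c ^+ 2}.
  by apply: (ae_imp2 (ra t) (ib t)) => x ea eb /In /h; rewrite normc_sq ea eb.
have IM : I `<=` `[- n, n]%classic.
  by move=> x /In; rewrite ler_norml /= in_itv.
apply: le_trans (leeD (Lpnorm_on2_le mI IM n0 (mu_ t) (sqr_ge0 c) gd) (Lpnorm_ony_le (sqr_ge0 c) gd)) _.
rewrite -EFinD lee_fin sqrtrM ?mulr_ge0// sqrtr_sqr gtr0_norm// -cE mulrDr mulr1.
by rewrite [_ * c]mulrC.
Qed.

(** Oddness of [u t] holds only almost everywhere. Reflection preserves null sets, and continuity of
    the representative turns the identity into a pointwise one, as needed for its zero at the
    origin. *)
Lemma real_parts_odd (a : R -> R -> R) (u : R -> R -> R[i]) (P : R[i] -> R) (t : R) :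
  (forall z, P (- z) = - P z) -> continuous (a t) -> {ae mu, forall x, P (u t x) = a t x} ->
  {ae mu, forall x, u t (- x) = - u t x} -> forall x, a t (- x) = - a t x.
Proof.
move=> PN ca ra od x; apply/eqP; rewrite -addr_eq0; apply/eqP; move: x; apply: ae_eq_cont.
  move=> x; apply: cvgD; last exact: ca.
  by apply: continuous_comp; [exact: opp_continuous|exact: ca].
have ra' := ae_reflect ra.
have od' := ae_imp2 ra od (fun x => @conj _ _).
by apply: (ae_imp2 ra' od') => x <- [<- ->]; rewrite PN addNr.
Qed.

Theorem real_solution_of_global f u : locally_lipschitz (fun s : R => f (s ^+ 2)) ->
  global_odd_H1_solution f u ->
  exists a ax b bx, [/\ odd_real_solution f a ax b bx,
    forall t, {ae mu, forall x, Re (u t x) = a t x},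
    forall t, {ae mu, forall x, Im (u t x) = b t x} &
    H1norm (u 0) = (Num.sqrt (H1sq a ax b bx 0))%:E].
Proof.
move=> flip [cu sol od]; have kc := locally_lipschitz_cont flip; have [uH _] := cu.
(* The derivatives are prescribed as the parts of [dx (u t)], so only the pair of continuous
   representatives is chosen at each time. *)
have [c Hc] := @choice R ((R -> R) * (R -> R)) (fun t (q : (R -> R) * (R -> R)) =>
    [/\ HS q.1 (fun x => Re (dx (u t) x)), HS q.2 (fun x => Im (dx (u t) x)),
      {ae mu, forall x, Re (u t x) = q.1 x} & {ae mu, forall x, Im (u t x) = q.2 x}])
  (fun t => let: ex_intro a (ex_intro b H) := H1_representative (uH t) in ex_intro _ (a, b) H).
pose a t := (c t).1; pose b t := (c t).2.
pose ax t x := Re (dx (u t) x); pose bx t x := Im (dx (u t) x).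
have ha t : HS (a t) (ax t) by case: (Hc t).
have hb t : HS (b t) (bx t) by case: (Hc t).
have ra t : {ae mu, forall x, Re (u t x) = a t x} by case: (Hc t).
have ib t : {ae mu, forall x, Im (u t x) = b t x} by case: (Hc t).
have dxa t : {ae mu, forall x, Re (dx (u t) x) = ax t x} by exact: aeW.
have dxb t : {ae mu, forall x, Im (dx (u t) x) = bx t x} by exact: aeW.
have [ca cb] := H1_curve_parts ha hb ra ib uH cu.
have W t := weak_dt_parts ha hb ra ib uH dxa dxb kc t sol.
exists a, ax, b, bx; split => //.
  split.
  - by split=> // t; case: (W t).
  - move=> t; by apply: (real_parts_odd (@Re_opp R) _ (ra t) (od t)); case: (ha t) => /ac_cont.
  - move=> t; by apply: (real_parts_odd (@Im_opp R) _ (ib t) (od t)); case: (hb t) => /ac_cont.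
have [[mg _] _] := uH 0.
by have [_ -> _ _] := H1_of_representative mg (ha 0) (hb 0) (ra 0) (ib 0).
Qed.

End local_norms.

Theorem theorem1p1 (R : realType) (p : R) (f : R -> R)
    (p_gt1 : 1 < p) (p_lt5 : p < 5)
    (f_growth : exists C : R, forall s : R, 0 <= s ->
       `|f s| <= C * s `^ ((p - 1) / 2))
    (f_lip : locally_lipschitz (fun s : R => f (s ^+ 2))) :
  (exists2 eps : R, 0 < eps &
     forall u, global_odd_H1_solution f u ->
       (H1norm (u 0%R) <= eps%:E)%E -> locally_decays u) /\
  ((forall s : R, 0 <= s -> f s = s `^ ((p - 1) / 2)) ->
     forall u, global_odd_H1_solution f u -> locally_decays u).
Proof.
(* The range of [p] is used through the exponent: positivity forces [f 0 = 0], and the bound by 2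
   keeps the potential energy below mass times gradient. *)
have be0 : 0 < (p - 1) / 2 by lra.
have be2 : (p - 1) / 2 <= 2 by lra.
split.
  have [C fC] := f_growth.
  have fC' s : 0 <= s -> `|f s| <= `|C| * s `^ ((p - 1) / 2).
    by move=> s0; apply: le_trans (fC s s0) _; apply: ler_wpM2r; [exact: powR_ge0|exact: ler_norm].
  have be : 0 < (p - 1) / 2 <= 2 by rewrite be0 be2.
  have [d d0 Hd] := small_decay f_lip be (normr_ge0 C) fC'.
  (* [small_decay] bounds the square of the H^1 norm. *)
  exists (Num.sqrt d); first by rewrite sqrtr_gt0.
  move=> u hu; have [a [ax [b [bx [osol ra ib N0]]]]] := real_solution_of_global f_lip hu.
  rewrite N0 lee_fin ler_sqrt ?(ltW d0)// => /(Hd _ _ _ _ osol).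
  apply: locally_decays_of_real => // t.
  by have [[uH _] _ _] := hu; have [[]] := uH t.
move=> fE u hu; have [a [ax [b [bx [osol ra ib _]]]]] := real_solution_of_global f_lip hu.
apply: (locally_decays_of_real _ ra ib).
  by move=> t; have [[uH _] _ _] := hu; have [[]] := uH t.
apply: (defocusing_decay f_lip _ _ osol).
  by move=> s s0; rewrite fE// powR_ge0.
move=> x y x0 y0 xy; rewrite !fE//; apply: ge0_ler_powR => //; exact: ltW.
Qed.
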